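(* Let $d\ge 2$ and let $X,X_1,X_2,\ldots$ be i.i.d. $\mathbb{R}^d$-valued random vectors with a spherically symmetric distribution such that $$\mathbb{P}(|X|>x)=e^{-g(x)+o(1)}\qquad\text{as } x\to\infty,$$ for some twice differentiable function $g$ such that, as $x\to\infty$, $$xg'(x)\to\infty\qquad\text{and}\qquad \frac{g''(x)}{g'(x)^2}\log^2\bigl(xg'(x)\bigr)\to 0.$$ Suppose further that $(a_n)$ and $(b_n)$ are sequences such that, as $n\to\infty$, $a_n\to\infty$ and $$g(a_n)=\log n+o(1),\qquad b_n=\frac{1+o\bigl(1/\log(a_ng'(a_n))\bigr)}{g'(a_n)}.$$ Let $M^{(2)}_n:=\max_{1\le i<j\le n}|X_i-X_j|$ and $c_d:=(d-1)2^{d-4}\Gamma(d/2)/\sqrt{\pi}$. Then, as $n\to\infty$, $$\frac{M^{(2)}_n-2a_n}{b_n}+\frac{d-1}{2}\log\frac{a_n}{b_n}-\log\log\frac{a_n}{b_n}-\log c_d\ \stackrel{d}{\longrightarrow}\ V,$$ where $V$ has the Gumbel distribution $\mathbb{P}(V\le x)=e^{-e^{-x}}$, $x\in\mathbb{R}$.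
   Context: $|\cdot|$ is the Euclidean norm on $\mathbb{R}^d$. $\stackrel{d}{\longrightarrow}$ denotes convergence in distribution. $g$ is a real-valued function of a real variable $x$; only its behaviour for large $x$ matters. $\log^2(y)$ means $(\log y)^2$. Expressions such as $\log\log(a_n/b_n)$ are considered for $n$ large enough that they are defined. *)

(* Defs.v *)
From HB Require Import structures.
From mathcomp Require Import all_boot all_order all_algebra finmap.
From mathcomp Require Import all_classical all_reals all_analysis.

Set Implicit Arguments.
Unset Strict Implicit.
Unset Printing Implicit Defensive.

Import Order.TTheory GRing.Theory Num.Theory.
Import numFieldNormedType.Exports.

Local Open Scope classical_set_scope.
Local Open Scope ring_scope.

(* The norm `|x| that the library puts on row vectors is the sup norm; it
   induces the same topology, but only [enorm] is the Euclidean norm. *)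
Definition enorm (R : realType) (d : nat) (x : 'rV[R]_d) : R :=
  Num.sqrt (\sum_(i < d) (x ord0 i) ^+ 2).

(* R^d with its Borel sigma-algebra. *)
Notation borel_rV R d := (g_sigma_algebraType (@open 'rV[R]_d)).

Section random_elements.
Context d (T : measurableType d) (R : realType) (P : probability T R).

Definition same_distribution d1 (E : measurableType d1) (X Y : {RV P >-> E}) :=
  forall A : set E, measurable A -> distribution P X A = distribution P Y A.

(* Mutual independence of the whole sequence: the product rule holds for every
   finite subfamily. *)
Definition independent_sequence d1 (E : measurableType d1)
    (X : nat -> {RV P >-> E}) :=
  forall (J : {fset nat}) (A : nat -> set E),
    (forall i, measurable (A i)) ->
    P (\bigcap_(i in [set` J]) X i @^-1` A i) =
    (\prod_(i <- J) P (X i @^-1` A i))%E.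

(* The law of X is invariant under every linear isometry of R^d; vectors being
   rows, these are the maps x |-> x *m Q with Q orthogonal. *)
Definition spherically_symmetric (n : nat) (X : {RV P >-> borel_rV R n}) :=
  forall Q : 'M[R]_n, Q *m Q^T = 1%:M ->
  forall A : set (borel_rV R n), measurable A ->
    distribution P X [set x | A ((x : 'rV[R]_n) *m Q)] = distribution P X A.

(* Since distances are nonnegative, the default value 0 of the maximum only
   matters when there is no pair (n < 2). *)
Definition max_interpoint_dist (k : nat) (X : nat -> {RV P >-> borel_rV R k})
    (n : nat) (t : T) : R :=
  \big[Num.max/0]_(p : 'I_n * 'I_n | (p.1 < p.2)%N)
    enorm ((X p.1 t : 'rV[R]_k) - (X p.2 t : 'rV[R]_k)).

(* The variables Z n and the limit V may live on different probability
   spaces. *)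
Definition cvg_in_distribution (Z : nat -> T -> R)
    d' (T' : measurableType d') (Q : probability T' R) (V : {RV Q >-> R}) :=
  (forall n, measurable_fun setT (Z n)) /\
  forall x : R, {for x, continuous (cdf V)} ->
    P [set t | Z n t <= x] @[n --> \oo] --> cdf V x.

End random_elements.

Definition Gumbel d (T : measurableType d) (R : realType)
    (P : probability T R) (V : {RV P >-> R}) :=
  forall x : R, cdf V x = (expR (- expR (- x)))%:E.

Definition Gamma (R : realType) (s : R) : R :=
  \int[lebesgue_measure]_(x in `]0, +oo[) (x `^ (s - 1) * expR (- x)).

Definition c_ (R : realType) (d : nat) : R :=
  (d%:R - 1) * 2 ^ (d%:Z - 4) * Gamma (d%:R / 2) / Num.sqrt pi.

(* Main.v *)
Require Import Defs.
From HB Require Import structures.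
From mathcomp Require Import all_boot all_order all_algebra finmap.
From mathcomp Require Import all_classical all_reals all_analysis measurable_realfun.
From mathcomp Require Import ring lra zify.

Set Implicit Arguments.
Unset Strict Implicit.
Unset Printing Implicit Defensive.

Import Order.TTheory GRing.Theory Num.Theory.
Import numFieldNormedType.Exports.

Local Open Scope classical_set_scope.
Local Open Scope ring_scope.

(** Call a pair of sample points an edge if its distance exceeds the level
    [2 a + b y], where [y] is chosen such that the normalized maximum is at most
    [x] exactly when there is no edge. The number of edges is asymptotically
    Poisson with mean [exp (- x)], whence the Gumbel limit.

    Radii. The hypotheses on [g] say that the derivative of [g] is nearly
    constant on the scale that matters, so that [n P(|X| > a + b t)] is close
    to [exp (- t)] uniformly for [|t|] of order [ell = ln (a / b)]
    ([tail_uniform]). On that scale the rescaled radii resemble a Poisson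
    process of intensity [exp (- t) dt].

    Directions. Two points at rescaled radii [s] and [t] whose directions are
    nearly opposite, at angle of cosine [- c], form an edge if, to first order,
    [s + t > y + lam (1 - c)] with [lam = a / (2 b)]. As radius and direction
    are independent ([polar_independence]), given a point at [t] the mean
    number of edges at this point is [exp (t - y) * L(lam)], where [L] is the
    Laplace transform of [1 - c] for a uniform direction ([section_upper],
    [section_lower]). The even moments of a direction cosine satisfy a
    recursion that follows from rotation invariance ([moment_succ]); solved by
    Gaussian moments, it gives
    [L(lam) ~ 2 ^ alpha Gamma(d / 2) / (2 sqrt pi) * lam ^ (- alpha)] with
    [alpha = (d - 1) / 2] ([lap_asymptotic]).

    Mean. Integrating over the radius [t], the factors [exp t] and
    [exp (- t) dt] cancel, and every [t] between about [y] and 0 contributes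
    equally. Since [y] is about [- alpha ell], the mean is proportional to
    [ell * exp (- y) * L(lam)], and the normalization is the one that makes its
    limit [exp (- x)] ([pair_mean_cvg]).

    Poisson limit. A point at rescaled radius [t] belongs to about
    [exp t / ell] edges, so edges cluster at points of very large radius, which
    are rare but dominate the second moment. Therefore edges are only counted
    between points of radius at most [a + b A]; points beyond exist with
    probability about [exp (- A)]. For the truncated edges, the mean number of
    pairs of edges at a common point is of order [1 / ell]
    ([triple_mean_cvg0]), and adding one pair at a time gives nearly the same
    probability [(1 - p) ^ (n (n - 1) / 2)] of no edge as for independent pairs
    ([no_edge_binomial]). Finally [A] tends to infinity. *)

(** * Independence of blocks of a sequence *)

Section block_independence.
Context d (T : measurableType d) (R : realType) (P : probability T R).
Context d1 (E : measurableType d1) (X : nat -> {RV P >-> E}).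

(** A pi-system that generates the sigma-algebra of the coordinates in [J], on
    which independence is the product rule for finite subfamilies. *)
Definition cylinder (J : {fset nat}) : set (set T) :=
  [set C | exists2 B : nat -> set E, (forall i, measurable (B i)) &
     C = \bigcap_(i in [set` J]) X i @^-1` B i].

Lemma measurable_rv_preimage (i : nat) (B : set E) :
  measurable B -> measurable (X i @^-1` B).
Proof. by move=> mB; rewrite -[_ @^-1` _]setTI; exact: measurable_funPT. Qed.

Lemma cylinder_measurable J : cylinder J `<=` measurable.
Proof.
move=> _ [B mB ->]; apply: fin_bigcap_measurable => [|i _].
  exact: finite_fset.
exact: measurable_rv_preimage.
Qed.

Lemma cylinder_setI J : setI_closed (cylinder J).
Proof.
move=> _ _ [A mA ->] [B mB ->]; exists (fun i => A i `&` B i).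
  by move=> i; exact: measurableI.
by rewrite bigcapI.
Qed.

Lemma cylinder_setT J : cylinder J setT.
Proof.
exists (fun=> setT); first by move=> _; exact: measurableT.
by apply/seteqP; split => // t _ i _.
Qed.

Hypothesis X_indep : independent_sequence X.

Lemma cylinder_indep (I J : {fset nat}) A B : [disjoint I & J]%fset ->
  cylinder I A -> cylinder J B -> P (A `&` B) = (P A * P B)%E.
Proof.
move=> /fdisjointP IJ [A' mA ->] [B' mB ->].
pose C i := if i \in I then A' i else B' i.
have mC i : measurable (C i) by rewrite /C; case: ifP.
have -> : \bigcap_(i in [set` I]) X i @^-1` A' i `&`
    \bigcap_(i in [set` J]) X i @^-1` B' i =
    \bigcap_(i in [set` (I `|` J)%fset]) X i @^-1` C i.
  apply/seteqP; split => t.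
    move=> [tA tB] i /=; rewrite inE /C => /orP[iI|iJ].
      by rewrite iI; exact: tA.
    case: ifP => [iI|_]; first exact: tA.
    exact: tB.
  move=> tC; split => i /= iI.
    by have := tC i; rewrite /C /= inE iI; exact.
  have := tC i; rewrite /C /= inE iI orbT => /(_ isT).
  case: ifPn => // /IJ; by rewrite iI.
rewrite !X_indep// -big_filter.
have Ip : perm_eq (enum_fset (I `|` J)%fset) (enum_fset I ++ enum_fset J).
  apply: uniq_perm; rewrite ?fset_uniq//.
    rewrite cat_uniq !fset_uniq/= andbT; apply/hasPn => i iJ.
    by apply/negP => iI; have := IJ i iI; rewrite iJ.
  by move=> i; rewrite mem_cat in_fsetU.
rewrite big_filter (perm_big _ Ip)/= big_cat/=; congr (_ * _)%E.
  by rewrite big_seq [RHS]big_seq; apply: eq_bigr => i iI; rewrite /C ifT.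
rewrite big_seq [RHS]big_seq; apply: eq_bigr => i iJ; rewrite /C ifF//.
by apply/negP => /IJ; rewrite iJ.
Qed.

(** For fixed [B], both [P (- `&` B)] and [P B * P -] are finite measures; they
    agree on the pi-system [G], hence on the sigma-algebra that it generates. *)
Lemma indep_extend (G : set (set T)) (B : set T) : G `<=` measurable ->
  setI_closed G -> G setT -> measurable B ->
  (forall A, G A -> P (A `&` B) = (P A * P B)%E) ->
  forall A, <<s G >> A -> P (A `&` B) = (P A * P B)%E.
Proof.
move=> mG GI GT mB GB A sGA.
pose r : {nonneg R} := NngNum (fine_ge0 (measure_ge0 P B)).
have PBE : P B = (r%:num)%:E by rewrite /r/= fineK// fin_num_measure.
have := @g_sigma_algebra_measure_unique _ _ _ G mG (fun=> setT) _ _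
  (mrestr P mB) (mscale r P) GI _ _ A sGA.
rewrite /= /mrestr /mscale PBE muleC; apply => //.
- by rewrite bigcup_const.
- by move=> C GC; rewrite /mrestr /mscale GB// PBE muleC.
- by move=> _; rewrite /mrestr setTI PBE ltry.
Qed.

(** The extension from cylinders is applied twice, once for each block. *)
Lemma block_indep (I J : {fset nat}) A B : [disjoint I & J]%fset ->
  <<s cylinder I >> A -> <<s cylinder J >> B -> P (A `&` B) = (P A * P B)%E.
Proof.
move=> IJ sA sB.
have mB : measurable B.
  by apply: (smallest_sub (@sigma_algebra_measurable _ T) _ sB);
     exact: cylinder_measurable.
apply: (@indep_extend (cylinder I) B) => //.
- exact: cylinder_measurable.
- exact: cylinder_setI.
- exact: cylinder_setT.
move=> C IC; rewrite setIC muleC.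
apply: (@indep_extend (cylinder J) C) => //.
- exact: cylinder_measurable.
- exact: cylinder_setI.
- exact: cylinder_setT.
- exact: cylinder_measurable IC.
- by move=> D JD; rewrite setIC muleC; exact: cylinder_indep IJ _ _.
Qed.

Lemma cylinder_coord (I : {fset nat}) i : i \in I ->
  measurable_fun setT (X i : g_sigma_algebraType (cylinder I) -> E).
Proof.
move=> iI _ B mB; rewrite setTI; apply: sub_sigma_algebra.
exists (fun j => if j == i then B else setT).
  by move=> j; case: ifP => _ //; exact: measurableT.
apply/seteqP; split => t /=.
  by move=> tB j _ /=; case: eqP => [->|].
by move=> /(_ i iI) /=; rewrite eqxx.
Qed.

End block_independence.

(** * Absence of weakly dependent events *)

Section dissociated_events.
Context d (T : measurableType d) (R : realType) (P : probability T R).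
Context (I : eqType) (A : I -> set T) (mA : forall i, measurable (A i)).

Local Notation pr B := (fine (P B)).

Lemma pr_EFin (B : set T) : measurable B -> (pr B)%:E = P B.
Proof. by move=> mB; rewrite fineK// fin_num_measure. Qed.

Lemma pr_le1 (B : set T) : measurable B -> pr B <= 1.
Proof. by move=> mB; rewrite -lee_fin pr_EFin// probability_le1. Qed.

Lemma le_pr (B C : set T) : measurable B -> measurable C ->
  B `<=` C -> pr B <= pr C.
Proof.
by move=> mB mC BC; rewrite -lee_fin !pr_EFin//; apply: le_measure; rewrite ?inE.
Qed.

Lemma prID (B C : set T) : measurable B -> measurable C ->
  pr B = pr (B `&` C) + pr (B `&` ~` C).
Proof.
move=> mB mC; apply: EFin_inj; rewrite EFinD !pr_EFin//; last 2 first.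
- by apply: measurableI => //; exact: measurableC.
- exact: measurableI.
rewrite -measureU//; last 3 first.
- exact: measurableI.
- by apply: measurableI => //; exact: measurableC.
- by rewrite setIACA setICr setI0.
by rewrite -setIUr setUCr setIT.
Qed.

Definition none (s : seq I) : set T := [set t | forall i, i \in s -> ~ A i t].

Lemma none_nil : none [::] = setT.
Proof. by apply/seteqP; split => // t _ i; rewrite in_nil. Qed.

Lemma none_cons i s : none (i :: s) = none s `&` ~` A i.
Proof.
apply/seteqP; split => t.
  move=> ni; split; last by apply: ni; rewrite mem_head.
  by move=> j js; apply: ni; rewrite in_cons js orbT.
by move=> [ns ni] j; rewrite in_cons => /orP[/eqP->//|]; exact: ns.
Qed.

Lemma none_filter (a : pred I) s :
  none s = none [seq i <- s | ~~ a i] `&` none [seq i <- s | a i].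
Proof.
apply/seteqP; split => t.
  by move=> ns; split => i; rewrite mem_filter => /andP[_]; exact: ns.
by move=> [n1 n2] i si; case: (boolP (a i)) => ai; [apply: n2|apply: n1];
  rewrite mem_filter ai.
Qed.

Lemma measurable_none s : measurable (none s).
Proof.
elim: s => [|i s IHs]; first by rewrite none_nil; exact: measurableT.
by rewrite none_cons; apply: measurableI => //; exact: measurableC.
Qed.

Lemma pr_none_ge (B : set T) s : measurable B ->
  pr B <= pr (B `&` none s) + \sum_(i <- s) pr (B `&` A i).
Proof.
move=> mB; elim: s => [|i s IHs]; first by rewrite none_nil setIT big_nil addr0.
rewrite big_cons none_cons (le_trans IHs)// [X in _ <= X]addrA lerD2r.
have mBn : measurable (B `&` none s).
  by apply: measurableI => //; exact: measurable_none.
rewrite (prID mBn (mA i)) -setIA addrC lerD// -?setIA//.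
apply: le_pr.
- by do 2 (apply: measurableI => //); exact: measurable_none.
- exact: measurableI.
- by move=> t [? []].
Qed.

Variables (touch : rel I) (p q : R) (D : nat).
Hypotheses (p_ge0 : 0 <= p) (p_le1 : p <= 1) (q_ge0 : 0 <= q).

(** Adding one event [A e]. Let [far] be the absence of the events of [s] that
    do not touch [e], so that [A e] and [far] are independent. The absence of
    all the events of [s] differs from [far] by at most [D] touching events:
    inside [A e] this costs [D * q], and replacing [p * pr far] by
    [p * pr (none s)] costs [D * p ^+ 2]. *)
Lemma pr_none_cons (e : I) (s : seq I) :
  pr (A e) = p ->
  {in s, forall i, pr (A i) = p} ->
  {in s, forall i, touch e i -> pr (A e `&` A i) <= q} ->
  (let far := none [seq i <- s | ~~ touch e i] in
     pr (A e `&` far) = p * pr far) ->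
  (size [seq i <- s | touch e i] <= D)%N ->
  `|pr (none (e :: s)) - (1 - p) * pr (none s)| <= D%:R * (q + p ^+ 2).
Proof.
move=> Ae Ap Aq far sD.
set l := [seq i <- s | touch e i] in sD.
set H := none [seq i <- s | ~~ touch e i] in far.
have mn := measurable_none.
have nsE : none s = H `&` none l := none_filter (touch e) s.
have e1 := prID (mn s) (mA e).
have le1 : pr (none s `&` A e) <= pr (A e `&` H).
  apply: le_pr; [exact: measurableI|by apply: measurableI => //; exact: mn|].
  by rewrite nsE => t [[]].
have le2 : pr (A e `&` H) <= pr (none s `&` A e) + D%:R * q.
  apply: le_trans (pr_none_ge l _) _; first by apply: measurableI => //; exact: mn.
  rewrite -setIA -nsE setIC lerD2l.
  apply: (@le_trans _ _ (\sum_(i <- l) q)).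
    rewrite big_seq [leRHS]big_seq; apply: ler_sum => i.
    rewrite mem_filter => /andP[tei si]; apply: le_trans (Aq i si tei).
    apply: le_pr; [|exact: measurableI|by move=> t [[]]].
    by do 2 (apply: measurableI => //); exact: mn.
  by rewrite big_const_seq count_predT iter_addr_0 -[leLHS]mulr_natl ler_wpM2r// ler_nat.
have le3 : pr (none s) <= pr H.
  by apply: le_pr; [exact: mn|exact: mn|rewrite nsE => t []].
have le4 : pr H <= pr (none s) + D%:R * p.
  apply: le_trans (pr_none_ge l (mn _)) _.
  rewrite -nsE lerD2l.
  apply: (@le_trans _ _ (\sum_(i <- l) p)).
    rewrite big_seq [leRHS]big_seq; apply: ler_sum => i.
    rewrite mem_filter => /andP[tei si]; rewrite -(Ap i si).
    by apply: le_pr; [apply: measurableI => //; exact: mn|exact: mA|move=> t []].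
  by rewrite big_const_seq count_predT iter_addr_0 -[leLHS]mulr_natl ler_wpM2r// ler_nat.
rewrite none_cons.
have D0 : 0 <= D%:R :> R by [].
rewrite far in le1 le2.
have le3' : p * pr (none s) <= p * pr H by rewrite ler_wpM2l.
have le4' : p * pr H <= p * (pr (none s) + D%:R * p) by rewrite ler_wpM2l.
have Dq : 0 <= D%:R * q by rewrite mulr_ge0.
have Dp : 0 <= D%:R * p ^+ 2 by rewrite mulr_ge0// exprn_ge0.
by rewrite ler_norml; apply/andP; split; nra.
Qed.

(** Each of the [size s] insertions multiplies the probability of absence by
    [1 - p] up to the error of the previous lemma. This elementary bound plays
    the role of the Chen-Stein method: it needs only pairs of events that
    touch, through [q], and independence from the events that do not. *)
Lemma pr_none_binomial (s : seq I) : uniq s ->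
  {in s, forall i, pr (A i) = p} ->
  {in s &, forall i j, i != j -> touch i j -> pr (A i `&` A j) <= q} ->
  {in s, forall i (s' : seq I), {subset s' <= s} ->
     let far := none [seq j <- s' | ~~ touch i j] in
     pr (A i `&` far) = p * pr far} ->
  {in s, forall i, (size [seq j <- s | touch i j] <= D)%N} ->
  `|pr (none s) - (1 - p) ^+ size s| <= (size s)%:R * D%:R * (q + p ^+ 2).
Proof.
elim: s => [|e s IHs]/=.
  move=> _ _ _ _ _; rewrite none_nil probability_setT/= expr0 subrr normr0.
  by rewrite !mul0r.
move=> /andP[es us] Ap Aq far sD.
have sub i : i \in s -> i \in e :: s by rewrite in_cons => ->; rewrite orbT.
have ne i : i \in s -> e != i by move=> si; apply: contraNneq es => ->.
have {}IHs : `|pr (none s) - (1 - p) ^+ size s| <=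
    (size s)%:R * D%:R * (q + p ^+ 2).
  apply: IHs => //.
  - by move=> i /sub; exact: Ap.
  - by move=> i j /sub si /sub sj; exact: Aq.
  - by move=> i /sub si s' ss; apply: far => // j /ss; exact: sub.
  - move=> i /sub si; apply: leq_trans (sD i si).
    by rewrite /=; case: ifP => //=.
have step : `|pr (none (e :: s)) - (1 - p) * pr (none s)| <=
    D%:R * (q + p ^+ 2).
  apply: pr_none_cons.
  - by apply: Ap; rewrite mem_head.
  - by move=> i /sub; exact: Ap.
  - by move=> i si; apply: Aq; rewrite ?mem_head ?sub ?ne.
  - by apply: far => //; rewrite mem_head.
  - by apply: leq_trans (sD e (mem_head _ _)); rewrite /=; case: ifP => //=.
have -> : pr (none (e :: s)) - (1 - p) ^+ (size s).+1 =
    pr (none (e :: s)) - (1 - p) * pr (none s) +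
    (1 - p) * (pr (none s) - (1 - p) ^+ size s) by rewrite exprS; ring.
rewrite -natr1 [(_ + 1) * _]mulrDl mulrDl mul1r [leRHS]addrC (le_trans (ler_normD _ _))// lerD//.
rewrite normrM (le_trans _ IHs)// -[leRHS]mul1r ler_wpM2r//.
by rewrite ger0_norm ?subr_ge0// gerBl.
Qed.

End dissociated_events.

(** * Scalar product and reflections *)

Section euclidean.
Context (R : realType) (d : nat).
Implicit Types x y v w : 'rV[R]_d.

Definition dot x y : R := \sum_(i < d) x ord0 i * y ord0 i.

Lemma dotC x y : dot x y = dot y x.
Proof. by apply: eq_bigr => i _; rewrite mulrC. Qed.

Lemma dotDl x y v : dot (x + y) v = dot x v + dot y v.
Proof.
by rewrite /dot -big_split; apply: eq_bigr => i _; rewrite mxE mulrDl.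
Qed.

Lemma dotZl k x y : dot (k *: x) y = k * dot x y.
Proof.
by rewrite /dot big_distrr /=; apply: eq_bigr => i _; rewrite mxE mulrA.
Qed.

Lemma dotNl x y : dot (- x) y = - dot x y.
Proof. by rewrite -scaleN1r dotZl mulN1r. Qed.

Lemma dotDr x y v : dot x (y + v) = dot x y + dot x v.
Proof. by rewrite dotC dotDl ![dot _ x]dotC. Qed.

Lemma dotZr k x y : dot x (k *: y) = k * dot x y.
Proof. by rewrite dotC dotZl dotC. Qed.

Lemma dotNr x y : dot x (- y) = - dot x y.
Proof. by rewrite dotC dotNl dotC. Qed.

Lemma dot_mulmx x y : dot x y = (x *m y^T) ord0 ord0.
Proof. by rewrite mxE; apply: eq_bigr => i _; rewrite mxE. Qed.

Lemma dot_ge0 x : 0 <= dot x x.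
Proof. by apply: sumr_ge0 => i _; rewrite -expr2 sqr_ge0. Qed.

Lemma enorm_dot x : enorm x = Num.sqrt (dot x x).
Proof. by rewrite /enorm; congr Num.sqrt; apply: eq_bigr => i _; rewrite expr2. Qed.

Lemma enorm_ge0 x : 0 <= enorm x.
Proof. exact: sqrtr_ge0. Qed.

Lemma sqr_enorm x : enorm x ^+ 2 = dot x x.
Proof. by rewrite enorm_dot sqr_sqrtr// dot_ge0. Qed.

Lemma enorm_eq0 x : (enorm x == 0) = (x == 0).
Proof.
have -> : (enorm x == 0) = (dot x x == 0) by rewrite -sqr_enorm expf_eq0.
rewrite psumr_eq0; last first.
  by move=> i _; rewrite -expr2 sqr_ge0.
apply/idP/eqP => [/allP x0|->].
  apply/rowP => i; have := x0 i (mem_index_enum i).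
  by rewrite /= mulf_eq0 orbb mxE => /eqP.
by apply/allP => i _ /=; rewrite mxE mul0r.
Qed.

Lemma enormN x : enorm (- x) = enorm x.
Proof. by rewrite !enorm_dot dotNl dotNr opprK. Qed.

Lemma sqr_enormB x y :
  enorm (x - y) ^+ 2 = enorm x ^+ 2 - 2 * dot x y + enorm y ^+ 2.
Proof.
rewrite !sqr_enorm dotDl dotDr dotNl !dotNr dotDr dotNr (dotC y x); ring.
Qed.

Lemma enorm_mulmx (Q : 'M[R]_d) x : Q *m Q^T = 1%:M -> enorm (x *m Q) = enorm x.
Proof.
by move=> QQ; rewrite !enorm_dot !dot_mulmx trmx_mul mulmxA -(mulmxA x) QQ mulmx1.
Qed.

Lemma sqr_dot_le x y : dot x y ^+ 2 <= enorm x ^+ 2 * enorm y ^+ 2.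
Proof.
have [->|y0] := eqVneq y 0.
  by rewrite /dot big1 ?expr0n ?mulr_ge0 ?exprn_ge0 ?enorm_ge0// => i _; rewrite mxE mulr0.
have yy : 0 < dot y y by rewrite -sqr_enorm exprn_even_gt0// enorm_eq0.
have := dot_ge0 (x - (dot x y / dot y y) *: y).
rewrite dotDl dotDr dotNl !dotNr dotDr dotNr !dotZl !dotZr (dotC y x) !sqr_enorm.
set a := dot x x; set b := dot x y; set c := dot y y in yy *.
have -> : a - b / c * b - (b / c * b - b / c * (b / c * c)) = (a * c - b ^+ 2) / c.
  by field; rewrite gt_eqF.
by rewrite pmulr_lge0 ?invr_gt0// subr_ge0.
Qed.

Lemma dot_le x y : `|dot x y| <= enorm x * enorm y.
Proof.
rewrite -(@ler_pXn2r _ 2)// ?nnegrE ?mulr_ge0 ?enorm_ge0//.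
by rewrite exprMn real_normK ?num_real// sqr_dot_le.
Qed.

(** The reflection in the hyperplane orthogonal to [w = e - v] exchanges the
    unit vectors [e] and [v]. *)
Lemma householder (e v : 'rV[R]_d) : dot e e = 1 -> dot v v = 1 ->
  exists2 Q : 'M[R]_d, Q *m Q^T = 1%:M & forall x, dot (x *m Q) e = dot x v.
Proof.
move=> ee vv; have [<-|ev] := eqVneq e v.
  by exists 1%:M => [|x]; rewrite ?trmx1 mulmx1.
pose w := e - v.
have ww : dot w w = 2 - 2 * dot e v.
  by rewrite /w dotDl dotDr dotNl !dotNr dotDr dotNr ee vv (dotC v e); ring.
have w0 : dot w w != 0.
  by rewrite -sqr_enorm expf_eq0/= enorm_eq0 subr_eq0.
pose k := 2 / dot w w.
pose Q := 1%:M - k *: (w^T *m w).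
have QT : Q^T = Q by rewrite /Q linearB/= trmx1 linearZ/= trmx_mul trmxK.
have xQ x : x *m Q = x - (k * dot x w) *: w.
  rewrite /Q mulmxBr mulmx1 -scalemxAr mulmxA -scalerA; congr (_ - _ *: _).
  by rewrite [x *m w^T]mx11_scalar mul_scalar_mx -dot_mulmx.
exists Q.
  pose W := w^T *m w.
  have WW : W *m W = dot w w *: W.
    rewrite /W mulmxA -(mulmxA w^T) [w *m w^T]mx11_scalar -dot_mulmx.
    by rewrite mul_mx_scalar -scalemxAl.
  rewrite QT /Q -/W mulmxBl mul1mx mulmxBr mulmx1 -scalemxAl -scalemxAr WW !scalerA.
  have -> : k * k * dot w w = k + k by rewrite /k; field.
  by rewrite scalerDl opprB addrK subrK.
move=> x; rewrite xQ dotDl dotNl dotZl.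
have we : dot w e = dot w w / 2.
  by rewrite ww /w dotDl dotNl ee (dotC v); field.
rewrite we /k; have -> : 2 / dot w w * dot x w * (dot w w / 2) = dot x w by field.
by rewrite /w dotDr dotNr; ring.
Qed.

End euclidean.

(** * Rotation invariant laws: radius and direction *)

Section borel_row_vectors.
Context (R : realType) (d : nat).
Local Notation E := (borel_rV R d).

Lemma measurable_coord (i : 'I_d) :
  measurable_fun setT (fun x : E => (x : 'rV[R]_d) ord0 i).
Proof.
apply: (measurability _ (RGenOpens.measurableE R)) => _ [_ [a [b ->]] <-].
rewrite setTI; apply: sub_sigma_algebra.
apply: open_comp => [x _|]; [exact: coord_continuous|exact: interval_open].
Qed.

Context d1 (T : measurableType d1) (X Y : T -> E).
Hypotheses (mX : measurable_fun setT X) (mY : measurable_fun setT Y).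

Lemma measurable_dot :
  measurable_fun setT (fun t => dot (X t : 'rV[R]_d) (Y t : 'rV[R]_d)).
Proof.
rewrite /dot; apply: measurable_sum => i.
by apply: measurable_funM; apply: (measurableT_comp (measurable_coord i)).
Qed.

Lemma measurable_enormB :
  measurable_fun setT (fun t => enorm ((X t : 'rV[R]_d) - (Y t : 'rV[R]_d))).
Proof.
apply: (@measurableT_comp _ _ _ _ _ _ (@Num.sqrt R)).
  by apply: continuous_measurable_fun; exact: sqrt_continuous.
apply: measurable_sum => i; apply: measurable_funX.
rewrite (_ : (fun _ => _) = (fun t => (X t : 'rV[R]_d) ord0 i) \-
  (fun t => (Y t : 'rV[R]_d) ord0 i)); last by apply/funext => t; rewrite !mxE.
by apply: measurable_funB; apply: (measurableT_comp (measurable_coord i)).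
Qed.

Lemma measurable_enorm :
  measurable_fun setT (fun t => enorm (X t : 'rV[R]_d)).
Proof.
apply: (@measurableT_comp _ _ _ _ _ _ (@Num.sqrt R)).
  by apply: continuous_measurable_fun; exact: sqrt_continuous.
apply: measurable_sum => i; apply: measurable_funX.
exact: (measurableT_comp (measurable_coord i)).
Qed.

End borel_row_vectors.

Lemma neq0_indicE (R : realType) (r : R) :
  (r != 0)%:R = \1_(~` [set 0]) r :> R.
Proof.
rewrite indicE; have [->|r0] := eqVneq r 0; first by rewrite memNset//= => /(_ erefl).
by rewrite mem_set//=; exact/eqP.
Qed.

Section rotation_invariant.
Context (R : realType) (d : nat) (i0 : 'I_d).
Local Notation E := (borel_rV R d).
Variable mu : probability E R.
Hypothesis mu_rot : forall Q : 'M[R]_d, Q *m Q^T = 1%:M ->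
  forall A : set E, measurable A -> mu [set x | A ((x : 'rV[R]_d) *m Q)] = mu A.

Local Notation e0 := (delta_mx ord0 i0 : 'rV[R]_d).
Local Notation en x := (enorm (x : 'rV[R]_d)).

Lemma dot_e0 (x : 'rV[R]_d) : dot x e0 = x ord0 i0.
Proof.
rewrite /dot (bigD1 i0)//= mxE !eqxx mulr1 big1 ?addr0// => j ji.
by rewrite mxE eqxx (negbTE ji) mulr0.
Qed.

Definition polar (v : 'rV[R]_d) (x : E) : R * R :=
  ((en x), dot (x : 'rV[R]_d) v).

Lemma measurable_polar v : measurable_fun setT (polar v).
Proof.
apply: measurable_fun_pair; first exact: measurable_enorm.
by apply: measurable_dot => //; exact: measurable_cst.
Qed.

HB.instance Definition _ v := isMeasurableFun.Build _ _ _ _ (polar v)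
  (measurable_polar v).

(** The norm and the component along a unit vector [v] have a joint law that
    does not depend on [v]: a reflection maps [v] to the axis [e0]. *)
Lemma polar_law v (S : set (R * R)) : dot v v = 1 -> measurable S ->
  mu (polar v @^-1` S) = mu (polar e0 @^-1` S).
Proof.
move=> vv mS.
have ee : dot e0 e0 = 1 by rewrite dot_e0 mxE !eqxx.
have [Q QQ Qv] := householder ee vv.
rewrite -[RHS](mu_rot QQ); last first.
  by rewrite -[_ @^-1` _]setTI; exact: measurable_polar.
congr (mu _); apply/seteqP; split => x; rewrite /polar /preimage /= ?Qv;
  by rewrite enorm_mulmx.
Qed.

Lemma polar_integral v (f : R * R -> \bar R) : dot v v = 1 ->
  measurable_fun setT f -> (forall z, 0 <= f z)%E ->
  (\int[mu]_x f (polar v x) = \int[mu]_x f (polar e0 x))%E.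
Proof.
move=> vv mf f0.
rewrite -(ge0_integral_distribution (polar v : {mfun _ >-> _}) mf f0).
rewrite -(ge0_integral_distribution (polar e0 : {mfun _ >-> _}) mf f0).
by apply: eq_measure_integral => S mS _; exact: polar_law.
Qed.

(** The cosine of the angle with the axis [i0]; it is 0 at the origin, which
    is why integrals of it carry the factor [nonzero]. *)
Definition dircos (y : E) : R := (y : 'rV[R]_d) ord0 i0 / (en y).

Lemma measurable_dircos : measurable_fun setT dircos.
Proof.
apply: measurable_funM; first exact: measurable_coord.
rewrite (_ : (fun _ => _) = (fun y : E => (en y) `^ -1)); last first.
  by apply/funext => y; rewrite powR_inv1// enorm_ge0.
apply: (@measurableT_comp _ _ _ _ _ _ (fun r : R => r `^ -1)).
  exact: measurable_powR.
exact: measurable_enorm.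
Qed.

Definition nonzero (y : E) : R := ((en y) != 0)%:R.

Lemma measurable_nonzero : measurable_fun setT nonzero.
Proof.
rewrite (_ : nonzero = \1_(~` [set 0]) \o (fun y : E => (en y))).
  apply: measurableT_comp; last exact: measurable_enorm.
  by apply: measurable_indic; exact: measurableC.
by apply/funext => y; rewrite /nonzero/= neq0_indicE.
Qed.

Local Notation pi0 := (\int[mu]_y (nonzero y)%:E)%E.

(** Radius and direction are independent. Both sides are the integral of
    [g (|x|, cos (x, y))] over pairs of independent vectors. Integrated first
    in [x], the inner integral does not depend on the direction of [y];
    integrated first in [y], the direction of [x] may be replaced by an axis,
    and the cosine becomes a direction cosine of [y]. *)
Lemma polar_independence (g : R * R -> \bar R) (v : 'rV[R]_d) :
  measurable_fun setT g -> (forall z, 0 <= g z)%E ->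
  (forall c, g (0, c)%R = 0%E) -> dot v v = 1 ->
  ((\int[mu]_x g ((en x), dot (x : 'rV[R]_d) v / (en x))%R) * pi0 =
   \int[mu]_y ((\int[mu]_x g ((en x), dircos y)) * (nonzero y)%:E))%E.
Proof.
move=> mg g0 gz vv.
have mV : measurable_fun setT (fun r : R => r `^ -1) by exact: measurable_powR.
have mn0 : measurable_fun setT (fun r : R => (r != 0)%:R : R).
  rewrite (_ : (fun _ => _) = \1_(~` [set 0])).
    by apply: measurable_indic; exact: measurableC.
  by apply/funext => r; rewrite neq0_indicE.
have eV (x : E) : (en x)^-1 = (en x) `^ -1 by rewrite powR_inv1// enorm_ge0.
have ge00 (x : E) : 0 <= (en x) by exact: enorm_ge0.
have gI w : dot w w = 1 ->
    (\int[mu]_x g ((en x), dot (x : 'rV[R]_d) w / (en x))%R =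
     \int[mu]_x g ((en x), dircos x))%E.
  move=> ww; pose f (z : R * R) := g (z.1, z.2 * z.1 `^ -1).
  have mf : measurable_fun setT f.
    apply: measurableT_comp => //; apply: measurable_fun_pair => //.
    by apply: measurable_funM => //; exact: (measurableT_comp mV measurable_fst).
  transitivity (\int[mu]_x f (polar w x))%E.
    by apply: eq_integral => x _; rewrite /f/= eV.
  rewrite polar_integral//; last by move=> z; exact: g0.
  by apply: eq_integral => x _; rewrite /f/= -eV dot_e0.
rewrite gI//.
pose F (z : E * E) : \bar R := (g ((en z.1),
  dot (z.1 : 'rV[R]_d) (z.2 : 'rV[R]_d) / ((en z.1) * (en z.2)))%R *
    (nonzero z.2)%:E)%E.
have mF : measurable_fun setT F.
  apply: emeasurable_funM; last first.
    by apply/measurable_EFinP; exact: (measurableT_comp measurable_nonzero measurable_snd).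
  apply: measurableT_comp => //; apply: measurable_fun_pair.
    exact: (measurable_enorm measurable_fst).
  apply: measurable_funM; first exact: (measurable_dot measurable_fst measurable_snd).
  rewrite (_ : (fun _ => _) = (fun z : E * E => ((en z.1) * (en z.2)) `^ -1)).
    apply: (measurableT_comp mV); apply: measurable_funM.
      exact: (measurable_enorm measurable_fst).
    exact: (measurable_enorm measurable_snd).
  by apply/funext => z; rewrite powR_inv1// mulr_ge0.
have F0 z : (0 <= F z)%E by rewrite mule_ge0// lee_fin.
have unit (x : E) : (en x) != 0 ->
    dot (((en x))^-1 *: (x : 'rV[R]_d)) (((en x))^-1 *: (x : 'rV[R]_d)) = 1.
  by move=> x0; rewrite dotZl dotZr -sqr_enorm; field.
(* the integral over x first: the direction of y is irrelevant *)
have step1 : (\int[mu]_y \int[mu]_x F (x, y) =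
    (\int[mu]_x g ((en x), dircos x)) * pi0)%E.
  rewrite -ge0_integralZl//; last 3 first.
  - by apply/measurable_EFinP; exact: measurable_nonzero.
  - by move=> y _; rewrite lee_fin.
  - by apply: integral_ge0 => x _; exact: g0.
  apply: eq_integral => y _; rewrite /F/= /nonzero.
  have [y0|y0] := eqVneq (en y) 0.
    by rewrite !mule0; apply: integral0_eq => x _; rewrite mule0.
  rewrite mule1 -(gI _ (unit y y0)); apply: eq_integral => x _.
  by rewrite mule1 dotZr; congr (g (_, _)); rewrite invfM; ring.
pose G (z : E * E) : \bar R := (g ((en z.1), dircos z.2) * (nonzero z.2)%:E)%E.
have mG : measurable_fun setT G.
  apply: emeasurable_funM; last first.
    by apply/measurable_EFinP; exact: (measurableT_comp measurable_nonzero measurable_snd).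
  apply: measurableT_comp => //; apply: measurable_fun_pair.
    exact: (measurable_enorm measurable_fst).
  exact: (measurableT_comp measurable_dircos measurable_snd).
have G0 z : (0 <= G z)%E by rewrite mule_ge0// lee_fin.
(* the integral over y first: the direction of x is moved to the axis *)
have step2 : (\int[mu]_x \int[mu]_y F (x, y) =
    \int[mu]_x \int[mu]_y G (x, y))%E.
  apply: eq_integral => x _; rewrite /F /G/=.
  have [x0|x0] := eqVneq (en x) 0.
    by apply: eq_integral => y _; rewrite x0 !gz.
  pose f (z : R * R) := (g ((en x), z.2 * z.1 `^ -1)%R * (z.1 != 0)%:R%:E)%E.
  have mf : measurable_fun setT f.
    apply: emeasurable_funM.
      apply: measurableT_comp => //; apply: measurable_fun_pair => //.
      by apply: measurable_funM => //; exact: (measurableT_comp mV measurable_fst).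
    by apply/measurable_EFinP; exact: (measurableT_comp mn0 measurable_fst).
  have f0 z : (0 <= f z)%E by rewrite mule_ge0// lee_fin.
  transitivity (\int[mu]_y f (polar (((en x))^-1 *: (x : 'rV[R]_d)) y))%E.
    apply: eq_integral => y _; rewrite /f /polar/= -eV dotZr (dotC (y : 'rV[R]_d)).
    by congr (g (_, _) * _)%E; rewrite invfM; ring.
  rewrite polar_integral//; last exact: unit.
  by apply: eq_integral => y _; rewrite /f /polar/= -eV dot_e0.
have swap (H : E * E -> \bar R) : measurable_fun setT H -> (forall z, 0 <= H z)%E ->
    (\int[mu]_x \int[mu]_y H (x, y) = \int[mu]_y \int[mu]_x H (x, y))%E.
  by move=> mH H0; exact: fubini_tonelli.
rewrite -step1 -(swap F mF F0) step2 (swap G mG G0).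
apply: eq_integral => y _.
have mgy : measurable_fun setT (fun x : E => g (en x, dircos y)).
  apply: (measurableT_comp mg); apply: measurable_fun_pair.
    by apply: measurable_enorm; exact: measurable_id.
  exact: measurable_cst.
have gy0 x : setT x -> (0 <= g (en x, dircos y))%E by move=> _; exact: g0.
have ny : (0 <= (nonzero y)%:E)%E by rewrite lee_fin ler0n.
by rewrite /G /=; exact: (ge0_integralZr mu measurableT mgy gy0 ny).
Qed.

End rotation_invariant.

(** * Even moments of a direction cosine *)

Section bounded_measurable.
Context d (T : measurableType d) (R : realType) (mu : probability T R).

Definition bounded_measurable (f : T -> R) :=
  measurable_fun setT f /\ exists M : R, forall y, `|f y| <= M.

Lemma bounded_measurable_integrable f :
  bounded_measurable f -> mu.-integrable setT (EFin \o f).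
Proof.
move=> [mf [M fM]]; apply: measurable_bounded_integrable => //.
  by rewrite (le_lt_trans (probability_le1 _ _))// ltry.
exists M; split; first exact: num_real.
by move=> M' MM' x _; exact: le_trans (fM x) (ltW MM').
Qed.

Lemma bounded_measurableM f g : bounded_measurable f -> bounded_measurable g ->
  bounded_measurable (fun y => f y * g y).
Proof.
move=> [mf [M fM]] [mg [N gN]]; split; first exact: measurable_funM.
exists (M * N) => y; rewrite normrM ler_pM//.
Qed.

Lemma bounded_measurableD f g : bounded_measurable f -> bounded_measurable g ->
  bounded_measurable (fun y => f y + g y).
Proof.
move=> [mf [M fM]] [mg [N gN]]; split; first exact: measurable_funD.
by exists (M + N) => y; rewrite (le_trans (ler_normD _ _))// lerD.
Qed.

Lemma bounded_measurable_cst (c : R) : bounded_measurable (fun=> c).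
Proof. by split; [exact: measurable_cst|exists `|c|]. Qed.

Lemma bounded_measurableX f n : bounded_measurable f ->
  bounded_measurable (fun y => f y ^+ n).
Proof.
move=> [mf [M fM]]; split; first exact: measurable_funX.
by exists (M ^+ n) => y; rewrite normrX lerXn2r ?nnegrE//; exact: le_trans (fM y).
Qed.

Lemma bounded_measurable_sum I (s : seq I) (f : I -> T -> R) :
  (forall i, bounded_measurable (f i)) ->
  bounded_measurable (fun y => \sum_(i <- s) f i y).
Proof.
move=> bf; elim: s => [|i s IHs].
  by under eq_fun do rewrite big_nil; exact: bounded_measurable_cst.
by under eq_fun do rewrite big_cons; exact: bounded_measurableD.
Qed.

Lemma Rintegral_sum I (s : seq I) (f : I -> T -> R) :
  (forall i, bounded_measurable (f i)) ->
  \int[mu]_y (\sum_(i <- s) f i y) = \sum_(i <- s) \int[mu]_y (f i y).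
Proof.
move=> bf; elim: s => [|i s IHs].
  rewrite big_nil; under eq_Rintegral do rewrite big_nil.
  by rewrite Rintegral_cst// mul0r.
rewrite big_cons -IHs -RintegralD//; last 2 first.
- exact: bounded_measurable_integrable.
- by apply: bounded_measurable_integrable; exact: bounded_measurable_sum.
by apply: eq_Rintegral => y _; rewrite big_cons.
Qed.

End bounded_measurable.

Lemma poly_eq_horner (R : realType) (p q : {poly R}) :
  (forall b, p.[b] = q.[b]) -> p = q.
Proof.
move=> pq; apply/eqP; rewrite -subr_eq0; apply/eqP.
pose s := [seq i%:R : R | i <- iota 0 (size (p - q))].
apply: (@roots_geq_poly_eq0 _ _ s).
- by apply/allP => b _; rewrite rootE !hornerE pq subrr.
- by rewrite map_inj_uniq ?iota_uniq//; exact: mulrIn (oner_neq0 R).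
- by rewrite size_map size_iota.
Qed.

Section sphere_moments.
Context (R : realType) (d : nat) (i0 : 'I_d).
Local Notation E := (borel_rV R d).
Variable mu : probability E R.
Hypothesis mu_rot : forall Q : 'M[R]_d, Q *m Q^T = 1%:M ->
  forall A : set E, measurable A -> mu [set x | A ((x : 'rV[R]_d) *m Q)] = mu A.

Local Notation en x := (enorm (x : 'rV[R]_d)).
Local Notation e_ i := (delta_mx ord0 i : 'rV[R]_d).
Local Notation nz := (@nonzero R d).

Lemma dircos_le1 i (y : E) : `|dircos i y| <= 1.
Proof.
rewrite /dircos normf_div (ger0_norm (enorm_ge0 _)).
have [y0|y0] := eqVneq (en y) 0; first by rewrite y0 invr0 mulr0 ler01.
rewrite ler_pdivrMr ?mul1r ?lt0r ?y0 ?enorm_ge0//.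
have := dot_le (y : 'rV[R]_d) (e_ i).
by rewrite dot_e0 (enorm_dot (e_ i)) dot_e0 mxE !eqxx sqrtr1 mulr1.
Qed.

Lemma bounded_dircos i : bounded_measurable (@dircos R d i).
Proof.
split; first exact: measurable_dircos.
by exists 1; exact: dircos_le1.
Qed.

Lemma bounded_nonzero : bounded_measurable nz.
Proof.
split; first exact: measurable_nonzero.
by exists 1 => y; rewrite /nonzero; case: (_ != _); rewrite ?normr1 ?normr0.
Qed.

(** With [mu] an arbitrary rotation invariant law, [moment k] is the moment of
    order [2 k] of a direction cosine, times the probability [moment 0] that
    the vector is not 0. *)
Definition moment k := \int[mu]_y (dircos i0 y ^+ k.*2 * nz y).

(** [e_ i0 + b *: e_ i] has norm [sqrt (1 + b ^ 2)], and the law of the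
    component in a direction depends only on the norm of that direction. *)
Lemma moment_direction i (b : R) k : i != i0 ->
  \int[mu]_y ((dircos i0 y + b * dircos i y) ^+ k.*2 * nz y) =
  (1 + b ^+ 2) ^+ k * moment k.
Proof.
move=> ii0; pose v := e_ i0 + b *: e_ i.
pose c : R := Num.sqrt (1 + b ^+ 2).
have b0 : 0 < 1 + b ^+ 2 by rewrite ltr_pwDl// sqr_ge0.
have c0 : 0 < c by rewrite sqrtr_gt0.
have c2 : c ^+ 2 = 1 + b ^+ 2 by rewrite sqr_sqrtr// ltW.
have vv : dot (c^-1 *: v) (c^-1 *: v) = 1.
  rewrite dotZl dotZr /v dotDl !dotDr !dotZl !dotZr !dot_e0 !mxE !eqxx/=.
  rewrite (negbTE ii0) eq_sym (negbTE ii0) mulr0 addr0 add0r mulr1.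
  by rewrite -expr2 -c2; field; rewrite gt_eqF.
pose f (z : R * R) : \bar R :=
  (((z.2 * z.1 `^ -1) ^+ k.*2 * (z.1 != 0)%:R)%:E)%E.
have mf : measurable_fun setT f.
  apply/measurable_EFinP; apply: measurable_funM.
    apply: measurable_funX; apply: measurable_funM => //.
    exact: (measurableT_comp (@measurable_powR R (-1)) measurable_fst).
  apply: (@measurableT_comp _ _ _ _ _ _ (fun r : R => (r != 0)%:R : R)) => //.
  rewrite (_ : (fun _ => _) = \1_(~` [set 0])).
    by apply: measurable_indic; exact: measurableC.
  by apply/funext => r; rewrite neq0_indicE.
have f0 z : (0 <= f z)%E.
  by rewrite lee_fin mulr_ge0// -mul2n exprM exprn_ge0// sqr_ge0.
have := polar_integral i0 mu_rot vv mf f0.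
move=> /(congr1 (fun r => c ^+ k.*2 * fine r)).
have -> : c ^+ k.*2 = (1 + b ^+ 2) ^+ k by rewrite -mul2n exprM c2.
rewrite -c2 -exprM mul2n => fE.
have bh : bounded_measurable
    (fun y => (dircos i0 y + b * dircos i y) ^+ k.*2 * nz y).
  apply: bounded_measurableM; last exact: bounded_nonzero.
  apply: bounded_measurableX; apply: bounded_measurableD.
    exact: bounded_dircos.
  by apply: bounded_measurableM; [exact: bounded_measurable_cst|exact: bounded_dircos].
have fh : fine (\int[mu]_x f (polar (c^-1 *: v) x)) = (c^-1) ^+ k.*2 *
    \int[mu]_y ((dircos i0 y + b * dircos i y) ^+ k.*2 * nz y).
  rewrite -RintegralZl//; last exact: bounded_measurable_integrable.
  apply: eq_Rintegral => y _; rewrite /f/=.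
  rewrite powR_inv1 ?enorm_ge0// [RHS]mulrA -exprMn; congr (_ ^+ _ * _).
  by rewrite dotZr /v dotDr dotZr !dot_e0 /dircos mulrDr mulrDl mulrDr !mulrA.
transitivity (c ^+ k.*2 * fine (\int[mu]_x f (polar (c^-1 *: v) x))).
  by rewrite fh mulrA -exprMn mulfV ?gt_eqF// expr1n mul1r.
rewrite fE; congr (_ * _); apply: eq_Rintegral => y _.
by rewrite /f/= powR_inv1 ?enorm_ge0// dot_e0.
Qed.

(** The coefficients of [b ^ 2] on the two sides of [moment_direction]. *)
Lemma moment_coef2 i k : i != i0 ->
  k.*2.+1%:R * \int[mu]_y (dircos i0 y ^+ k.*2 * dircos i y ^+ 2 * nz y) =
  moment k.+1.
Proof.
move=> ii0; set n := k.+1.*2.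
pose m j := \int[mu]_y (dircos i0 y ^+ (n - j) * dircos i y ^+ j * nz y).
have bm j : bounded_measurable
    (fun y => dircos i0 y ^+ (n - j) * dircos i y ^+ j * nz y).
  apply: bounded_measurableM; last exact: bounded_nonzero.
  by apply: bounded_measurableM; apply: bounded_measurableX; exact: bounded_dircos.
pose p : {poly R} := \poly_(j < n.+1) ('C(n, j)%:R * m j).
pose q : {poly R} := moment k.+1 *: (1 + 'X^2) ^+ k.+1.
have pq : p = q.
  apply: poly_eq_horner => b; rewrite horner_poly !hornerE/=.
  rewrite [RHS]mulrC -(moment_direction _ _ ii0) -/n.
  transitivity (\int[mu]_y (\sum_(j < n.+1)
      ('C(n, j)%:R * b ^+ j) * (dircos i0 y ^+ (n - j) * dircos i y ^+ j * nz y))).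
    rewrite Rintegral_sum; last first.
      move=> j; apply: bounded_measurableM => //; exact: bounded_measurable_cst.
    apply: eq_bigr => j _; rewrite RintegralZl//; last exact: bounded_measurable_integrable.
    by rewrite -/(m j); ring.
  apply: eq_Rintegral => y _; rewrite exprDn mulr_suml; apply: eq_bigr => j _.
  by rewrite [(b * _) ^+ _]exprMn -[in LHS]mulr_natl; ring.
have := congr1 (fun r : {poly R} => r`_2) pq.
rewrite coef_poly/= coefZ.
have -> : ((1 + 'X^2) ^+ k.+1 : {poly R})`_2 = k.+1%:R.
  rewrite exprDn coef_sum (bigD1 (inord 1))//= inordK// expr1n mul1r expr1.
  rewrite coefMn coefXn eqxx bin1 big1 ?addr0// => j.
  rewrite -val_eqE/= inordK// => j1.
  rewrite expr1n mul1r -exprM coefMn coefXn; case: eqP => [e|]; last by rewrite mul0rn.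
  by exfalso; move/eqP: j1 e; lia.
move=> e.
apply: (@mulfI _ k.+1%:R); first by rewrite pnatr_eq0.
rewrite [RHS]mulrC -e /m /n doubleS subSS subSS subn0.
rewrite mulrA; congr (_ * _).
rewrite -natrM; congr (_%:R).
by rewrite bin2; nia.
Qed.

Hypothesis d_ge2 : (2 <= d)%N.

Lemma dircos_sum (y : E) : (\sum_i dircos i y ^+ 2) * nz y = nz y.
Proof.
rewrite /nonzero; have [y0|y0] := eqVneq (en y) 0; first by rewrite mulr0.
rewrite mulr1 (eq_bigr (fun i => (y : 'rV[R]_d) ord0 i * (y : 'rV[R]_d) ord0 i *
  (en y ^- 2))); last by move=> i _; rewrite exprMn exprVn expr2.
by rewrite -mulr_suml -/(dot _ _) -sqr_enorm divff// expf_neq0.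
Qed.

(** Summing [moment_coef2] over all axes, the squares of the cosines add up to
    1. This recursion determines the moments of the direction cosine, hence
    everything about the uniform law on the sphere that is needed. *)
Lemma moment_succ k :
  moment k.+1 = k.*2.+1%:R / (k.*2 + d)%:R * moment k.
Proof.
have bm i : bounded_measurable
    (fun y => dircos i0 y ^+ k.*2 * dircos i y ^+ 2 * nz y).
  apply: bounded_measurableM; last exact: bounded_nonzero.
  by apply: bounded_measurableM; apply: bounded_measurableX; exact: bounded_dircos.
have e : moment k = \sum_i \int[mu]_y (dircos i0 y ^+ k.*2 * dircos i y ^+ 2 * nz y).
  rewrite -Rintegral_sum//; apply: eq_Rintegral => y _.
  rewrite -mulr_suml -mulr_sumr -mulrA dircos_sum//.
have e0 : \int[mu]_y (dircos i0 y ^+ k.*2 * dircos i0 y ^+ 2 * nz y) = moment k.+1.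
  by apply: eq_Rintegral => y _; rewrite -exprD doubleS addn2.
have := congr1 (fun r => k.*2.+1%:R * r) e.
rewrite (bigD1 i0)//= e0 mulrDr mulr_sumr.
rewrite (eq_bigr (fun=> moment k.+1)); last by move=> i; exact: moment_coef2.
have -> : \sum_(i < d | i != i0) moment k.+1 = d.-1%:R * moment k.+1.
  by rewrite sumr_const (cardC1 i0) card_ord mulr_natl.
move=> {}e; have dk : (k.*2 + d)%:R != 0 :> R.
  by rewrite pnatr_eq0 -lt0n; lia.
apply: (mulfI dk); rewrite [RHS]mulrA [_ * (_ / _)]mulrC divfK// e -mulrDl; congr (_ * _).
by rewrite -natrD; congr (_%:R); lia.
Qed.

End sphere_moments.

(** * Gaussian moments and the Gamma function at half-integers *)

Section gaussian_moments.
Context (R : realType).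
Local Notation mu := (@lebesgue_measure R).

Definition gpow n (x : R) : R := x ^+ n * expR (- x ^+ 2).

Lemma is_derive_gauss (x : R) :
  is_derive x 1 (fun x : R => - (expR (- x ^+ 2) / 2)) (x * expR (- x ^+ 2)).
Proof.
apply: is_derive_eq.
by rewrite /GRing.scale /=; field.
Qed.

Lemma continuous_gpow n : continuous (gpow n).
Proof.
move=> x; apply: cvgM; first exact: exprn_continuous.
apply: (@continuous_comp _ _ _ (fun x : R => - x ^+ 2) expR).
  by apply: cvgN; exact: exprn_continuous.
exact: continuous_expR.
Qed.

Lemma gpow_ge0 n x : 0 <= x -> 0 <= gpow n x.
Proof. by move=> x0; rewrite mulr_ge0// ?exprn_ge0// expR_ge0. Qed.

Lemma continuous_integrable (h : R -> R) (b : R) : continuous h ->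
  mu.-integrable `[0, b] (EFin \o h).
Proof.
move=> ch; apply: continuous_compact_integrable; first exact: segment_compact.
by apply: continuous_subspaceT => x; exact: ch.
Qed.

Lemma integrable_gpow n (b : R) :
  mu.-integrable `[0, b] (EFin \o gpow n).
Proof. exact/continuous_integrable/continuous_gpow. Qed.

Lemma derivable_oo_LRcontinuousT (F : R -> R) (a b : R) :
  (forall x, derivable F x 1) -> derivable_oo_LRcontinuous F a b.
Proof.
move=> dF; have cF x : {for x, continuous F}.
  by apply: differentiable_continuous; exact/derivable1_diffP.
split; first by move=> x _.
- by apply: cvg_at_right_filter; exact: cF.
- by apply: cvg_at_left_filter; exact: cF.
Qed.

Definition gint n (b : R) : R := \int[mu]_(x in `[0, b]) gpow n x.

Lemma gint1 b : 0 < b -> gint 1 b = (1 - expR (- b ^+ 2)) / 2.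
Proof.
move=> b0; rewrite /gint /Rintegral.
rewrite (@continuous_FTC2 _ _ (fun x => - (expR (- x ^+ 2) / 2)))//=.
- by rewrite expr0n oppr0 expR0; lra.
- by apply: continuous_subspaceT => x; exact: continuous_gpow.
- by apply: derivable_oo_LRcontinuousT => x; have [] := is_derive_gauss x.
- move=> x _; rewrite derive1E; have [_ ->] := is_derive_gauss x.
  by rewrite /gpow expr1.
Qed.

Lemma gint_rec n b : 0 < b ->
  gint n.+2 b = n.+1%:R / 2 * gint n b - b ^+ n.+1 * expR (- b ^+ 2) / 2.
Proof.
move=> b0; rewrite /gint.
pose F (x : R) := x ^+ n.+1; pose G (x : R) := - (expR (- x ^+ 2) / 2).
pose f (x : R) := n.+1%:R * x ^+ n; pose g (x : R) := x * expR (- x ^+ 2).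
have -> : gpow n.+2 = (fun x => F x * g x).
  by apply/funext => x; rewrite /F /g /gpow exprSr; ring.
rewrite (@Rintegration_by_parts _ F G f g)//.
- have -> : (fun x => f x * G x) = (fun x => - (n.+1%:R / 2) * gpow n x).
    by apply/funext => x; rewrite /f /G /gpow; field.
  rewrite RintegralZl//; last exact: integrable_gpow.
  by rewrite /F /G expr0n/=; field.
- by apply: continuous_subspaceT => x; apply: cvgM;
    [exact: cvg_cst|exact: exprn_continuous].
- by apply: derivable_oo_LRcontinuousT => x; exact: exprn_derivable.
- by move=> x _; rewrite derive1E exp_derive /f /GRing.scale/= mulr1.
- apply: continuous_subspaceT => x; have := @continuous_gpow 1 x.
  by rewrite /gpow; under eq_fun do rewrite expr1.
- by apply: derivable_oo_LRcontinuousT => x; have [] := is_derive_gauss x.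
- by move=> x _; rewrite derive1E; have [_ ->] := is_derive_gauss x.
Qed.

(** The integral of [x ^ n * (x - s) ^ 2 * exp (- x ^ 2)]. *)
Lemma gint_convex n b s :
  0 <= b -> 0 <= gint n.+2 b - 2 * s * gint n.+1 b + s ^+ 2 * gint n b.
Proof.
move=> b0; have ig := integrable_gpow.
have cg c m : continuous (fun x => c * gpow m x).
  by move=> x; apply: cvgM; [exact: cvg_cst|exact: continuous_gpow].
rewrite -!RintegralZl// -RintegralB//; last exact: continuous_integrable.
rewrite -RintegralD//; last 2 first.
- by apply: continuous_integrable => x; apply: cvgB; [exact: continuous_gpow|exact: cg].
- exact: continuous_integrable.
apply: Rintegral_ge0 => x /=; rewrite in_itv/= => /andP[x0 _].
rewrite (_ : _ + _ = gpow n x * (x - s) ^+ 2); last by rewrite /gpow !exprS; ring.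
by rewrite mulr_ge0 ?gpow_ge0 ?sqr_ge0.
Qed.

Lemma cvg_exprn_gauss n : k%:R ^+ n * expR (- k%:R ^+ 2) @[k --> \oo] --> (0 : R).
Proof.
pose C : R := 2 * n.+1`!%:R.
apply: (@squeeze_cvgr _ _ _ _ (fun=> 0) (fun k => C * k.+1%:R^-1)); last 2 first.
- exact: cvg_cst.
- rewrite -[X in _ --> X](mulr0 C); apply: cvgM; first exact: cvg_cst.
  exact: cvg_harmonic.
near=> k; have k0 : (0 < k)%N by near: k; exact: nbhs_infty_gt.
rewrite mulr_ge0 ?expR_ge0 ?exprn_ge0//= expRN ler_pdivrMr ?expR_gt0//.
have C0 : 0 < n.+1`!%:R :> R by rewrite ltr0n fact_gt0.
have h : k%:R ^+ n.+1 / n.+1`!%:R <= expR (k%:R ^+ 2) :> R.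
  apply: le_trans (_ : expR k%:R <= _); last first.
    by rewrite ler_expR -natrX ler_nat; nia.
  by apply: le_trans (expR_ge1Dxn n _) => //; rewrite lerDr.
rewrite ler_pdivrMr// exprS in h.
rewrite mulrAC ler_pdivlMr// -natr1 mulrDr mulr1 /C.
have k1 : 1 <= k%:R :> R by rewrite ler1n.
have : k%:R ^+ n <= k%:R * k%:R ^+ n :> R by rewrite ler_peMl// exprn_ge0.
by lra.
Unshelve. all: by end_near. Qed.

Definition gmoment n : R := \int[mu]_(x in `[0, +oo[) gpow n x.

(** The absolute value makes the integrand nonnegative everywhere, as monotone
    convergence along the intervals [[0, k]] requires. *)
Lemma gint_integral n : (gint n k%:R)%:E @[k --> \oo]
  --> (\int[mu]_(x in `[0%R, +oo[) (gpow n x)%:E)%E.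
Proof.
pose f (x : R) := `|x| ^+ n * expR (- x ^+ 2).
have mf : measurable_fun setT f.
  apply: continuous_measurable_fun => x; apply: cvgM.
    apply: (@continuous_comp _ _ _ (fun x : R => `|x|) (fun x => x ^+ n)).
      exact: norm_continuous.
    exact: exprn_continuous.
  apply: (@continuous_comp _ _ _ (fun x : R => - x ^+ 2) expR).
    by apply: cvgN; exact: exprn_continuous.
  exact: continuous_expR.
have f0 x : 0 <= f x by rewrite mulr_ge0 ?exprn_ge0 ?expR_ge0.
have -> : (\int[mu]_(x in `[0%R, +oo[) (gpow n x)%:E =
    \int[mu]_(x in `[0%R, +oo[) (f x)%:E)%E.
  by apply: eq_integral => x; rewrite inE/= in_itv/= andbT => x0;
    rewrite /f ger0_norm.
have -> : (fun k => (gint n k%:R)%:E) =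
    (fun k => (\int[mu]_(x in `[0%R, k%:R]) (f x)%:E)%E).
  apply/funext => k; rewrite /gint /Rintegral fineK.
    by apply: eq_integral => x; rewrite inE/= in_itv/= => /andP[x0 _];
      rewrite /f ger0_norm.
  by apply: integrable_fin_num => //; exact: integrable_gpow.
exact: ge0_cvgn_integral.
Qed.

Lemma gint_cvg n (c : R) : gint n k%:R @[k --> \oo] --> c -> gmoment n = c.
Proof.
move=> gc; rewrite /gmoment /Rintegral.
have gcE : (gint n k%:R)%:E @[k --> \oo] --> c%:E by apply/fine_cvgP; split; [exact: nearW|].
by rewrite (cvg_unique _ (gint_integral (n := n)) gcE).
Qed.

Lemma gmoment0 : gmoment 0 = Num.sqrt pi / 2.
Proof.
rewrite /gmoment /Rintegral.
have -> : gpow 0 = @gauss_fun R by apply/funext => x; rewrite /gpow mul1r.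
by rewrite integral0y_gauss.
Qed.

Lemma gint0_cvg : gint 0 k%:R @[k --> \oo] --> gmoment 0.
Proof.
have := gint_integral (n := 0).
have e : (\int[mu]_(x in `[0%R, +oo[) (gpow 0 x)%:E = (gmoment 0)%:E)%E.
  rewrite gmoment0 -integral0y_gauss; apply: eq_integral => x _.
  by rewrite /gpow mul1r.
by rewrite e => /fine_cvgP[].
Qed.

Lemma gint1_cvg : gint 1 k%:R @[k --> \oo] --> (1 / 2 : R).
Proof.
have h : (1 - k%:R ^+ 0 * expR (- k%:R ^+ 2)) / 2 @[k --> \oo] --> ((1 - 0) / 2 : R).
  apply: cvgM; last exact: cvg_cst.
  by apply: cvgB; [exact: cvg_cst|exact: cvg_exprn_gauss].
rewrite subr0 in h; apply: cvg_trans h; apply: near_eq_cvg.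
near=> k; rewrite gint1 ?expr0 ?mul1r// ltr0n; near: k; exact: nbhs_infty_gt.
Unshelve. all: by end_near. Qed.

Lemma gint_cvg_rec n (c : R) : gint n k%:R @[k --> \oo] --> c ->
  gint n.+2 k%:R @[k --> \oo] --> n.+1%:R / 2 * c.
Proof.
move=> gc.
have h : n.+1%:R / 2 * gint n k%:R - (k%:R ^+ n.+1 * expR (- k%:R ^+ 2)) / 2
    @[k --> \oo] --> n.+1%:R / 2 * c - 0 / 2.
  apply: cvgB; first by apply: cvgM => //; exact: cvg_cst.
  by apply: cvgM; [exact: cvg_exprn_gauss|exact: cvg_cst].
rewrite mul0r subr0 in h; apply: cvg_trans h; apply: near_eq_cvg.
near=> k; rewrite gint_rec// ltr0n; near: k; exact: nbhs_infty_gt.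
Unshelve. all: by end_near. Qed.

Lemma gint_cvg_gmoment n : gint n k%:R @[k --> \oo] --> gmoment n.
Proof.
suff [c gc] : exists c : R, gint n k%:R @[k --> \oo] --> c by rewrite (gint_cvg gc).
elim/ltn_ind: n => -[_|[_|n IHn]].
- by exists (gmoment 0); exact: gint0_cvg.
- by exists (1 / 2); exact: gint1_cvg.
- by have [//|c gc] := IHn n; exists (n.+1%:R / 2 * c); exact: gint_cvg_rec.
Qed.

Lemma gmoment1 : gmoment 1 = 1 / 2.
Proof. by apply: gint_cvg; exact: gint1_cvg. Qed.

Lemma gmoment_rec n : gmoment n.+2 = n.+1%:R / 2 * gmoment n.
Proof. by apply: gint_cvg; apply: gint_cvg_rec; exact: gint_cvg_gmoment. Qed.

Lemma gmoment_gt0 n : 0 < gmoment n.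
Proof.
elim/ltn_ind: n => -[_|[_|n IHn]].
- by rewrite gmoment0 divr_gt0// sqrtr_gt0 pi_gt0.
- by rewrite gmoment1; lra.
- by rewrite gmoment_rec mulr_gt0 ?divr_gt0// IHn.
Qed.

Lemma gmoment_convex n s :
  0 <= gmoment n.+2 - 2 * s * gmoment n.+1 + s ^+ 2 * gmoment n.
Proof.
have gc := gint_cvg_gmoment.
have h : gint n.+2 k%:R - 2 * s * gint n.+1 k%:R + s ^+ 2 * gint n k%:R @[k --> \oo]
    --> gmoment n.+2 - 2 * s * gmoment n.+1 + s ^+ 2 * gmoment n.
  apply: cvgD; last by apply: cvgM => //; exact: cvg_cst.
  by apply: cvgB => //; apply: cvgM => //; exact: cvg_cst.
rewrite -(cvg_lim _ h)//; apply: limr_ge; first by apply/cvg_ex; eexists; exact: h.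
by apply: nearW => k; exact: gint_convex.
Qed.

(** The quadratic form of [gmoment_convex] in [s] has a nonpositive
    discriminant. *)
Lemma gmoment_log_convex n :
  gmoment n.+1 ^+ 2 <= gmoment n * gmoment n.+2.
Proof.
have g0 := gmoment_gt0 n.
have := gmoment_convex n (gmoment n.+1 / gmoment n).
set a := gmoment n.+2; set b := gmoment n.+1; set c := gmoment n in g0 *.
have -> : a - 2 * (b / c) * b + (b / c) ^+ 2 * c = (c * a - b ^+ 2) / c.
  by field; rewrite gt_eqF.
by rewrite pmulr_lge0 ?invr_gt0// subr_ge0.
Qed.

End gaussian_moments.

Section gamma_half_integer.
Context (R : realType).
Local Notation mu := (@lebesgue_measure R).

(** The substitution [y = x ^ 2]. *)
Lemma gamma_substitution (m k : nat) :
  (\int[mu]_(y in `[0%R, (k ^ 2)%:R]) (Num.sqrt y ^+ m * expR (- y))%:E =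
   (2 * gint m.+1 (k%:R : R))%:E)%E.
Proof.
pose F (x : R) := x ^+ 2; pose G (y : R) := Num.sqrt y ^+ m * expR (- y).
have dF x : derivable F x 1 by exact: exprn_derivable.
have F'E : F^`()%classic = (fun x => 2 * x).
  by apply/funext => x; rewrite derive1E exp_derive /GRing.scale/= expr1 mulr1.
have cF' : continuous (F^`()%classic).
  by rewrite F'E => x; apply: cvgM; [exact: cvg_cst|exact: cvg_id].
have cG : continuous G.
  move=> x; apply: cvgM.
    apply: (@continuous_comp _ _ _ (@Num.sqrt R) (fun x => x ^+ m)).
      exact: sqrt_continuous.
    exact: exprn_continuous.
  apply: (@continuous_comp _ _ _ (fun x : R => - x) expR).
    by apply: cvgN; exact: cvg_id.
  exact: continuous_expR.
have := @integration_by_substitution_increasing R F G 0 k%:R (ler0n _ _).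
rewrite /F expr0n/= -natrX => ->.
- rewrite -[in RHS]/(2 * _)%R -RintegralZl//; last exact: integrable_gpow.
  rewrite /Rintegral fineK; last first.
    apply: integrable_fin_num => //; apply: continuous_integrable => x.
    by apply: cvgM; [exact: cvg_cst|exact: continuous_gpow].
  apply: eq_integral => x; rewrite inE/= in_itv/= => /andP[x0 _].
  rewrite F'E -[LHS]/((Num.sqrt (x ^+ 2) ^+ m * expR (- x ^+ 2) * (2 * x))%:E) sqrtr_sqr ger0_norm// /gpow (exprSr x m); congr (_%:E); ring.
- move=> x y; rewrite !in_itv/= => /andP[x0 _] /andP[y0 _] xy.
  by rewrite ltr_pXn2r.
- by move=> x _; exact: cF'.
- by apply/cvg_ex; eexists; apply: cvg_at_right_filter; exact: cF'.
- by apply/cvg_ex; eexists; apply: cvg_at_left_filter; exact: cF'.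
- exact: (derivable_oo_LRcontinuousT _ _ dF).
- by apply: continuous_subspaceT => x; exact: cG.
Qed.

Lemma Gamma_half m : Gamma (m.+2%:R / 2) = 2 * gmoment R m.+1.
Proof.
pose G (y : R) := Num.sqrt y ^+ m * expR (- y).
have cG : continuous G.
  move=> x; apply: cvgM.
    apply: (@continuous_comp _ _ _ (@Num.sqrt R) (fun x => x ^+ m)).
      exact: sqrt_continuous.
    exact: exprn_continuous.
  apply: (@continuous_comp _ _ _ (fun x : R => - x) expR).
    by apply: cvgN; exact: cvg_id.
  exact: continuous_expR.
have mG : measurable_fun setT G by exact: continuous_measurable_fun.
have G0 y : 0 <= G y by rewrite mulr_ge0 ?expR_ge0 ?exprn_ge0 ?sqrtr_ge0.
have -> : Gamma (m.+2%:R / 2) = \int[mu]_(y in `[0, +oo[) G y.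
  rewrite /Gamma [RHS]/Rintegral -integral_itv_obnd_cbnd; last first.
    by apply/measurable_EFinP; exact: measurable_funTS.
  apply: eq_Rintegral => y; rewrite inE/= in_itv/= andbT => y0.
  rewrite /G -powR12_sqrt ?ltW// -powR_mulrn ?powR_ge0// -powRrM.
  by congr (_ `^ _ * _); rewrite -natr1 -natr1; field.
have h1 := @ge0_cvgn_integral R mu G G0 mG.
have sq : (fun k => (k ^ 2)%N) @ \oo --> \oo.
  apply/cvgnyPge => A; near=> k; rewrite (leq_trans _ (_ : k <= _)%N)//.
    by near: k; exact: nbhs_infty_ge.
  by rewrite expnS expn1; nia.
have h2 : (\int[mu]_(y in `[0%R, (k ^ 2)%:R]) (G y)%:E)%E @[k --> \oo] -->
    (\int[mu]_(y in `[0%R, +oo[) (G y)%:E)%E.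
  exact: (cvg_comp _ _ sq h1).
have h3 : (2 * gint m.+1 (k%:R : R))%:E @[k --> \oo] --> (2 * gmoment R m.+1)%:E.
  apply/fine_cvgP; split; first exact: nearW.
  by apply: cvgM; [exact: cvg_cst|exact: gint_cvg_gmoment].
rewrite /Rintegral; move: h2.
under eq_fun do rewrite gamma_substitution.
by move=> h2; rewrite (cvg_unique _ h2 h3).
Unshelve. all: by end_near. Qed.

End gamma_half_integer.

(** * Asymptotics of the moments of a direction cosine *)

Section gmoment_ratio.
Context (R : realType).
Local Notation J := (@gmoment R).

(** Log-convexity together with [gmoment_rec] squeezes the ratio of two
    consecutive moments between [sqrt (n / 2)] and [sqrt ((n + 1) / 2)]. *)
Lemma gmoment_ratio_le n : (J n.+1 / J n) ^+ 2 <= n.+1%:R / 2.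
Proof.
have J0 := @gmoment_gt0 R n.
rewrite expr_div_n ler_pdivrMr ?exprn_gt0//.
by have := gmoment_log_convex R n; rewrite gmoment_rec expr2; nra.
Qed.

Lemma gmoment_ratio_ge n : n%:R / 2 <= (J n.+1 / J n) ^+ 2.
Proof.
case: n => [|n]; first by rewrite mul0r sqr_ge0.
have J0 := @gmoment_gt0 R n.+1.
rewrite expr_div_n ler_pdivlMr ?exprn_gt0//.
have := gmoment_log_convex R n; have e := gmoment_rec R n.
have n0 : 0 < n.+1%:R :> R by [].
have -> : J n = n.+1%:R^-1 * 2 * J n.+2 by rewrite e; field.
set a := J n.+1; set b := J n.+2; set N := n.+1%:R in n0 *.
rewrite -(ler_pM2l n0); have -> : N * (N^-1 * 2 * b * b) = 2 * b ^+ 2.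
  by field; rewrite gt_eqF.
lra.
Qed.

Lemma gmoment_ratio_cvg i :
  J (k.*2 + i).+1 / J (k.*2 + i)%N / Num.sqrt k%:R @[k --> \oo] --> (1 : R).
Proof.
have sq : (J (k.*2 + i).+1 / J (k.*2 + i)%N) ^+ 2 / k%:R @[k --> \oo] --> (1 : R).
  have h c : (1 + c / 2 * k%:R^-1) @[k --> \oo] --> (1 : R).
    rewrite -[X in _ --> X]addr0 -[X in _ --> _ + X](mulr0 (c / 2)).
    apply: cvgD; first exact: cvg_cst.
    apply: cvgM; first exact: cvg_cst.
    by rewrite -(cvg_shiftS); exact: cvg_harmonic.
  apply: (@squeeze_cvgr _ _ _ _ (fun k => 1 + i%:R / 2 * k%:R^-1)
    (fun k => 1 + i.+1%:R / 2 * k%:R^-1)); [|exact: h|exact: h].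
  near=> k; have k0 : 0 < k%:R :> R.
    by rewrite ltr0n; near: k; exact: nbhs_infty_gt.
  have := gmoment_ratio_ge (k.*2 + i); have := gmoment_ratio_le (k.*2 + i).
  rewrite -addnS !natrD -mul2n natrM; set a := (_ / _) ^+ 2 => h1 h2.
  rewrite ler_pdivlMr// ler_pdivrMr// !mulrDl !mul1r !divfK ?gt_eqF//.
  by apply/andP; split; lra.
have := cvg_comp _ _ sq (@sqrt_continuous R 1).
rewrite sqrtr1; apply: cvg_trans; apply: near_eq_cvg.
near=> k => /=.
rewrite sqrtrM ?sqr_ge0// sqrtr_sqr ger0_norm ?sqrtrV//.
by rewrite divr_ge0// ltW// gmoment_gt0.
Unshelve. all: by end_near. Qed.

Lemma gmoment_shift_cvg m :
  J (k.*2 + m)%N / J k.*2 / Num.sqrt k%:R ^+ m @[k --> \oo] --> (1 : R).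
Proof.
elim: m => [|m IHm].
  rewrite (_ : (fun _ => _) = fun=> 1); first exact: cvg_cst.
  by apply/funext => k; rewrite addn0 divff ?gt_eqF ?gmoment_gt0// expr0 divr1.
have h : (J (k.*2 + m).+1 / J (k.*2 + m)%N / Num.sqrt k%:R) *
    (J (k.*2 + m)%N / J k.*2 / Num.sqrt k%:R ^+ m) @[k --> \oo] --> (1 * 1 : R).
  exact: cvgM (gmoment_ratio_cvg m) IHm.
rewrite mulr1 in h.
apply: cvg_trans h; apply: near_eq_cvg; near=> k.
have k0 : Num.sqrt k%:R != 0 :> R.
  by rewrite gt_eqF// sqrtr_gt0 ltr0n; near: k; exact: nbhs_infty_gt.
have j0 := gmoment_gt0 R (k.*2 + m); have j1 := gmoment_gt0 R k.*2.
rewrite /= addnS exprS; field.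
by rewrite ?expf_neq0 ?k0 //= !gt_eqF.
Unshelve. all: by end_near. Qed.

(** The recursion of [moment_succ] is also satisfied by
    [J (2 k) / J (2 k + m + 1)], where [J] are the Gaussian moments, so that
    [M k] is a fixed multiple of this ratio. *)
Lemma moment_asymptotic (m : nat) (M : nat -> R) :
  (forall k, M k.+1 = k.*2.+1%:R / (k.*2 + m.+2)%:R * M k) ->
  Num.sqrt k%:R ^+ m.+1 * M k @[k --> \oo] -->
    M 0%N * (Gamma (m.+2%:R / 2) / Num.sqrt pi).
Proof.
move=> Mrec.
have ME k : M k * J 0 * J (k.*2 + m.+1)%N = M 0%N * J k.*2 * J m.+1.
  elim: k => [|k IHk]; first by rewrite add0n.
  rewrite Mrec doubleS addSn addSn !gmoment_rec.
  have e : (k.*2 + m.+1).+1%:R = (k.*2 + m.+2)%:R :> R by rewrite -addnS.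
  have nz : (k.*2 + m.+2)%:R != 0 :> R by rewrite pnatr_eq0; lia.
  transitivity (k.*2.+1%:R / 2 * (M k * J 0 * J (k.*2 + m.+1)%N)).
    by rewrite e; field.
  by rewrite IHk; ring.
have h : M 0%N * (J m.+1 / J 0) *
    (J (k.*2 + m.+1)%N / J k.*2 / Num.sqrt k%:R ^+ m.+1)^-1 @[k --> \oo] -->
    M 0%N * (J m.+1 / J 0) * 1^-1.
  apply: cvgM; first exact: cvg_cst.
  by apply: cvgV; [exact: oner_neq0|exact: gmoment_shift_cvg].
rewrite invr1 mulr1 in h.
have -> : Gamma (m.+2%:R / 2) / Num.sqrt pi = J m.+1 / J 0.
  rewrite Gamma_half gmoment0; field.
  by rewrite gt_eqF// sqrtr_gt0 pi_gt0.
apply: cvg_trans h; apply: near_eq_cvg; near=> k.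
have j0 := gmoment_gt0 R 0; have j1 := gmoment_gt0 R k.*2.
have j2 := gmoment_gt0 R (k.*2 + m.+1).
have k0 : Num.sqrt k%:R != 0 :> R.
  by rewrite gt_eqF// sqrtr_gt0 ltr0n; near: k; exact: nbhs_infty_gt.
have -> : M k = M 0%N * J k.*2 * J m.+1 / (J 0 * J (k.*2 + m.+1)%N).
  by rewrite -ME; field; rewrite !gt_eqF.
rewrite /= /cst; field.
by rewrite ?expf_neq0 ?k0 //= !gt_eqF.
Unshelve. all: by end_near. Qed.

Lemma moment_asymptotic_comp (p : nat) (M : nat -> R) (L c : R) (f : R -> nat) :
  0 < c -> (forall x, 0 <= x -> `|(f x)%:R - c * x| <= 1) ->
  Num.sqrt k%:R ^+ p * M k @[k --> \oo] --> L ->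
  Num.sqrt x ^+ p * M (f x) @[x --> +oo] --> Num.sqrt c^-1 ^+ p * L.
Proof.
move=> c0 fc ML.
have foo : f x @[x --> +oo] --> \oo.
  apply/cvgnyPge => A; near=> x.
  have x0 : 0 <= x by near: x; apply: nbhs_pinfty_ge; exact: num_real.
  have := fc x x0; rewrite ler_norml => /andP[h _].
  have : (A.+1)%:R / c <= x by near: x; apply: nbhs_pinfty_ge; exact: num_real.
  rewrite ler_pdivrMr// -natr1 mulrC => h'.
  by rewrite -(@ler_nat R); lra.
have fx : (f x)%:R / x @[x --> +oo] --> c.
  have ix : (x^-1 @[x --> +oo] --> (0 : R)) by apply/gtr0_cvgV0; [apply: nbhs_pinfty_gt; exact: num_real|exact: cvg_id].
  apply: (@squeeze_cvgr _ _ _ _ (fun x => c - x^-1) (fun x => c + x^-1)).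
  - near=> x; have x0 : 0 < x by near: x; apply: nbhs_pinfty_gt; exact: num_real.
    have := fc x (ltW x0); rewrite ler_norml => /andP[h1 h2].
    rewrite ler_pdivlMr// ler_pdivrMr// mulrBl mulrDl mulVf ?gt_eqF//.
    by apply/andP; split; lra.
  - by rewrite -[X in _ --> X]subr0; apply: cvgB => //; exact: cvg_cst.
  - by rewrite -[X in _ --> X]addr0; apply: cvgD => //; exact: cvg_cst.
have xf : Num.sqrt ((f x)%:R / x)^-1 ^+ p @[x --> +oo] --> Num.sqrt c^-1 ^+ p.
  have s1 : ((f x)%:R / x)^-1 @[x --> +oo] --> c^-1 by apply: cvgV => //; rewrite gt_eqF.
  have s2 : Num.sqrt ((f x)%:R / x)^-1 @[x --> +oo] --> Num.sqrt c^-1.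
    exact: (cvg_comp _ _ s1 (@sqrt_continuous R _)).
  exact: (cvg_comp _ _ s2 (@exprn_continuous R p _)).
have h : Num.sqrt ((f x)%:R / x)^-1 ^+ p * (Num.sqrt (f x)%:R ^+ p * M (f x))
    @[x --> +oo] --> Num.sqrt c^-1 ^+ p * L.
  by apply: cvgM => //; exact: (cvg_comp _ _ foo ML).
apply: cvg_trans h; apply: near_eq_cvg; near=> x.
have x0 : 0 < x by near: x; apply: nbhs_pinfty_gt; exact: num_real.
have f0 : (0 < f x)%N by near: x; move/cvgnyPgt : foo; exact.
rewrite /= mulrA -exprMn -sqrtrM; last by rewrite invr_ge0 divr_ge0// ltW.
rewrite invf_div divfK//.
by rewrite pnatr_eq0 -lt0n.
Unshelve. all: by end_near. Qed.

End gmoment_ratio.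

(** * Laplace transform of a direction cosine *)

Lemma cvg_sqrt_expr_expR (R : realType) (p : nat) (eta : R) : 0 < eta ->
  Num.sqrt x ^+ p * expR (- (eta * x)) @[x --> +oo] --> (0 : R).
Proof.
move=> eta0; pose C : R := p.+1`!%:R / eta ^+ p.+1.
have C0 : 0 < C by rewrite divr_gt0 ?exprn_gt0// ltr0n fact_gt0.
apply: (@squeeze_cvgr _ _ _ _ (fun=> 0) (fun x => C * x^-1)); last 2 first.
- exact: cvg_cst.
- rewrite -[X in _ --> X](mulr0 C); apply: cvgM; first exact: cvg_cst.
  by apply/gtr0_cvgV0; [apply: nbhs_pinfty_gt; exact: num_real|exact: cvg_id].
near=> x; have x1 : 1 <= x by near: x; apply: nbhs_pinfty_ge; exact: num_real.
have x0 : 0 < x by lra.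
rewrite mulr_ge0 ?expR_ge0 ?exprn_ge0 ?sqrtr_ge0//=.
have sx : Num.sqrt x ^+ p <= x ^+ p.
  have s1 : 1 <= Num.sqrt x by rewrite -[leLHS]sqrtr1 ler_wsqrtr.
  have s2 : Num.sqrt x ^+ 2 = x by rewrite sqr_sqrtr// ltW.
  have s3 : Num.sqrt x <= x by rewrite -[leRHS]s2 expr2 ler_peMl ?sqrtr_ge0.
  by rewrite lerXn2r ?nnegrE ?sqrtr_ge0// ltW.
apply: (le_trans (ler_wpM2r (expR_ge0 _) sx)).
rewrite expRN ler_pdivrMr ?expR_gt0// mulrAC ler_pdivlMr// -exprSr.
have h : (eta * x) ^+ p.+1 / p.+1`!%:R <= expR (eta * x).
  by apply: le_trans (expR_ge1Dxn p _); rewrite ?lerDr// mulr_ge0 ?ltW.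
have -> : x ^+ p.+1 = C * ((eta * x) ^+ p.+1 / p.+1`!%:R).
  rewrite /C exprMn; field.
  by rewrite pnatr_eq0 -lt0n fact_gt0 expf_neq0// gt_eqF.
by rewrite ler_wpM2l// ltW.
Unshelve. all: by end_near. Qed.

Section sphere_laplace.
Context (R : realType) (m : nat).
Local Notation d := m.+2.
Variable i0 : 'I_d.
Local Notation E := (borel_rV R d).
Variable mu : probability E R.
Hypothesis mu_rot : forall Q : 'M[R]_d, Q *m Q^T = 1%:M ->
  forall A : set E, measurable A -> mu [set x | A ((x : 'rV[R]_d) *m Q)] = mu A.

Local Notation U := (dircos i0).
Local Notation nz := (@nonzero R d).

(** The Laplace transform of [1 - cos], which governs how likely a random
    direction is to be within a small angle of a fixed one. *)
Definition lap (l : R) := \int[mu]_y (expR (- (l * (1 - U y))) * nz y).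

Lemma bounded_laplace (s l : R) : 0 <= l -> `|s| <= 1 ->
  bounded_measurable (fun y => expR (- (l * (1 - s * U y))) * nz y).
Proof.
move=> l0 s1; apply: bounded_measurableM; last exact: bounded_nonzero.
split.
  apply: (measurableT_comp (@measurable_expR R)).
  apply: measurable_funN; apply: measurable_funM; first exact: measurable_cst.
  apply: measurable_funB; first exact: measurable_cst.
  by apply: measurable_funM; [exact: measurable_cst|exact: measurable_dircos].
exists 1 => y; rewrite ger0_norm ?expR_ge0// expR_le1 oppr_le0 mulr_ge0//.
rewrite subr_ge0; apply: le_trans (ler_norm _) _; rewrite normrM.
by rewrite mulr_ile1// dircos_le1.
Qed.

Lemma lap_opp l : 0 <= l ->
  \int[mu]_y (expR (- (l * (1 + U y))) * nz y) = lap l.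
Proof.
move=> l0; pose f (z : R * R) : \bar R :=
  (expR (- (l * (1 + z.2 * z.1 `^ -1))) * (z.1 != 0)%:R)%:E.
have mf : measurable_fun setT f.
  apply/measurable_EFinP; apply: measurable_funM.
    apply: (measurableT_comp (@measurable_expR R)).
    apply: measurable_funN; apply: measurable_funM; first exact: measurable_cst.
    apply: measurable_funD; first exact: measurable_cst.
    apply: measurable_funM => //.
    exact: (measurableT_comp (@measurable_powR R (-1)) measurable_fst).
  apply: (@measurableT_comp _ _ _ _ _ _ (fun r : R => (r != 0)%:R : R)) => //.
  rewrite (_ : (fun _ => _) = \1_(~` [set 0])).
    by apply: measurable_indic; exact: measurableC.
  by apply/funext => r; rewrite neq0_indicE.
have f0 z : (0 <= f z)%E by rewrite lee_fin mulr_ge0 ?expR_ge0.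
pose e0 : 'rV[R]_d := delta_mx ord0 i0.
have vv : dot (- e0) (- e0) = 1 by rewrite dotNl dotNr opprK dot_e0 mxE !eqxx.
have := polar_integral i0 mu_rot vv mf f0.
have fE v y : f (polar v y) =
    (expR (- (l * (1 + dot (y : 'rV[R]_d) v / enorm (y : 'rV[R]_d)))) * nz y)%:E.
  by rewrite -(powR_inv1 (enorm_ge0 _)).
rewrite /lap /Rintegral => e; congr fine; transitivity (\int[mu]_x f (polar e0 x))%E.
  by apply: eq_integral => y _; rewrite fE dot_e0.
by rewrite -e; apply: eq_integral => y _; rewrite fE dotNr dot_e0 mulNr.
Qed.

(** By symmetry the cosine may be replaced by its absolute value up to the
    factor 2; even moments can then be compared with exponentials. *)
Lemma lap2 l : 0 <= l -> 2 * lap l =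
  \int[mu]_y ((expR (- (l * (1 - U y))) + expR (- (l * (1 + U y)))) * nz y).
Proof.
move=> l0; have b1 := @bounded_laplace 1 l l0; have b2 := @bounded_laplace (-1) l l0.
rewrite normrN normr1 in b1 b2.
transitivity (lap l + lap l); first by rewrite mulr_natl mulr2n.
rewrite -{2}lap_opp// -RintegralD//; last 2 first.
- apply: bounded_measurable_integrable.
  by have := b1 (lexx _); under eq_fun do rewrite mul1r.
- apply: bounded_measurable_integrable.
  by have := b2 (lexx _); under eq_fun do rewrite mulN1r opprK.
by apply: eq_Rintegral => y _; rewrite mulrDl.
Qed.

Let bounded_lap2 l : 0 <= l ->
  bounded_measurable (fun y => (expR (- (l * (1 - U y))) + expR (- (l * (1 + U y)))) * nz y).
Proof.
move=> l0; have b1 := @bounded_laplace 1 l l0; have b2 := @bounded_laplace (-1) l l0.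
rewrite normrN normr1 in b1 b2.
under eq_fun do rewrite mulrDl; apply: bounded_measurableD.
  by have := b1 (lexx _); under eq_fun do rewrite mul1r.
by have := b2 (lexx _); under eq_fun do rewrite mulN1r opprK.
Qed.

Let bounded_moment k : bounded_measurable (fun y => U y ^+ k.*2 * nz y).
Proof.
apply: bounded_measurableM; last exact: bounded_nonzero.
by apply: bounded_measurableX; exact: bounded_dircos.
Qed.

(** [u ^ (2 k) <= exp (- 2 k (1 - u))]. *)
Lemma lap_ge_moment l k : 0 <= l -> l <= k.*2%:R -> moment i0 mu k <= 2 * lap l.
Proof.
move=> l0 lk; rewrite lap2//; apply: le_Rintegral => //.
- exact/bounded_measurable_integrable/bounded_moment.
- exact/bounded_measurable_integrable/bounded_lap2.
move=> y _; rewrite ler_wpM2r ?ler0n//.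
suff h (u : R) : 0 <= u -> u <= 1 -> u ^+ k.*2 <= expR (- (l * (1 - u))).
  have := dircos_le1 i0 y; rewrite ler_norml => /andP[u1 u2].
  have [u0|u0] := leP 0 (U y).
    by apply: le_trans (h _ u0 u2) _; rewrite lerDl expR_ge0.
  have := h (- U y); rewrite opprK -mul2n exprM sqrrN -exprM mul2n => h'.
  by apply: le_trans (h' _ _) _; [lra|lra|rewrite lerDr expR_ge0].
move=> u0 u1; apply: (@le_trans _ _ (expR (u - 1) ^+ k.*2)).
  by rewrite lerXn2r ?nnegrE ?expR_ge0//; have := expR_ge1Dx (u - 1); lra.
by rewrite -expRM_natr ler_expR; nra.
Qed.

(** Within [eta] of 1, [exp (- (1 + del) (1 - u)) <= u]; farther away the
    exponential is at most [exp (- eta l)]. *)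
Lemma lap_le_moment l k (del : R) : 0 < del -> k.*2%:R * (1 + del) <= l ->
  2 * lap l <= moment i0 mu k + 2 * expR (- (del / (1 + del) * l)).
Proof.
move=> del0 kl; set eta := del / (1 + del).
have l0 : 0 <= l by apply: le_trans kl; rewrite mulr_ge0//; lra.
have bc : bounded_measurable (fun y : E => 2 * expR (- (eta * l))).
  exact: bounded_measurable_cst.
have eta_le1 : eta <= 1 by rewrite ler_pdivrMr; lra.
have cE : 2 * expR (- (eta * l)) = \int[mu]_y (2 * expR (- (eta * l))).
  have mu1 : fine (mu setT) = 1 by rewrite (@probability_setT _ _ _ mu).
  by rewrite Rintegral_cst// [fine _](_ : _ = 1) ?mulr1.
rewrite cE lap2// -RintegralD//; last 2 first.
- exact/bounded_measurable_integrable/bounded_moment.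
- exact/bounded_measurable_integrable.
apply: le_Rintegral => //.
- exact/bounded_measurable_integrable/bounded_lap2.
- by apply/bounded_measurable_integrable/bounded_measurableD.
move=> y _; rewrite /nonzero; case: (_ != 0); last first.
  by rewrite !mulr0 add0r mulr_ge0// expR_ge0.
rewrite !mulr1.
suff h (u : R) : 0 <= u -> u <= 1 -> expR (- (l * (1 - u))) + expR (- (l * (1 + u))) <=
    u ^+ k.*2 + 2 * expR (- (eta * l)).
  have := dircos_le1 i0 y; rewrite ler_norml => /andP[u1 u2].
  have [u0|u0] := leP 0 (U y); first exact: h.
  have := h (- U y); rewrite opprK -mul2n exprM sqrrN -exprM mul2n => h'.
  by rewrite addrC; apply: h'; lra.
move=> u0 u1.
have e2 : expR (- (l * (1 + u))) <= expR (- (eta * l)) by rewrite ler_expR; nra.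
suff e1 : expR (- (l * (1 - u))) <= u ^+ k.*2 + expR (- (eta * l)).
  by apply: le_trans (lerD e1 e2) _; lra.
have [ule|ult] := leP (1 - u) eta; last first.
  apply: ler_wpDl; first exact: exprn_ge0.
  by rewrite ler_expR; nra.
apply: ler_wpDr; first exact: expR_ge0.
apply: (@le_trans _ _ (expR (- ((1 + del) * (1 - u))) ^+ k.*2)).
  by rewrite -expRM_natr ler_expR; nra.
rewrite lerXn2r ?nnegrE ?expR_ge0//.
set w := (1 + del) * (1 - u).
have w0 : 0 <= w by rewrite mulr_ge0; lra.
rewrite expRN; apply: (@le_trans _ _ (1 + w)^-1).
  by rewrite lef_pV2 ?posrE ?expR_gt0 ?expR_ge1Dx//; lra.
rewrite -[leLHS]mul1r ler_pdivrMr; last lra.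
have : (1 - u) * (1 + del) <= del by move: ule; rewrite ler_pdivlMr; lra.
rewrite /w; nra.
Qed.

(** The Laplace transform at [l] lies between half the moments of orders about
    [l] and [l / (1 + del)], both of which are known to leading order. *)
Theorem lap_asymptotic :
  Num.sqrt l ^+ m.+1 * lap l @[l --> +oo] -->
  moment i0 mu 0 * (Num.sqrt 2 ^+ m.+1 * Gamma (m.+2%:R / 2) / (2 * Num.sqrt pi)).
Proof.
set p := m.+1; set L := moment i0 mu 0 * (Gamma (m.+2%:R / 2) / Num.sqrt pi).
have Mk : Num.sqrt k%:R ^+ p * moment i0 mu k @[k --> \oo] --> L.
  by apply: moment_asymptotic => k; exact: moment_succ.
have low : Num.sqrt l ^+ p * moment i0 mu (Num.truncn (2^-1 * l)).+1 @[l --> +oo]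
    --> Num.sqrt 2 ^+ p * L.
  have := @moment_asymptotic_comp R p (moment i0 mu) L 2^-1
    (fun l => (Num.truncn (2^-1 * l)).+1).
  rewrite invrK; apply=> //.
  move=> x x0; have /truncn_itv/andP[h1 h2] : 0 <= 2^-1 * x by rewrite mulr_ge0.
  rewrite -[(Num.truncn _).+1%:R]natr1 in h2 *.
  by rewrite ler_norml; apply/andP; split; lra.
have upp del : 0 < del -> Num.sqrt l ^+ p *
    moment i0 mu (Num.truncn ((2 * (1 + del))^-1 * l)) @[l --> +oo]
    --> Num.sqrt (2 * (1 + del)) ^+ p * L.
  move=> del0; have c0 : 0 < (2 * (1 + del))^-1 by rewrite invr_gt0; lra.
  have := @moment_asymptotic_comp R p (moment i0 mu) L (2 * (1 + del))^-1
    (fun l => (Num.truncn ((2 * (1 + del))^-1 * l))).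
  rewrite invrK; apply=> //.
  move=> x x0; have /truncn_itv/andP[h1 h2] : 0 <= (2 * (1 + del))^-1 * x.
    by rewrite mulr_ge0// ltW.
  rewrite -[(Num.truncn _).+1%:R]natr1 in h2.
  by rewrite ler_norml; apply/andP; split; lra.
suff : Num.sqrt l ^+ p * (2 * lap l) @[l --> +oo] --> Num.sqrt 2 ^+ p * L.
  move=> h.
  have h2 : 2^-1 * (Num.sqrt l ^+ p * (2 * lap l)) @[l --> +oo] -->
    2^-1 * (Num.sqrt 2 ^+ p * L) by apply: cvgM => //; exact: cvg_cst.
  have -> : moment i0 mu 0 * (Num.sqrt 2 ^+ p * Gamma (m.+2%:R / 2) / (2 * Num.sqrt pi)) =
    2^-1 * (Num.sqrt 2 ^+ p * L).
    by rewrite /L; field; rewrite gt_eqF// sqrtr_gt0 pi_gt0.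
  apply: cvg_trans h2; apply: near_eq_cvg; near=> l; by field.
apply/cvgrPdist_le => e e0.
have e3 : 0 < e / 3 by rewrite divr_gt0.
have [del del0 hdel] : exists2 del : R, 0 < del &
    Num.sqrt (2 * (1 + del)) ^+ p * L <= Num.sqrt 2 ^+ p * L + e / 3.
  have c : Num.sqrt (2 * (1 + del)) ^+ p * L @[del --> 0^'+] -->
      Num.sqrt (2 * (1 + 0)) ^+ p * L.
    apply: cvg_at_right_filter; apply: cvgM; last exact: cvg_cst.
    have s1 : 2 * (1 + del) @[del --> (0 : R)] --> 2 * (1 + 0 : R).
      apply: cvgM; first exact: cvg_cst.
      by apply: cvgD; [exact: cvg_cst|exact: cvg_id].
    have s2 := cvg_comp _ _ s1 (@sqrt_continuous R _).
    exact: (cvg_comp _ _ s2 (@exprn_continuous R p _)).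
  rewrite addr0 mulr1 in c.
  have /cvgrPdist_le/(_ _ e3) c' := c.
  near (0 : R)^'+ => del; exists del; first by near: del; exact: nbhs_right_gt.
  have : `|Num.sqrt 2 ^+ p * L - Num.sqrt (2 * (1 + del)) ^+ p * L| <= e / 3.
    by near: del.
  by rewrite ler_norml => /andP[? ?]; lra.
have err : Num.sqrt l ^+ p * expR (- (del / (1 + del) * l)) @[l --> +oo] --> (0 : R).
  by apply: cvg_sqrt_expr_expR; rewrite divr_gt0//; lra.
near=> l.
have l0 : 0 <= l by near: l; apply: nbhs_pinfty_ge; exact: num_real.
have sl : 0 <= Num.sqrt l ^+ p by rewrite exprn_ge0 ?sqrtr_ge0.
have lo : `|Num.sqrt 2 ^+ p * L -
    Num.sqrt l ^+ p * moment i0 mu (Num.truncn (2^-1 * l)).+1| <= e / 3.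
  by near: l; move/cvgrPdist_le : low; exact.
have up : `|Num.sqrt (2 * (1 + del)) ^+ p * L - Num.sqrt l ^+ p *
    moment i0 mu (Num.truncn ((2 * (1 + del))^-1 * l))| <= e / 3.
  by near: l; move/cvgrPdist_le : (upp del del0); exact.
have er : `|0 - Num.sqrt l ^+ p * expR (- (del / (1 + del) * l))| <= e / 6.
  by near: l; move/cvgrPdist_le : err; apply; rewrite divr_gt0.
rewrite sub0r normrN ger0_norm ?mulr_ge0 ?expR_ge0// in er.
have h1 : moment i0 mu (Num.truncn (2^-1 * l)).+1 <= 2 * lap l.
  apply: lap_ge_moment => //.
  have /truncn_itv/andP[_ h2] : 0 <= 2^-1 * l by rewrite mulr_ge0.
  by rewrite -mul2n natrM; lra.
have c0 : 0 < 2 * (1 + del) by lra.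
have h2 : 2 * lap l <= moment i0 mu (Num.truncn ((2 * (1 + del))^-1 * l)) +
    2 * expR (- (del / (1 + del) * l)).
  apply: lap_le_moment => //.
  have /truncn_itv/andP[h _] : 0 <= (2 * (1 + del))^-1 * l.
    by rewrite mulr_ge0// invr_ge0 ltW.
  by rewrite -mul2n natrM; rewrite -(ler_pM2l c0) mulrA divff ?gt_eqF// in h; lra.
have {}h1 := ler_wpM2l sl h1; have {}h2 := ler_wpM2l sl h2.
rewrite mulrDr in h2.
rewrite !ler_norml in lo up *.
by move: lo up => /andP[lo1 lo2] /andP[up1 up2]; apply/andP; split; lra.
Unshelve. all: by end_near. Qed.

End sphere_laplace.

(** * Local linearity of the tail exponent *)

Section slow_variation.
Context (R : realType).

Lemma MVT_derivable (f : R -> R) (u w : R) : u <= w ->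
  (forall x, u <= x <= w -> derivable f x 1) ->
  exists2 c, u <= c <= w & f w - f u = derive1 f c * (w - u).
Proof.
move=> uw df.
have [] := @MVT_segment R f (derive1 f) u w uw.
- move=> x; rewrite in_itv/= => /andP[ux xw].
  have /df/derivableP : u <= x <= w by rewrite !ltW.
  by rewrite derive1E.
- by apply: derivable_within_continuous => x; rewrite in_itv/=; exact: df.
by move=> c; rewrite in_itv/= => uc ->; exists c.
Qed.

(** The antiderivative of [- v ^ 2 * exp (- v)]. In the variable
    [v = ln (c * g' x)], the hypothesis on [g''] says that the derivative of
    [psi v] is small; see [derivative_ratio]. *)
Definition psi (v : R) : R := expR (- v) * (v ^+ 2 + 2 * v + 2).

Lemma is_derive_psi (v : R) : is_derive v 1 psi (- (v ^+ 2 * expR (- v))).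
Proof. by apply: is_derive_eq; rewrite /GRing.scale/=; ring. Qed.

Lemma psi_MVT u w : u <= w ->
  exists2 c, u <= c <= w & psi w - psi u = - (c ^+ 2 * expR (- c)) * (w - u).
Proof.
move=> uw; have [|c uc] := @MVT_derivable psi u w uw.
  by move=> x _; have [] := is_derive_psi x.
by rewrite derive1E; have [_ ->] := is_derive_psi c; move=> e; exists c.
Qed.

Lemma psi_nonincr u w : u <= w -> psi w <= psi u.
Proof.
move=> uw; have [c _ e] := psi_MVT uw; rewrite -subr_le0 e mulNr oppr_le0.
by apply: mulr_ge0; [rewrite mulr_ge0 ?sqr_ge0 ?expR_ge0|rewrite subr_ge0].
Qed.

(** A quantitative inverse of [psi]: on the interval of length [theta / v0]
    next to [v0], the derivative of [psi] is at least [v0 ^ 2 * exp (- v0) / 4]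
    in absolute value, and [psi] is monotone beyond. *)
Lemma psi_separates (v0 v theta : R) : 0 < theta -> 2 <= v0 -> theta <= v0 ->
  `|psi v - psi v0| < theta / 4 * v0 * expR (- v0) -> `|v - v0| <= theta / v0.
Proof.
move=> t0 v02 tv; have v00 : 0 < v0 by lra.
set s := theta / v0; have s0 : 0 < s by rewrite divr_gt0.
have s1 : s <= 1 by rewrite ler_pdivrMr// mul1r.
have sv : s * v0 = theta by rewrite divfK// gt_eqF.
rewrite ltr_norml => /andP[h1 h2]; rewrite leNgt; apply/negP => h.
have e0 := expR_gt0 (- v0).
have [vv0|v0v] := leP v v0.
  rewrite ler0_norm ?subr_le0// in h.
  have vs : v <= v0 - s by lra.
  have h3 := psi_nonincr vs.
  have [|c /andP[c1 c2] e] := @psi_MVT (v0 - s) v0; first lra.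
  have ce : expR (- v0) <= expR (- c) by rewrite ler_expR; lra.
  have cc : v0 ^+ 2 / 4 <= c ^+ 2 by nra.
  have : v0 ^+ 2 / 4 * expR (- v0) <= c ^+ 2 * expR (- c).
    by rewrite ler_pM// ?expR_ge0// divr_ge0// sqr_ge0.
  move: e; have -> : v0 - (v0 - s) = s by ring.
  move=> e h4.
  have h5 : s * (v0 ^+ 2 / 4 * expR (- v0)) <= s * (c ^+ 2 * expR (- c)).
    by rewrite ler_pM2l.
  have e5 : s * (v0 ^+ 2 / 4 * expR (- v0)) = theta / 4 * v0 * expR (- v0).
    by rewrite -sv; field.
  lra.
rewrite gtr0_norm ?subr_gt0// in h.
have vs : v0 + s <= v by lra.
have h3 := psi_nonincr vs.
have [|c /andP[c1 c2] e] := @psi_MVT v0 (v0 + s); first lra.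
have ce : expR (- v0) / 4 <= expR (- c).
  have : expR (- v0) * expR (- 1) <= expR (- c) by rewrite -expRD ler_expR; lra.
  have : 4^-1 <= expR (- 1 : R).
    have -> : - 1 = - 2^-1 + - 2^-1 :> R by field.
    by rewrite expRD; have := expR_ge1Dx (- 2^-1 : R); nra.
  by nra.
have cc : v0 ^+ 2 <= c ^+ 2 by nra.
have : v0 ^+ 2 * (expR (- v0) / 4) <= c ^+ 2 * expR (- c).
  by rewrite ler_pM// ?divr_ge0 ?expR_ge0// sqr_ge0.
move: e; have -> : v0 + s - v0 = s by ring.
move=> e h4.
have h5 : s * (v0 ^+ 2 * (expR (- v0) / 4)) <= s * (c ^+ 2 * expR (- c)).
  by rewrite ler_pM2l.
have e5 : s * (v0 ^+ 2 * (expR (- v0) / 4)) = theta / 4 * v0 * expR (- v0).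
  by rewrite -sv; field.
lra.
Qed.

Lemma expR_dist_le (w : R) : `|w| <= 2^-1 -> `|expR w - 1| <= 2 * `|w|.
Proof.
move=> w1; have h1 := expR_ge1Dx w; have h2 := expR_ge1Dx (- w).
have e0 := expR_gt0 w; have e1 := expRxMexpNx_1 w.
move: w1; rewrite ler_norml => /andP[w1 w2].
have [w0|w0] := leP 0 w; last first.
  by rewrite (ltr0_norm w0) ler_norml; apply/andP; split; nra.
rewrite (ger0_norm w0) ler_norml; apply/andP; split; first lra.
have h3 : expR w * (1 - w) <= 1 by rewrite -e1 ler_pM2l//; lra.
by rewrite lerBlDr -(@ler_pM2r _ (1 - w)); [apply: (le_trans h3); nra|lra].
Qed.

Variable g : R -> R.
Hypothesis g_derivable : \forall x \near +oo,
  derivable g x 1 /\ derivable (derive1 g) x 1.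
Hypothesis g_cond1 : x * derive1 g x @[x --> +oo] --> +oo.
Hypothesis g_cond2 :
  derive1n 2 g x / derive1 g x ^+ 2 * ln (x * derive1 g x) ^+ 2 @[x --> +oo] --> 0.

Local Notation g' := (derive1 g).
Local Notation el x := (ln (x * g' x)).

(** The derivative [g'] varies little on the scale of [ln (a g' a) / g' a].
    With [c = a / 2] and [v x = ln (c * g' x)], the derivative of [psi (v x)]
    is [- g'' x / (g' x) ^ 2 * (v x) ^ 2 / c]. On [[a / 2, 2 a]] one has
    [0 <= v x <= ln (x * g' x)], so that this is at most [eta / c] for a small
    [eta]. Integrated from [a] to [x], this bounds [psi (v x) - psi (v a)], and
    [psi_separates] converts it into a bound on [ln (g' x / g' a)]. *)
Lemma derivative_ratio (K theta : R) : 0 < K -> 0 < theta ->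
  \forall a \near +oo, forall x, `|x - a| <= K * el a / g' a ->
  [/\ 0 < g' x, a / 2 <= x, derivable g x 1 &
    `|ln (g' x / g' a)| <= theta / el a].
Proof.
move=> K0 theta0.
(* 64 leaves room for psi (v x) - psi (v a) to meet psi_separates at theta / 2 *)
pose eta := theta / (64 * K).
have eta0 : 0 < eta by rewrite divr_gt0// mulr_gt0.
have big : \forall x \near +oo, [/\ derivable g x 1, derivable g' x 1,
    16 <= x * g' x, 0 < x &
    `|derive1n 2 g x / g' x ^+ 2 * el x ^+ 2| <= eta].
  near=> x.
  have x00 : 0 < x by near: x; apply: nbhs_pinfty_gt; exact: num_real.
  have [d1 d2] : derivable g x 1 /\ derivable g' x 1 by near: x.
  split=> //; first by near: x; move/cvgryPge : g_cond1; exact.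
  rewrite -normrN -sub0r; near: x.
  by move/cvgrPdist_le : g_cond2; exact.
have [x0 [x0R hx0]] := big.
near=> a.
have a0 : 0 < a by near: a; apply: nbhs_pinfty_gt; exact: num_real.
have ax0 : x0 < a / 2.
  by rewrite ltr_pdivlMr//; near: a; apply: nbhs_pinfty_gt; exact: num_real.
have hx x : a / 2 <= x -> [/\ derivable g x 1, derivable g' x 1,
    16 <= x * g' x, 0 < x &
    `|derive1n 2 g x / g' x ^+ 2 * el x ^+ 2| <= eta].
  by move=> ax; apply: hx0; exact: lt_le_trans ax.
have gp x : a / 2 <= x -> 0 < g' x.
  by move=> /hx[_ _ h x00 _]; rewrite -(pmulr_rgt0 _ x00); lra.
have ga0 : 0 < g' a by apply: gp; lra.
set l := el a.
have ag0 : 0 < a * g' a by rewrite mulr_gt0.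
have lbig : 4 + theta + 8 * K <= l.
  rewrite /l -[leLHS]expRK ler_ln ?posrE ?expR_gt0//.
  by near: a; move/cvgryPge : g_cond1; exact.
have el_a : expR l = a * g' a by rewrite lnK.
have lr : K * l / g' a <= a / 4.
  rewrite ler_pdivrMr// mulrAC -el_a.
  have : 1 + l ^+ 2 / 2 <= expR l by apply: (@expR_ge1Dxn R l 1); lra.
  by nra.
pose c := a / 2; have c0 : 0 < c by rewrite /c; lra.
pose v x := ln (c * g' x).
have cg x : a / 2 <= x -> x <= 2 * a -> 4 <= c * g' x.
  by move=> h1 h2; have [_ _ h _ _] := hx x h1; have := gp x h1; rewrite /c; nra.
have vl x : a / 2 <= x -> x <= 2 * a -> 0 <= v x <= el x.
  move=> h1 h2; have h := cg x h1 h2; have [_ _ h16 _ _] := hx x h1.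
  rewrite /v ln_ge0 /=; last lra.
  by rewrite ler_ln ?posrE ?(ler_pM2r (gp x h1))//; lra.
have dW x : a / 2 <= x -> x <= 2 * a ->
    is_derive x 1 (psi \o v) (- (v x ^+ 2 * expR (- v x)) * ((c * g' x)^-1 * (c * derive1 g' x))).
  move=> h1 h2; have h := cg x h1 h2; have [_ dg' _ _ _] := hx x h1.
  apply: is_derive1_comp; first exact: is_derive_psi.
  apply: (@is_derive1_comp _ (@ln R) (fun x => c * g' x)).
    by apply: is_derive1_ln; lra.
  have := derivableP dg'; rewrite -derive1E => h'.
  by apply: is_derive_eq.
have Wb x : a / 2 <= x -> x <= 2 * a -> `|derive1 (psi \o v) x| <= eta / c.
  move=> h1 h2; rewrite derive1E; have [_ ->] := dW x h1 h2.
  have h := cg x h1 h2; have [_ _ _ _ he] := hx x h1.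
  have /andP[v1 v2] := vl x h1 h2.
  rewrite {1}/v expRN lnK ?posrE; last lra.
  have gx := gp x h1.
  have -> : - (v x ^+ 2 * (c * g' x)^-1) * ((c * g' x)^-1 * (c * derive1 g' x)) =
      - (c^-1 * (derive1n 2 g x / g' x ^+ 2 * v x ^+ 2)).
    rewrite /derive1n/=; field.
    by rewrite !gt_eqF.
  rewrite normrN normrM gtr0_norm ?invr_gt0// mulrC ler_pM2r ?invr_gt0//.
  apply: le_trans he; rewrite normrM [leRHS]normrM ler_wpM2l//.
  rewrite (ger0_norm (sqr_ge0 (v x))) (ger0_norm (sqr_ge0 (el x))).
  by rewrite lerXn2r ?nnegrE//; lra.
have Wd u w : a / 2 <= u -> u <= w -> w <= 2 * a ->
    `|psi (v w) - psi (v u)| <= eta / c * (w - u).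
  move=> h1 h2 h3; have [z /andP[z1 z2]|z /andP[z1 z2] e] := @MVT_derivable (psi \o v) u w h2.
    by have [] := @dW z ltac:(lra) ltac:(lra).
  rewrite -[psi (v w)]/((psi \o v) w) -[psi (v u)]/((psi \o v) u) e normrM.
  rewrite (ger0_norm (_ : 0 <= w - u)) ?subr_ge0// ler_wpM2r ?subr_ge0//.
  by apply: Wb; lra.
move=> x xa.
have /andP[xa1 xa2] : a / 2 <= x <= 2 * a.
  by move: (le_trans xa lr); rewrite ler_norml => /andP[? ?]; apply/andP; split; lra.
split=> //; [exact: gp|by have [] := hx x xa1|].
have vE y : a / 2 <= y -> v y = ln (g' y) + ln c.
  by move=> h1; rewrite /v lnM ?posrE ?gp// addrC.
have aa : a / 2 <= a by lra.
have -> : ln (g' x / g' a) = v x - v a.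
  by rewrite ln_div ?posrE ?gp// !vE//; ring.
have ln2 : 0 <= (ln 2 : R) <= 1.
  apply/andP; split; first by apply: ln_ge0; lra.
  by rewrite -[leRHS]expRK ler_ln ?posrE ?expR_gt0//; have := @expR_ge1Dx R 1; lra.
have va : v a = l - ln 2.
  rewrite /v /l -ln_div ?posrE//; by congr ln; rewrite /c; field.
have cga : c * g' a = expR (v a) by rewrite lnK// posrE mulr_gt0.
have W : `|psi (v x) - psi (v a)| <= eta / c * `|x - a|.
  have [xa0|xa0] := leP x a.
    rewrite distrC (distrC x); have -> : `|a - x| = a - x by rewrite ger0_norm ?subr_ge0.
    by apply: Wd => //; lra.
  have -> : `|x - a| = x - a by rewrite gtr0_norm ?subr_gt0.
  by apply: Wd => //; exact: ltW.
have v0b : 2 <= v a /\ l / 2 <= v a /\ theta / 2 <= v a.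
  by move/andP: ln2 => [? ?]; rewrite va; split; [|split]; lra.
have [v1 [v2 v3]] := v0b.
apply: (@le_trans _ _ (theta / 2 / v a)); last first.
  rewrite ler_pdivrMr; last lra.
  rewrite mulrAC ler_pdivlMr; last lra.
  by nra.
apply: psi_separates => //; first by rewrite divr_gt0.
apply: (le_lt_trans W).
apply: (@le_lt_trans _ _ (eta / c * (K * l / g' a))).
  by rewrite ler_wpM2l// divr_ge0 ?ltW.
have -> : eta / c * (K * l / g' a) = theta / 64 * l * expR (- v a).
  by rewrite expRN -cga /eta; field; rewrite !gt_eqF.
rewrite ltr_pM2r ?expR_gt0//; nra.
Unshelve. all: by end_near. Qed.

(** By the mean value theorem, the error is the variation of [g'] times
    [x - a], where the former is of order [theta * g' a / ln (a g' a)]. *)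
Lemma local_linear (K eps : R) : 0 < K -> 0 < eps ->
  \forall a \near +oo, 0 < g' a /\ forall x, `|x - a| <= K * el a / g' a ->
    a / 2 <= x /\ `|g x - g a - (x - a) * g' a| <= eps.
Proof.
move=> K0 eps0; pose theta := eps / (2 * K).
have theta0 : 0 < theta by rewrite divr_gt0// mulr_gt0.
near=> a.
have a0 : 0 < a by near: a; apply: nbhs_pinfty_gt; exact: num_real.
have hx : forall x, `|x - a| <= K * el a / g' a ->
  [/\ 0 < g' x, a / 2 <= x, derivable g x 1 & `|ln (g' x / g' a)| <= theta / el a].
  by near: a; exact: derivative_ratio.
have big : expR (1 + 2 * theta) <= a * g' a.
  by near: a; move/cvgryPge : g_cond1; exact.
have ag0 : 0 < a * g' a := lt_le_trans (expR_gt0 _) big.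
have ga0 : 0 < g' a by rewrite -(pmulr_rgt0 _ a0).
have l0 : 1 + 2 * theta <= el a by rewrite -[leLHS]expRK ler_ln ?posrE ?expR_gt0.
set l := el a in hx l0 *.
have l00 : 0 < l by lra.
have gpos x : `|x - a| <= K * l / g' a -> 0 < g' x.
  by move=> /hx[].
have g'b x : `|x - a| <= K * l / g' a -> `|g' x - g' a| <= 2 * (theta / l) * g' a.
  move=> xa; have [_ _ _ h] := hx x xa; have gx := gpos x xa.
  have -> : g' x - g' a = (expR (ln (g' x / g' a)) - 1) * g' a.
    by rewrite lnK ?posrE ?divr_gt0//; field; rewrite gt_eqF.
  rewrite normrM (gtr0_norm ga0) ler_pM2r//.
  apply: le_trans (expR_dist_le _) _; last by rewrite ler_pM2l.
  by apply: (le_trans h); rewrite ler_pdivrMr//; lra.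
split=> // x xa; split; first by have [] := hx x xa.
have [c ca ->] : exists2 c, `|c - a| <= `|x - a| & g x - g a = g' c * (x - a).
  have [xa0|xa0] := leP a x.
    have [|c /andP[c1 c2] e] := @MVT_derivable g a x xa0.
      move=> y /andP[y1 y2]; have [] := hx y => //.
      by apply: le_trans xa; rewrite !ger0_norm; lra.
    by exists c => //; rewrite !ger0_norm; lra.
  have [|c /andP[c1 c2] e] := @MVT_derivable g x a (ltW xa0).
    move=> y /andP[y1 y2]; have [] := hx y => //.
    by apply: le_trans xa; rewrite !ler0_norm; lra.
  exists c; first by rewrite !ler0_norm; lra.
  by rewrite -opprB e -mulrN opprB.
have -> : g' c * (x - a) - (x - a) * g' a = (g' c - g' a) * (x - a) by ring.
rewrite normrM; apply: (@le_trans _ _ (2 * (theta / l) * g' a * (K * l / g' a))).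
  by rewrite ler_pM// g'b//; exact: le_trans xa.
have -> : 2 * (theta / l) * g' a * (K * l / g' a) = 2 * K * theta.
  by field; rewrite !gt_eqF.
by rewrite /theta mulrC divfK// gt_eqF// mulr_gt0.
Unshelve. all: by end_near. Qed.

End slow_variation.

(** * Tail of the rescaled radius *)

Section normalizing_sequences.
Context (R : realType) (g T : R -> R) (a b : nat -> R).
Hypothesis g_tail : exists2 e : R -> R, e x @[x --> +oo] --> 0 &
  \forall x \near +oo, T x = expR (- g x + e x).
Hypothesis g_derivable : \forall x \near +oo,
  derivable g x 1 /\ derivable (derive1 g) x 1.
Hypothesis g_cond1 : x * derive1 g x @[x --> +oo] --> +oo.
Hypothesis g_cond2 :
  derive1n 2 g x / derive1 g x ^+ 2 * ln (x * derive1 g x) ^+ 2 @[x --> +oo] --> 0.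
Hypothesis a_cvg : a n @[n --> \oo] --> +oo.
Hypothesis g_a : g (a n) - ln n%:R @[n --> \oo] --> 0.
Hypothesis b_a : exists2 e : nat -> R,
  e =o_\oo (fun n => (ln (a n * derive1 g (a n)))^-1) &
  \forall n \near \oo, b n = (1 + e n) / derive1 g (a n).

Local Notation g' := (derive1 g).
Local Notation el n := (ln (a n * g' (a n))).
Local Notation ell n := (ln (a n / b n)).

Lemma near_seq (Q : R -> Prop) :
  (\forall x \near +oo, Q x) -> \forall n \near \oo, Q (a n).
Proof. by move=> h; exact: a_cvg. Qed.

(** [ln (a g' a)] tends to infinity, so the relative error of [b] is both small
    and small compared with the inverse of this logarithm. *)
Lemma normalizing_constants (eps B : R) : 0 < eps -> \forall n \near \oo,
  [/\ 0 < a n, 0 < g' (a n), B <= el n, 0 < b n &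
    exists2 e : R, b n = (1 + e) / g' (a n) & `|e| * el n <= eps].
Proof.
move=> eps0; have [e /eqoP eo be] := b_a.
have e1 := eo _ eps0.
have e2 : \forall n \near \oo, `|e n| <= 2^-1 * `|(el n)^-1|.
  by apply: eo; rewrite invr_gt0.
have x1 : \forall x \near +oo, expR (`|B| + 1) <= x * g' x.
  by move/cvgryPge : g_cond1; exact.
near=> n.
have a0 : 0 < a n.
  by near: n; apply: (near_seq (Q := fun x => 0 < x)); apply: nbhs_pinfty_gt; exact: num_real.
have h : expR (`|B| + 1) <= a n * g' (a n) by near: n; exact: (near_seq x1).
have ag0 : 0 < a n * g' (a n) := lt_le_trans (expR_gt0 _) h.
have ga0 : 0 < g' (a n) by rewrite -(pmulr_rgt0 _ a0).
have l0 : `|B| + 1 <= el n by rewrite -[leLHS]expRK ler_ln ?posrE ?expR_gt0.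
have B0 := normr_ge0 B; have BB := ler_norm B.
have l00 : 0 < el n by lra.
have h1 : `|e n| <= eps * `|(el n)^-1| by near: n.
have h2 : `|e n| <= 2^-1 * `|(el n)^-1| by near: n.
have hb : b n = (1 + e n) / g' (a n) by near: n.
rewrite (gtr0_norm (_ : 0 < (el n)^-1)) ?invr_gt0// in h1 h2.
have ee : `|e n| <= 2^-1.
  by apply: (le_trans h2); rewrite ler_piMr// ?invf_le1//; lra.
split => //; first lra.
  rewrite hb divr_gt0//; move: ee; rewrite ler_norml => /andP[? ?]; lra.
by exists (e n) => //; rewrite -ler_pdivlMr.
Unshelve. all: by end_near. Qed.

(** [ln (a / b)] and [ln (a g' a)] differ by the logarithm of the relative
    error of [b], so either may serve as the scale. *)
Lemma ratio_bounds (B : R) : \forall n \near \oo,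
  [/\ 0 < a n, 0 < b n, B <= ell n & `|ell n - el n| <= 1].
Proof.
have e0 : (0 : R) < 4^-1 by rewrite invr_gt0.
near=> n.
have [a0 ga0 l0 b0 [e be ee]] : [/\ 0 < a n, 0 < g' (a n), `|B| + 1 <= el n, 0 < b n &
    exists2 e : R, b n = (1 + e) / g' (a n) & `|e| * el n <= 4^-1].
  by near: n; exact: normalizing_constants.
have B0 := normr_ge0 B; have BB := ler_norm B.
have e4 : `|e| <= 4^-1 by have := normr_ge0 e; nra.
move: e4; rewrite ler_norml => /andP[e1 e2].
have h : ell n = el n - ln (1 + e).
  rewrite -ln_div ?posrE ?mulr_gt0//; last lra.
  by congr ln; rewrite be; field; rewrite !gt_eqF//; lra.
have h2 : `|ln (1 + e)| <= 1.
  rewrite ler_norml; apply/andP; split.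
    rewrite -[leLHS]expRK ler_ln ?posrE ?expR_gt0//; last lra.
    have := @expR_ge1Dx R 1; have := expRxMexpNx_1 (1 : R).
    by have := @expR_gt0 R 1; have := @expR_gt0 R (-1); nra.
  rewrite -[leRHS]expRK ler_ln ?posrE ?expR_gt0//; last lra.
  by have := @expR_ge1Dx R 1; lra.
rewrite h; split => //.
  by move: h2; rewrite ler_norml => /andP[? ?]; lra.
by rewrite addrC addKr normrN.
Unshelve. all: by end_near. Qed.

Lemma ratio_cvg : ell n @[n --> \oo] --> +oo.
Proof.
apply/cvgryPge => B; near=> n.
by have [] : [/\ 0 < a n, 0 < b n, B <= ell n & `|ell n - el n| <= 1]
  by near: n; exact: ratio_bounds.
Unshelve. all: by end_near. Qed.

(** [n T (a + b t)] is the exponential of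
    [ln n - g a - (g x - g a) + o(1)] with [x = a + b t], and
    [g x - g a = (x - a) g' a + o(1) = t + o(1)] by [local_linear]: the relative
    error of [b] is multiplied by [t], which is of order [ln (a g' a)]. *)
Lemma tail_uniform (K del : R) : 0 < K -> 0 < del -> \forall n \near \oo,
  forall t : R, `|t| <= K * ell n ->
    (1 - del) * expR (- t) <= n%:R * T (a n + b n * t) <= (1 + del) * expR (- t).
Proof.
move=> K0 del0; pose eps := Num.min (1 / 8) (del / 8).
have eps0 : 0 < eps by rewrite lt_min !divr_gt0.
have [e ex Te] := g_tail.
have eK0 : 0 < eps / (2 * K) by rewrite divr_gt0// mulr_gt0.
have tailx : \forall x \near +oo, T x = expR (- g x + e x) /\ `|e x| <= eps.
  near=> x; split; first by near: x.
  rewrite -normrN -sub0r; near: x.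
  by move/cvgrPdist_le : ex; exact.
have [x0 [x0R hx0]] := tailx.
have K4 : 0 < 4 * K by rewrite mulr_gt0.
have lin0 := local_linear g_derivable g_cond1 g_cond2 K4 eps0.
near=> n.
have [a0 ga0 l0 b0 [r be re]] : [/\ 0 < a n, 0 < g' (a n), 2 + eps / (2 * K) <= el n, 0 < b n &
    exists2 e : R, b n = (1 + e) / g' (a n) & `|e| * el n <= eps / (2 * K)].
  by near: n; exact: normalizing_constants.
have [_ _ l1 ll] : [/\ 0 < a n, 0 < b n, 2 <= ell n & `|ell n - el n| <= 1].
  by near: n; exact: ratio_bounds.
have [_ lin] : 0 < g' (a n) /\ forall x, `|x - a n| <= 4 * K * el n / g' (a n) ->
    a n / 2 <= x /\ `|g x - g (a n) - (x - a n) * g' (a n)| <= eps.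
  by near: n; exact: (near_seq lin0).
have ga : `|g (a n) - ln n%:R| <= eps.
  rewrite -normrN -sub0r; near: n.
  by move/cvgrPdist_le : g_a; exact.
have ax0 : x0 < a n / 2.
  rewrite ltr_pdivlMr//; near: n; apply: (near_seq (Q := fun x => x0 * 2 < x)).
  by apply: nbhs_pinfty_gt; exact: num_real.
have n0 : 0 < n%:R :> R by rewrite ltr0n; near: n; exact: nbhs_infty_gt.
move=> t tl.
have r1 : `|r| <= 1.
  rewrite -(@ler_pM2r _ (el n)); last lra.
  by apply: (le_trans re); lra.
have lt : K * ell n <= 2 * K * el n.
  by move: ll; rewrite ler_norml => /andP[_ ?]; nra.
have xa : `|a n + b n * t - a n| <= 4 * K * el n / g' (a n).
  rewrite addrC addKr be normrM (gtr0_norm (_ : 0 < (1 + r) / g' (a n))) -?be//.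
  rewrite be mulrAC ler_pM2r ?invr_gt0//.
  have := normr_ge0 t; move: r1; rewrite ler_norml => /andP[? ?]; nra.
have [xa2 gx] := lin _ xa.
have [Tx ee] := hx0 _ (lt_le_trans ax0 xa2).
set x := a n + b n * t in xa xa2 gx Tx ee *.
have xe : (x - a n) * g' (a n) = t + t * r.
  by rewrite /x be; field; rewrite gt_eqF.
have tr : `|t * r| <= eps.
  rewrite normrM; apply: (@le_trans _ _ (2 * K * el n * `|r|)).
    by rewrite ler_wpM2r//; exact: le_trans tl lt.
  have -> : eps = 2 * K * (eps / (2 * K)) by field; rewrite gt_eqF.
  by rewrite -mulrA ler_pM2l ?mulr_gt0// mulrC.
pose s := ln n%:R - g x + e x + t.
have s4 : `|s| <= 4 * eps.
  rewrite xe in gx; rewrite !ler_norml in gx tr ee ga *.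
  move: gx tr ee ga => /andP[? ?] /andP[? ?] /andP[? ?] /andP[? ?].
  by rewrite /s; apply/andP; split; lra.
have -> : n%:R * T x = expR s * expR (- t).
  rewrite Tx -expRD -{1}(@lnK R n%:R) ?posrE// -expRD; congr expR.
  by rewrite /s; ring.
have eps8 : eps <= 1 / 8 by rewrite ge_min lexx.
have epsd : eps <= del / 8 by rewrite ge_min lexx orbT.
have s2 : `|s| <= 2^-1 by apply: (le_trans s4); lra.
have := expR_dist_le s2; rewrite ler_norml => /andP[h1 h2].
by rewrite !ler_pM2r ?expR_gt0//; apply/andP; split; lra.
Unshelve. all: by end_near. Qed.

End normalizing_sequences.

(** * Exponential moments from tail probabilities *)

Section boolean_events.
Context d (E : measurableType d) (R : realType) (mu : probability E R).

Lemma measurable_natr_bool (h : E -> bool) : measurable_fun setT h ->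
  measurable_fun setT (fun y => (h y)%:R : R).
Proof.
move=> mh; apply: (@measurableT_comp _ _ _ _ _ _ (fun b : bool => b%:R : R)) => //.
Qed.

Lemma bounded_natr_bool (h : E -> bool) : measurable_fun setT h ->
  bounded_measurable (fun y => (h y)%:R : R).
Proof.
move=> mh; split; first exact: measurable_natr_bool.
by exists 1 => y; case: (h y); rewrite ?normr1 ?normr0.
Qed.

Lemma measurable_bool_set (h : E -> bool) : measurable_fun setT h ->
  measurable [set y | h y].
Proof.
move=> mh; rewrite -[X in measurable X]setTI.
by rewrite (_ : [set y | h y] = h @^-1` [set true])//; exact: mh.
Qed.

Lemma Rintegral_natr_bool (h : E -> bool) : measurable_fun setT h ->
  \int[mu]_y (h y)%:R = fine (mu [set y | h y]).
Proof.
move=> mh; have mS := measurable_bool_set mh.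
rewrite /Rintegral -[in RHS](setIT [set y | h y]) -integral_indic//.
congr fine; apply: eq_integral => y _; rewrite indicE.
by case: (boolP (h y)) => hy; [rewrite mem_set|rewrite memNset//=; exact/negP].
Qed.

End boolean_events.

Section layer_cake.
Context d (E : measurableType d) (R : realType) (mu : probability E R).
Variable (t : E -> R).
Hypothesis mt : measurable_fun setT t.

Lemma measurable_gt_bool (s : R) : measurable_fun setT (fun y => s < t y).
Proof. by apply: measurable_fun_ltr => //; exact: measurable_cst. Qed.

Lemma measurable_le_bool (s : R) : measurable_fun setT (fun y => t y <= s).
Proof. by apply: measurable_fun_ler => //; exact: measurable_cst. Qed.

Lemma measurable_slab (c A : R) : measurable_fun setT (fun y => c < t y <= A).
Proof.
by apply: measurable_and; [exact: measurable_gt_bool|exact: measurable_le_bool].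
Qed.

(** Writing [exp t] as the sum of its increments over a grid of step [eta]
    turns the integral of [exp t] into a finite combination of tail
    probabilities, a Riemann sum for the layer-cake formula. *)
Lemma exp_grid_upper (c eta u : R) N : 0 <= eta -> u <= c + N.+1%:R * eta ->
  expR u * (c < u)%R%:R <= expR (c + eta) * (c < u)%R%:R +
    \sum_(k < N) (expR (c + k.+2%:R * eta) - expR (c + k.+1%:R * eta)) *
      (c + k.+1%:R * eta < u)%R%:R.
Proof.
move=> eta0; elim: N => [|N IHN] uN.
  rewrite big_ord0 addr0 ler_wpM2r// ler_expR; by rewrite mul1r in uN.
have inc k : 0 <= expR (c + k.+2%:R * eta) - expR (c + k.+1%:R * eta).
  by rewrite subr_ge0 ler_expR lerD2l ler_wpM2r// ler_nat.
rewrite big_ord_recr/= addrA.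
have [uN1|uN1] := leP u (c + N.+1%:R * eta).
  by apply: (le_trans (IHN uN1)); rewrite lerDl mulr_ge0.
have all1 k : (k <= N.+1)%N -> c + k%:R * eta < u.
  by move=> kN; apply: le_lt_trans uN1; rewrite lerD2l ler_wpM2r// ler_nat.
have cu : c < u by have := all1 0%N isT; rewrite mul0r addr0.
have -> : \sum_(k < N) (expR (c + k.+2%:R * eta) - expR (c + k.+1%:R * eta)) *
      (c + k.+1%:R * eta < u)%R%:R =
    \sum_(0 <= k < N) (expR (c + k.+2%:R * eta) - expR (c + k.+1%:R * eta)).
  rewrite big_mkord; apply: eq_bigr => k _.
  by rewrite all1 ?mulr1//; exact: leqW (ltn_ord k).
rewrite (telescope_sumr (fun k => expR (c + k.+1%:R * eta)))//.
rewrite cu ?all1// !mulr1 mul1r.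
have : expR u <= expR (c + N.+2%:R * eta) by rewrite ler_expR.
by lra.
Qed.

Lemma exp_grid_lower (c eta u : R) N : 0 <= eta ->
  \sum_(k < N) (expR (c + k%:R * eta) - expR (c + k%:R * eta - eta)) *
    (c + k%:R * eta < u)%R%:R <= expR u * (c < u)%R%:R.
Proof.
move=> eta0; elim: N => [|N IHN]; first by rewrite big_ord0 mulr_ge0 ?expR_ge0.
rewrite big_ord_recr/=.
have [uN|uN] := leP u (c + N%:R * eta); first by rewrite mulr0 addr0.
have all1 k : (k <= N)%N -> c + k%:R * eta < u.
  by move=> kN; apply: le_lt_trans uN; rewrite lerD2l ler_wpM2r// ler_nat.
have cu : c < u by have := all1 0%N isT; rewrite mul0r addr0.
have -> : \sum_(k < N) (expR (c + k%:R * eta) - expR (c + k%:R * eta - eta)) *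
      (c + k%:R * eta < u)%R%:R =
    \sum_(0 <= k < N) (expR (c + k.+1%:R * eta - eta) - expR (c + k%:R * eta - eta)).
  rewrite big_mkord; apply: eq_bigr => k _.
  rewrite all1 ?mulr1; last exact: ltnW (ltn_ord k).
  by rewrite -natr1; congr (expR _ - _); ring.
rewrite (telescope_sumr (fun k => expR (c + k%:R * eta - eta)))//.
rewrite cu !mulr1; have := expR_gt0 (c + 0%:R * eta - eta).
have : expR (c + N%:R * eta) <= expR u by rewrite ler_expR ltW.
by lra.
Qed.

Variables (n del A c : R).
Hypotheses (n0 : 0 <= n) (del0 : 0 <= del) (del1 : del <= 1) (cA : c <= A).
Local Notation G s := (n * fine (mu [set y | s < t y])).
Hypothesis G_tail : forall s, c <= s -> s <= A ->
  (1 - del) * expR (- s) <= G s <= (1 + del) * expR (- s).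

(** When the tail [n mu (t > s)] is close to [exp (- s)] between [c] and [A],
    the values of [t] in a sample of size [n] have intensity about
    [exp (- t) dt] there, so that this integral is about [A - c]. *)
Definition layer : R := n * \int[mu]_y (expR (t y) * (c < t y <= A)%R%:R).

Lemma bounded_layer : bounded_measurable
  (fun y => expR (t y) * (c < t y <= A)%R%:R).
Proof.
split.
  apply: measurable_funM; first exact: (measurableT_comp (@measurable_expR R)).
  by apply: measurable_natr_bool; exact: measurable_slab.
exists (expR A) => y; rewrite ger0_norm ?mulr_ge0 ?expR_ge0//.
case: (boolP (c < t y <= A)) => [/andP[_ h]|_]; rewrite ?mulr1 ?mulr0 ?expR_ge0//.
by rewrite ler_expR.
Qed.

Let bounded_gt s : bounded_measurable (fun y => (s < t y)%R%:R : R).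
Proof. by apply: bounded_natr_bool; exact: measurable_gt_bool. Qed.

Let Rintegral_gt s : \int[mu]_y (s < t y)%R%:R = fine (mu [set y | s < t y]).
Proof. by apply: Rintegral_natr_bool; exact: measurable_gt_bool. Qed.

(** Each of the steps of the grid contributes about [eta]; the number [N] of
    steps is chosen so large that [eta ^ 2] sums to at most 1/2. *)
Lemma layer_le : layer <= (1 + del) * (A - c + 4).
Proof.
have d0 := del0; have d1 := del1; have cA' := cA.
pose N := Num.truncn (2 * (A - c) ^+ 2 + 2 * (A - c)).
pose eta := (A - c) / N.+1%:R.
have N0 : 0 < N.+1%:R :> R by [].
have Ac : 0 <= A - c by rewrite subr_ge0.
have eta0 : 0 <= eta by rewrite divr_ge0.
have etaN : N.+1%:R * eta = A - c by rewrite mulrC divfK// gt_eqF.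
have Ac2 := sqr_ge0 (A - c).
have /truncn_itv/andP[_ NA] : 0 <= 2 * (A - c) ^+ 2 + 2 * (A - c) by lra.
rewrite -/N in NA.
have eta1 : eta <= 2^-1 by rewrite ler_pdivrMr//; lra.
have NA2 : eta * (A - c) <= 2^-1.
  by rewrite mulrAC ler_pdivrMr// -expr2; lra.
pose w k := expR (c + k.+2%:R * eta) - expR (c + k.+1%:R * eta).
have w0 k : 0 <= w k by rewrite subr_ge0 ler_expR lerD2l ler_wpM2r// ler_nat.
have bsum : bounded_measurable (fun y => \sum_(k < N) w k * (c + k.+1%:R * eta < t y)%R%:R).
  apply: bounded_measurable_sum => k.
  by apply: bounded_measurableM => //; exact: bounded_measurable_cst.
have bfst : bounded_measurable (fun y => expR (c + eta) * (c < t y)%R%:R).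
  by apply: bounded_measurableM => //; exact: bounded_measurable_cst.
have h : layer <= n * \int[mu]_y (expR (c + eta) * (c < t y)%R%:R +
    \sum_(k < N) w k * (c + k.+1%:R * eta < t y)%R%:R).
  rewrite ler_wpM2l//; apply: le_Rintegral => //.
  - exact/bounded_measurable_integrable/bounded_layer.
  - by apply/bounded_measurable_integrable/bounded_measurableD.
  move=> y _; have [tA|tA] := leP (t y) A; last first.
    rewrite andbF mulr0 addr_ge0 ?mulr_ge0 ?expR_ge0//.
    by apply: sumr_ge0 => k _; rewrite mulr_ge0.
  by rewrite andbT; apply: exp_grid_upper => //; rewrite etaN; lra.
apply: (le_trans h).
rewrite RintegralD//; [|exact: bounded_measurable_integrable|exact: bounded_measurable_integrable].
rewrite RintegralZl//; last exact/bounded_measurable_integrable.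
rewrite Rintegral_sum; last first.
  by move=> k; apply: bounded_measurableM => //; exact: bounded_measurable_cst.
under eq_bigr => k _.
  rewrite RintegralZl//; last exact/bounded_measurable_integrable.
  rewrite Rintegral_gt; over.
rewrite Rintegral_gt mulrDr mulr_sumr.
have e3 : expR eta <= 1 + eta + 2 * eta ^+ 2.
  have h1 : expR eta * (1 - eta) <= 1.
    by rewrite -[leRHS](expRxMexpNx_1 eta) ler_pM2l ?expR_gt0// expR_ge1Dx.
  rewrite -(@ler_pM2r _ (1 - eta)); last lra.
  apply: (le_trans h1); have := exprn_ge0 3 eta0; have := sqr_ge0 eta.
  by rewrite !exprS expr0; nra.
have p1 : n * (expR (c + eta) * fine (mu [set y | c < t y])) <= (1 + del) * 3.
  rewrite mulrCA; have /andP[_ h1] := G_tail (lexx c) cA.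
  apply: (@le_trans _ _ (expR (c + eta) * ((1 + del) * expR (- c)))).
    by rewrite ler_wpM2l// expR_ge0.
  rewrite mulrCA -expRD addrAC subrr add0r ler_wpM2l//; first lra.
  by nra.
have p2 : \sum_(k < N) n * (w k * fine (mu [set y | c + k.+1%:R * eta < t y])) <=
    (1 + del) * (A - c + 1).
  apply: (@le_trans _ _ (\sum_(k < N) (1 + del) * (eta + 2 * eta ^+ 2))).
    apply: ler_sum => k _; rewrite mulrCA.
    have kN : c + k.+1%:R * eta <= A.
      have : k.+1%:R * eta <= N.+1%:R * eta.
        by rewrite ler_wpM2r// ler_nat; exact: leqW (ltn_ord k).
      by rewrite etaN; lra.
    have ck : c <= c + k.+1%:R * eta by rewrite lerDl mulr_ge0.
    have /andP[_ h1] := G_tail ck kN.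
    apply: (le_trans (ler_wpM2l (w0 k) h1)).
    rewrite mulrCA ler_wpM2l//; first lra.
    rewrite /w mulrBl -!expRD subrr expR0.
    rewrite (_ : c + k.+2%:R * eta - (c + k.+1%:R * eta) = eta); last first.
      by rewrite -natr1; ring.
    by lra.
  rewrite sumr_const card_ord -[_ *+ N]mulr_natl mulrCA ler_wpM2l//; first lra.
  have NN : N%:R <= N.+1%:R :> R by rewrite ler_nat.
  apply: (@le_trans _ _ (N.+1%:R * (eta + 2 * eta ^+ 2))).
    by rewrite ler_wpM2r//; have := sqr_ge0 eta; lra.
  have -> : N.+1%:R * (eta + 2 * eta ^+ 2) = N.+1%:R * eta * (1 + 2 * eta) by ring.
  by rewrite etaN; lra.
by apply: (le_trans (lerD p1 p2)); lra.
Qed.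

Lemma layer_ge : (1 - del) * (A - c) - 3 <= layer.
Proof.
have d0 := del0; have d1 := del1; have cA' := cA.
pose N := Num.truncn ((A - c) ^+ 2 + (A - c)).
pose eta := (A - c) / N.+1%:R.
have N0 : 0 < N.+1%:R :> R by [].
have Ac : 0 <= A - c by rewrite subr_ge0.
have eta0 : 0 <= eta by rewrite divr_ge0.
have etaN : N.+1%:R * eta = A - c by rewrite mulrC divfK// gt_eqF.
have Ac2 := sqr_ge0 (A - c).
have /truncn_itv/andP[_ NA] : 0 <= (A - c) ^+ 2 + (A - c) by lra.
rewrite -/N in NA.
have NA2 : eta * (A - c) <= 1.
  by rewrite mulrAC ler_pdivrMr// -expr2; lra.
have sA k : (k < N.+1)%N -> c + k%:R * eta <= A.
  move=> kN; have : k%:R * eta <= N.+1%:R * eta.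
    by rewrite ler_wpM2r// ler_nat ltnW.
  by rewrite etaN; lra.
pose w k := expR (c + k%:R * eta) - expR (c + k%:R * eta - eta).
have w0 k : 0 <= w k by rewrite subr_ge0 ler_expR; lra.
have wE k : w k = expR (c + k%:R * eta) * (1 - expR (- eta)).
  by rewrite /w mulrBr mulr1 -expRD.
have bterm k : bounded_measurable (fun y => w k * ((c + k%:R * eta < t y)%R%:R - (A < t y)%R%:R)).
  apply: bounded_measurableM; first exact: bounded_measurable_cst.
  rewrite (_ : (fun _ => _) = (fun y => (c + k%:R * eta < t y)%R%:R + (-1) * (A < t y)%R%:R)).
    apply: bounded_measurableD => //; apply: bounded_measurableM => //.
    exact: bounded_measurable_cst.
  by apply/funext => y; rewrite mulN1r.
have h : n * \int[mu]_y (\sum_(k < N.+1) w k *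
    ((c + k%:R * eta < t y)%R%:R - (A < t y)%R%:R)) <= layer.
  rewrite ler_wpM2l//; apply: le_Rintegral => //.
  - by apply: bounded_measurable_integrable; exact: bounded_measurable_sum.
  - exact/bounded_measurable_integrable/bounded_layer.
  move=> y _; have [tA|tA] := leP (t y) A; last first.
    rewrite andbF mulr0; apply: sumr_le0 => k _.
    by rewrite (le_lt_trans (sA k (ltn_ord k)) tA) subrr mulr0.
  rewrite andbT; under eq_bigr do rewrite subr0.
  exact: exp_grid_lower.
apply: le_trans h; rewrite Rintegral_sum//.
have step k : (k < N.+1)%N -> w k * ((1 - del) * expR (- (c + k%:R * eta))) -
    w k * ((1 + del) * expR (- A)) <=
    n * \int[mu]_y (w k * ((c + k%:R * eta < t y)%R%:R - (A < t y)%R%:R)).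
  move=> kN; rewrite RintegralZl//; last first.
    apply: bounded_measurable_integrable.
    rewrite (_ : (fun _ => _) = (fun y => (c + k%:R * eta < t y)%R%:R + (-1) * (A < t y)%R%:R)).
      apply: bounded_measurableD => //; apply: bounded_measurableM => //.
      exact: bounded_measurable_cst.
    by apply/funext => y; rewrite mulN1r.
  rewrite RintegralB//; [|exact: bounded_measurable_integrable|exact: bounded_measurable_integrable].
  rewrite !Rintegral_gt [leRHS]mulrCA -mulrBr ler_wpM2l// mulrBr lerB//.
    have ck : c <= c + k%:R * eta by rewrite lerDl mulr_ge0.
    by have /andP[] := G_tail ck (sA k kN).
  by have /andP[] := G_tail cA (lexx A).
rewrite mulr_sumr.
apply: (@le_trans _ _ (\sum_(k < N.+1) (w k * ((1 - del) * expR (- (c + k%:R * eta))) -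
    w k * ((1 + del) * expR (- A))))); last by apply: ler_sum => k _; exact: step.
rewrite sumrB -mulr_suml.
have e1 : expR (- eta) <= 1 - eta + eta ^+ 2.
  have h1 : expR (- eta) * (1 + eta) <= 1.
    by rewrite mulrC -[leRHS](expRxMexpNx_1 eta) ler_pM2r ?expR_gt0// expR_ge1Dx.
  rewrite -(@ler_pM2r _ (1 + eta)); last lra.
  by apply: (le_trans h1); have := exprn_ge0 3 eta0; rewrite !exprS expr0; lra.
have s1 : (1 - del) * (A - c - 1) <=
    \sum_(k < N.+1) w k * ((1 - del) * expR (- (c + k%:R * eta))).
  rewrite (eq_bigr (fun=> (1 - del) * (1 - expR (- eta)))); last first.
    move=> k _; rewrite wE mulrCA mulrAC -expRD subrr expR0 mul1r//.
  rewrite sumr_const card_ord -[_ *+ N.+1]mulr_natl mulrCA ler_wpM2l//; first lra.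
  apply: (@le_trans _ _ (N.+1%:R * (eta - eta ^+ 2))); last by rewrite ler_wpM2l//; lra.
  have -> : N.+1%:R * (eta - eta ^+ 2) = N.+1%:R * eta * (1 - eta) by ring.
  by rewrite etaN; lra.
have s2 : (\sum_(k < N.+1) w k) * ((1 + del) * expR (- A)) <= 1 + del.
  have -> : \sum_(k < N.+1) w k = \sum_(0 <= k < N.+1)
      (expR (c + k.+1%:R * eta - eta) - expR (c + k%:R * eta - eta)).
    rewrite big_mkord; apply: eq_bigr => k _.
    by rewrite -natr1; congr (expR _ - _); ring.
  rewrite (telescope_sumr (fun k => expR (c + k%:R * eta - eta)))//.
  rewrite mulrCA ler_piMr//; first lra.
  rewrite mulrBl etaN; have := expR_gt0 (c + 0%:R * eta - eta); have := expR_gt0 (- A).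
  have -> : c + (A - c) - eta = A - eta by ring.
  rewrite -expRD; have : expR (A - eta + - A) <= 1 by rewrite expR_le1; lra.
  by nra.
by lra.
Qed.

End layer_cake.

(** * Edges with a given endpoint *)

Section polar_sets.
Context (R : realType) (m : nat).
Local Notation d := m.+2.
Variable i0 : 'I_d.
Local Notation E := (borel_rV R d).
Variable mu : probability E R.
Hypothesis mu_rot : forall Q : 'M[R]_d, Q *m Q^T = 1%:M ->
  forall A : set E, measurable A -> mu [set x | A ((x : 'rV[R]_d) *m Q)] = mu A.

Local Notation en x := (enorm (x : 'rV[R]_d)).
Local Notation U := (dircos i0).
Local Notation nz := (@nonzero R d).
Local Notation pr S := (fine (mu S)).

Lemma measurable_enormE : measurable_fun setT (fun x : E => en x).
Proof. by apply: measurable_enorm; exact: measurable_id. Qed.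

Variables (f : R -> R) (B : R).
Hypothesis mf : measurable_fun setT f.

Let win (z : R * R) : bool := (0 < z.1) && (f z.2 < z.1 <= B).

Let mwin : measurable_fun setT win.
Proof.
apply: measurable_and.
  by apply: measurable_fun_ltr; [exact: measurable_cst|exact: measurable_fst].
apply: measurable_and.
  apply: measurable_fun_ltr; last exact: measurable_fst.
  exact: (measurableT_comp mf measurable_snd).
by apply: measurable_fun_ler; [exact: measurable_fst|exact: measurable_cst].
Qed.

(** The radii admissible for a point at angle of cosine [c] from a given
    direction, the lower limit [f c] being the least radius that makes the
    point an endpoint of a long edge. *)
Definition window (c : R) : set E := [set x | win (en x, c)].

Lemma measurable_window c : measurable (window c).
Proof.
apply: measurable_bool_set; apply: (measurableT_comp mwin).
apply: measurable_fun_pair; first exact: measurable_enormE.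
exact: measurable_cst.
Qed.

Lemma bounded_window : bounded_measurable (fun y => pr (window (U y))).
Proof.
pose S : set (E * E) := [set z | win (en z.2, U z.1)].
have mS : measurable S.
  apply: measurable_bool_set; apply: (measurableT_comp mwin).
  apply: measurable_fun_pair.
    exact: (measurableT_comp measurable_enormE measurable_snd).
  exact: (measurableT_comp (measurable_dircos i0) measurable_fst).
split.
  apply: (measurableT_comp (fine_measurable measurableT)) => //.
  have := measurable_fun_xsection mu mS.
  rewrite (_ : mu \o xsection S = fun y => mu (window (U y)))//.
  apply/funext => y /=; congr (mu _); apply/seteqP; split => x;
    by rewrite /window/= -?mem_xsection ?inE// /xsection/= ?inE//.
exists 1 => y; rewrite ger0_norm ?fine_ge0// -lee_fin fineK ?fin_num_measure//.
  by apply: probability_le1; exact: measurable_window.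
exact: measurable_window.
Qed.

Let measurable_polar_bool (v : 'rV[R]_d) :
  measurable_fun setT (fun x : E => win (en x, dot (x : 'rV[R]_d) v / en x)).
Proof.
  apply: (measurableT_comp mwin); apply: measurable_fun_pair.
    exact: measurable_enormE.
  apply: measurable_funM.
    by apply: measurable_dot; [exact: measurable_id|exact: measurable_cst].
  rewrite (_ : (fun _ => _) = (fun y : E => en y `^ -1)); last first.
    by apply/funext => y; rewrite powR_inv1// enorm_ge0.
  exact: (measurableT_comp (@measurable_powR R (-1)) measurable_enormE).
Qed.

Lemma measurable_polar_window (v : 'rV[R]_d) :
  measurable [set x : E | win (en x, dot (x : 'rV[R]_d) v / en x)].
Proof. exact: measurable_bool_set. Qed.

(** The independence of radius and direction, in the form in which it
    evaluates the probability of an edge with a given endpoint. *)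
Lemma polar_window (v : 'rV[R]_d) : dot v v = 1 ->
  pr [set x : E | win (en x, dot (x : 'rV[R]_d) v / en x)] * moment i0 mu 0 =
  \int[mu]_y (pr (window (U y)) * nz y).
Proof.
move=> vv; pose g (z : R * R) : \bar R := ((win z)%:R)%:E.
have mg : measurable_fun setT g.
  by apply/measurable_EFinP; apply: measurable_natr_bool.
have g0 z : (0 <= g z)%E by rewrite lee_fin.
have gz c : g (0, c) = 0%E by rewrite /g /win/= ltxx.
have := polar_independence i0 mu_rot mg g0 gz vv => /(congr1 fine).
have mpol := measurable_polar_bool v.
have e1 : (\int[mu]_x g (en x, dot (x : 'rV[R]_d) v / en x)%R =
    (pr [set x : E | win (en x, dot (x : 'rV[R]_d) v / en x)])%:E)%E.
  rewrite -Rintegral_natr_bool// /Rintegral fineK//.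
  apply: integrable_fin_num => //; apply: bounded_measurable_integrable.
  exact: bounded_natr_bool.
have e2 : (\int[mu]_y (nz y)%:E = (moment i0 mu 0)%:E)%E.
  rewrite /moment; under [in RHS]eq_Rintegral do rewrite expr0 mul1r.
  rewrite /Rintegral fineK//; apply: integrable_fin_num => //.
  by apply: bounded_measurable_integrable; exact: bounded_nonzero.
rewrite e1 e2 -EFinM /= => ->.
rewrite /Rintegral; congr fine; apply: eq_integral => y _.
rewrite EFinM; congr (_ * _)%E.
have mw : measurable_fun setT (fun x : E => win (en x, U y)).
  apply: (measurableT_comp mwin); apply: measurable_fun_pair.
    exact: measurable_enormE.
  exact: measurable_cst.
rewrite -Rintegral_natr_bool// /Rintegral fineK//.
apply: integrable_fin_num => //; apply: bounded_measurable_integrable.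
exact: bounded_natr_bool.
Qed.

End polar_sets.

Section annulus_geometry.
Context (R : realType) (a k del r rho u c : R).
Hypotheses (a0 : 0 < a) (k0 : 0 <= k) (kdel : k = del / 8) (del1 : del <= 1).
Hypotheses (r_ge : a * (1 - k) <= r) (r_le : r <= a * (1 + k)).
Hypotheses (rho_ge : a * (1 - k) <= rho) (rho_le : rho <= a * (1 + k)).
Hypotheses (u_ge : 2 * a * (1 - k) <= u) (u_le : u <= 2 * a * (1 + k)).
Hypotheses (c_ge : -1 <= c) (c_le : c <= 1).

(** For [|x| = r], [|y| = rho] and [c = - cos (x, y)], the hypothesis reads
    [u < |x - y|]. It is equivalent to
    [2 r rho (1 - c) < (r + rho - u) (r + rho + u)]; as [r] and [rho] are close
    to [a], and [u] to [2 a], this is nearly [a / 2 * (1 - c) < r + rho - u]. *)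
Lemma annulus_upper : u ^+ 2 < r ^+ 2 + rho ^+ 2 + 2 * (r * rho * c) ->
  a / 2 * (1 - del) * (1 - c) < r + rho - u.
Proof.
have [a0' k0' kd d1] : [/\ 0 < a, 0 <= k, k = del / 8 & del <= 1] by [].
have [r1 r2 rho1 rho2] : [/\ a * (1 - k) <= r, r <= a * (1 + k),
  a * (1 - k) <= rho & rho <= a * (1 + k)] by [].
have [u1 u2 c1 c2] : [/\ 2 * a * (1 - k) <= u, u <= 2 * a * (1 + k), -1 <= c & c <= 1] by [].
move=> h; pose q := 1 - c; have q0 : 0 <= q by rewrite /q; lra.
have k1 : k <= 1 / 8 by lra.
have ak0 : 0 <= a * (1 - k) by rewrite mulr_ge0//; lra.
have h1 : 2 * (r * rho) * q < (r + rho - u) * (r + rho + u) by rewrite /q; nra.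
have h2 : (a * (1 - k)) * (a * (1 - k)) <= r * rho by rewrite ler_pM.
have h3 : 2 * ((a * (1 - k)) * (a * (1 - k))) * q <= 2 * (r * rho) * q.
  by rewrite ler_wpM2r// ler_pM2l.
have S0 : 0 < r + rho + u by nra.
have rr0 : 0 <= 2 * (r * rho) * q by rewrite !mulr_ge0//; nra.
have P0 : 0 < r + rho - u by rewrite -(pmulr_lgt0 _ S0); lra.
have h4 : (r + rho - u) * (r + rho + u) <= (r + rho - u) * (4 * a * (1 + k)).
  by rewrite ler_pM2l//; nra.
have h5 : a * (a * ((1 - k) ^+ 2 * q)) < a * (2 * (r + rho - u) * (1 + k)) by nra.
rewrite ltr_pM2l// in h5.
have h6 : (1 - del) * (1 + k) <= (1 - k) ^+ 2 by rewrite kd; nra.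
have h7 : a * ((1 - del) * (1 + k) * q) <= a * ((1 - k) ^+ 2 * q).
  by rewrite ler_pM2l// ler_wpM2r.
rewrite -/q -(@ltr_pM2r _ (1 + k)); last lra.
nra.
Qed.

Lemma annulus_lower : a / 2 * (1 + del) * (1 - c) < r + rho - u ->
  u ^+ 2 < r ^+ 2 + rho ^+ 2 + 2 * (r * rho * c).
Proof.
have [a0' k0' kd d1] : [/\ 0 < a, 0 <= k, k = del / 8 & del <= 1] by [].
have [r1 r2 rho1 rho2] : [/\ a * (1 - k) <= r, r <= a * (1 + k),
  a * (1 - k) <= rho & rho <= a * (1 + k)] by [].
have [u1 u2 c1 c2] : [/\ 2 * a * (1 - k) <= u, u <= 2 * a * (1 + k), -1 <= c & c <= 1] by [].
move=> h; pose q := 1 - c; have q0 : 0 <= q by rewrite /q; lra.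
have k1 : k <= 1 / 8 by lra.
have ak0 : 0 <= a * (1 - k) by rewrite mulr_ge0//; lra.
have [r0 rho0] : 0 <= r /\ 0 <= rho by split; lra.
have h2 : r * rho <= (a * (1 + k)) * (a * (1 + k)) by rewrite ler_pM.
have h3 : 2 * (r * rho) * q <= 2 * ((a * (1 + k)) * (a * (1 + k))) * q.
  by rewrite ler_wpM2r// ler_pM2l.
have h6 : (1 + k) ^+ 2 <= (1 + del) * (1 - k) by rewrite kd; nra.
have h7 : a * ((1 + k) ^+ 2 * q) <= a * ((1 + del) * (1 - k) * q).
  by rewrite ler_pM2l// ler_wpM2r.
have P0 : 0 <= r + rho - u.
  by apply: le_trans (ltW h); rewrite -/q !mulr_ge0//; lra.
have h4 : (r + rho - u) * (4 * a * (1 - k)) <= (r + rho - u) * (r + rho + u).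
  by rewrite ler_wpM2l//; nra.
rewrite -/q in h.
have h8 : 2 * ((a * (1 + k)) * (a * (1 + k))) * q <= a / 2 * (1 + del) * q * (4 * a * (1 - k)).
  have -> : 2 * ((a * (1 + k)) * (a * (1 + k))) * q = 2 * a * (a * ((1 + k) ^+ 2 * q)) by ring.
  have -> : a / 2 * (1 + del) * q * (4 * a * (1 - k)) =
    2 * a * (a * ((1 + del) * (1 - k) * q)) by field.
  by rewrite ler_pM2l// mulr_gt0.
have h9 : a / 2 * (1 + del) * q * (4 * a * (1 - k)) < (r + rho - u) * (4 * a * (1 - k)).
  by rewrite ltr_pM2r// mulr_gt0 ?mulr_gt0//; lra.
have : 2 * (r * rho) * q < (r + rho - u) * (r + rho + u) by lra.
rewrite /q; nra.
Qed.

End annulus_geometry.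

Section truncated_edges.
Context (R : realType) (m : nat).
Local Notation d := m.+2.
Variable i0 : 'I_d.
Local Notation E := (borel_rV R d).
Variable mu : probability E R.
Hypothesis mu_rot : forall Q : 'M[R]_d, Q *m Q^T = 1%:M ->
  forall A : set E, measurable A -> mu [set x | A ((x : 'rV[R]_d) *m Q)] = mu A.

Local Notation en x := (enorm (x : 'rV[R]_d)).
Local Notation U := (dircos i0).
Local Notation nz := (@nonzero R d).
Local Notation pr S := (fine (mu S)).
Local Notation pi0 := (moment i0 mu 0).

(** A pair at distance more than [u] inside the ball of radius [B]. The
    truncation of the radii bounds the mean number of edges at a point; without
    it, second moments would be dominated by rare points far away. *)
Definition edge (B u : R) (x y : E) : bool :=
  [&& en x <= B, en y <= B & u < enorm ((x : 'rV[R]_d) - (y : 'rV[R]_d))].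

Lemma edgeC B u x y : edge B u x y = edge B u y x.
Proof. by rewrite /edge -(enormN (_ - _)) opprB andbCA. Qed.

Definition section_prob B u (y : E) : R := pr [set x | edge B u x y].

Lemma measurable_edge B u :
  measurable_fun setT (fun z : E * E => edge B u z.1 z.2).
Proof.
have me := @measurable_enormE R m.
apply: measurable_and.
  apply: measurable_fun_ler; last exact: measurable_cst.
  exact: (measurableT_comp me measurable_fst).
apply: measurable_and.
  apply: measurable_fun_ler; last exact: measurable_cst.
  exact: (measurableT_comp me measurable_snd).
apply: measurable_fun_ltr; first exact: measurable_cst.
by apply: measurable_enormB; [exact: measurable_fst|exact: measurable_snd].
Qed.

Lemma measurable_edge_section B u y : measurable [set x | edge B u x y].
Proof.
apply: measurable_bool_set.
exact: (measurableT_comp (measurable_edge B u) (pair2_measurable y)).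
Qed.

Lemma bounded_section_prob B u : bounded_measurable (section_prob B u).
Proof.
pose S : set (E * E) := [set z | edge B u z.2 z.1].
have mS : measurable S.
  apply: measurable_bool_set.
  by under eq_fun do rewrite edgeC; exact: measurable_edge.
split.
  apply: (measurableT_comp (fine_measurable measurableT)) => //.
  have := measurable_fun_xsection mu mS.
  rewrite (_ : mu \o xsection S = fun y => mu [set x | edge B u x y])//.
  apply/funext => y /=; congr (mu _); apply/seteqP; split => x;
    by rewrite /= -?mem_xsection ?inE// /xsection/= ?inE//.
exists 1 => y; have mE := measurable_edge_section B u y.
rewrite ger0_norm ?fine_ge0// -lee_fin fineK ?fin_num_measure//.
exact: probability_le1.
Qed.

Variables (a b A yy w del n : R).
Hypotheses (a0 : 0 < a) (b0 : 0 < b) (del0 : 0 <= del) (del1 : del <= 1)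
  (n0 : 0 <= n) (A0 : 0 <= A) (yy0 : yy <= 0)
  (w_ge : A - yy + 1 <= w) (w_small : b * w <= a * (del / 8)) (pi0_gt0 : 0 < pi0).

Local Notation G s := (n * pr [set x : E | a + b * s < en x]).
Hypothesis G_tail : forall s, - w <= s -> s <= A ->
  (1 - del) * expR (- s) <= G s <= (1 + del) * expR (- s).

Local Notation B := (a + b * A).
Local Notation u := (2 * a + b * yy).
Local Notation phi := (section_prob B u).
Local Notation t y := ((en y - a) / b).
Local Notation lam := (a / (2 * b)).

Let radius_window (s : R) : - w <= s -> s <= A ->
  a * (1 - del / 8) <= a + b * s /\ a + b * s <= a * (1 + del / 8).
Proof.
have [a0' b0' A0'] : [/\ 0 < a, 0 < b & 0 <= A] by [].
have [yy0' w1 w2] : [/\ yy <= 0, A - yy + 1 <= w & b * w <= a * (del / 8)] by [].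
move=> ws sA.
have h1 : b * s <= b * w by rewrite ler_pM2l//; lra.
have h2 : - (b * w) <= b * s by rewrite -mulrN ler_pM2l.
by split; lra.
Qed.

Lemma window_tail_le z : - w <= z ->
  n * pr [set x : E | (0 < en x) && (a + b * z < en x <= B)] <=
  (1 + del) * expR (- z).
Proof.
move=> wz; have [zA|Az] := leP z A; last first.
  rewrite (_ : [set x | _] = set0); last first.
    apply/seteqP; split => x //= /andP[_ /andP[h1 h2]].
    have := lt_le_trans h1 h2; rewrite ltrD2l ltr_pM2l// => h.
    by have := lt_trans h Az; rewrite ltxx.
  by rewrite measure0 mulr0 mulr_ge0 ?expR_ge0// addr_ge0.
have /andP[_ h] := G_tail wz zA.
apply: (le_trans _ h); rewrite ler_wpM2l//.
have mt s : measurable [set x : E | a + b * s < en x].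
  apply: measurable_bool_set; apply: measurable_fun_ltr.
    exact: measurable_cst.
  exact: measurable_enormE.
apply: le_pr => //; last by move=> x /= /andP[_ /andP[]].
exact: (@measurable_window _ _ (fun=> a + b * z) B (measurable_cst _) 0).
Qed.

(** The tail beyond [A] has to be subtracted; writing it as at most
    [2 exp (- (z + A) / 2)] keeps the bound valid for [z] beyond [A], where
    the annulus is empty, and keeps it exponential in [z]. *)
Lemma window_tail_ge z : - w <= z ->
  (1 - del) * expR (- z) - 2 * expR (- ((z + A) / 2)) <=
  n * pr [set x : E | (0 < en x) && (a + b * z < en x <= B)].
Proof.
have [a0' b0' A0'] : [/\ 0 < a, 0 < b & 0 <= A] by [].
have [yy0' w1 w2] : [/\ yy <= 0, A - yy + 1 <= w & b * w <= a * (del / 8)] by [].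
have [d0 d1] : 0 <= del /\ del <= 1 by [].
move=> wz; have e1 := expR_gt0 (- z).
have [zA|Az] := leP z A; last first.
  apply: (@le_trans _ _ 0); last by rewrite mulr_ge0// fine_ge0.
  have : expR (- z) <= expR (- ((z + A) / 2)) by rewrite ler_expR; lra.
  by nra.
have e2 : expR (- A) <= expR (- ((z + A) / 2)) by rewrite ler_expR; lra.
have e3 := expR_gt0 (- A).
have /andP[h1 _] := G_tail wz zA.
have wA : - w <= A by lra.
have /andP[_ h2] := G_tail wA (lexx A).
have mt s : measurable [set x : E | a + b * s < en x].
  apply: measurable_bool_set; apply: measurable_fun_ltr.
    exact: measurable_cst.
  exact: measurable_enormE.
have mW : measurable [set x : E | (0 < en x) && (a + b * z < en x <= B)].
  exact: (@measurable_window _ _ (fun=> a + b * z) B (measurable_cst _) 0).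
have [r1 _] := radius_window wz zA.
have az : 0 < a + b * z by apply: lt_le_trans r1; rewrite mulr_gt0//; lra.
have e : pr [set x : E | a + b * z < en x] =
    pr [set x : E | (0 < en x) && (a + b * z < en x <= B)] +
    pr [set x : E | a + b * A < en x].
  rewrite (prID mu (mt z) (mt A)) addrC; congr (pr _ + pr _).
    apply/seteqP; split => x /=.
      by move=> [h /negP]; rewrite -leNgt => ->; rewrite h (lt_trans az h).
    by move=> /andP[_ /andP[-> h]]; split => //; apply/negP; rewrite -leNgt.
  apply/seteqP; split => x /=; first by case.
  move=> h; split => //; apply: le_lt_trans h.
  by rewrite lerD2l ler_pM2l.
rewrite e mulrDr in h1.
have : (1 + del) * expR (- A) <= 2 * expR (- A) by rewrite ler_pM2r//; lra.
lra.
Qed.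

Lemma enormB_le (x y : 'rV[R]_d) : enorm (x - y) <= enorm x + enorm y.
Proof.
rewrite -(@ler_pXn2r _ 2)// ?nnegrE ?addr_ge0 ?enorm_ge0//.
rewrite sqr_enormB; have := dot_le x y; rewrite ler_norml => /andP[h _].
by rewrite sqrrD; lra.
Qed.

Lemma edge_radius x y : edge B u x y -> yy - A - 1 < t y <= A.
Proof.
move=> /and3P[h1 h2 h3].
rewrite ltr_pdivlMr// ler_pdivrMr//.
have := lt_le_trans h3 (enormB_le _ _).
have b0' : 0 < b by [].
move: h1 h2; set ex := enorm _; set ey := enorm _ => h1 h2 h.
by apply/andP; split; nra.
Qed.

Let cosine_le1 (v : 'rV[R]_d) (x : E) : dot v v = 1 ->
  `|dot (x : 'rV[R]_d) v / en x| <= 1.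
Proof.
move=> vv; have [x0|x0] := eqVneq (en x) 0; first by rewrite x0 invr0 mulr0 normr0.
rewrite normf_div (ger0_norm (enorm_ge0 _)) ler_pdivrMr ?mul1r ?lt0r ?x0 ?enorm_ge0//.
by have := dot_le (x : 'rV[R]_d) v; rewrite (enorm_dot v) vv sqrtr1 mulr1.
Qed.

Let opposite_unit (y : E) : en y != 0 ->
  dot (- (en y)^-1 *: (y : 'rV[R]_d)) (- (en y)^-1 *: (y : 'rV[R]_d)) = 1.
Proof. by move=> y0; rewrite dotZl dotZr -sqr_enorm; field. Qed.

Let edge_dist (x y : E) : en x != 0 -> en y != 0 ->
  enorm ((x : 'rV[R]_d) - (y : 'rV[R]_d)) ^+ 2 = en x ^+ 2 + en y ^+ 2 +
   2 * (en x * en y * (dot (x : 'rV[R]_d) (- (en y)^-1 *: (y : 'rV[R]_d)) / en x)).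
Proof.
by move=> x0 y0; rewrite sqr_enormB dotZr; field; rewrite x0 y0.
Qed.

(** The least radius at cosine [c] that gives an edge with a point at rescaled
    radius [tau], according to the linearized geometry; the
    values [q = 1 - del] and [q = 1 + del] account for the error of linearization. *)
Definition threshold (q tau c : R) : R := a + b * (yy - tau + lam * q * (1 - c)).

Lemma measurable_threshold q tau : measurable_fun setT (threshold q tau).
Proof.
apply: measurable_funD; first exact: measurable_cst.
apply: measurable_funM; first exact: measurable_cst.
apply: measurable_funD; first exact: measurable_cst.
apply: measurable_funM; first exact: measurable_cst.
by apply: measurable_funB; [exact: measurable_cst|exact: measurable_id].
Qed.

Let lam0 : 0 <= lam.
Proof. by apply: divr_ge0; [exact: ltW|apply: mulr_ge0 => //; exact: ltW]. Qed.

Let threshold_window q tau y : 0 <= q -> tau <= A ->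
  - w <= yy - tau + lam * q * (1 - U y).
Proof.
move=> q0 tauA; have w1 := w_ge; have A0' := A0; have l0 := lam0.
have := dircos_le1 i0 y; rewrite ler_norml => /andP[_ u1].
have : 0 <= lam * q * (1 - U y) by apply: mulr_ge0; [exact: mulr_ge0|rewrite subr_ge0].
lra.
Qed.

Let u_window : 2 * a * (1 - del / 8) <= u /\ u <= 2 * a * (1 + del / 8).
Proof.
have [a0' b0' A0'] : [/\ 0 < a, 0 < b & 0 <= A] by [].
have [yy0' w1 w2] : [/\ yy <= 0, A - yy + 1 <= w & b * w <= a * (del / 8)] by [].
have d0 := del0.
have h1 : b * - w <= b * yy by rewrite ler_pM2l//; lra.
have h2 : b * yy <= 0 by rewrite pmulr_rle0.
have h3 : 0 <= a * (del / 8) by rewrite mulr_ge0//; lra.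
by split; lra.
Qed.

Let radius_point (y : E) : yy - A - 1 < t y <= A ->
  [/\ en y = a + b * t y, 0 < en y, a * (1 - del / 8) <= en y &
   en y <= a * (1 + del / 8)].
Proof.
move=> /andP[t1 t2]; have [a0' w1 d1] : [/\ 0 < a, A - yy + 1 <= w & del <= 1] by [].
have e : en y = a + b * t y by field; rewrite gt_eqF.
have [|h1 h2] := @radius_window (t y) _ t2; first lra.
rewrite -e in h1 h2; split => //; apply: lt_le_trans h1; rewrite mulr_gt0//; lra.
Qed.

Let bounded_lap_window q : 0 <= q ->
  bounded_measurable (fun y => expR (- (lam * q * (1 - U y))) * nz y).
Proof.
move=> q0; have := @bounded_laplace R m i0 1 (lam * q).
rewrite normr1 => /(_ _ (lexx _)) h.
under eq_fun do rewrite -[U _]mul1r; apply: h; exact: mulr_ge0.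
Qed.

Let bounded_exp_window q tau : 0 <= q ->
  bounded_measurable (fun y => expR (tau - yy) * (expR (- (lam * q * (1 - U y))) * nz y)).
Proof.
move=> q0; apply: bounded_measurableM; first exact: bounded_measurable_cst.
exact: bounded_lap_window.
Qed.

Let lap_window q tau r : 0 <= q -> r * expR (tau - yy) * lap i0 mu (lam * q) =
  \int[mu]_y (r * (expR (tau - yy) * (expR (- (lam * q * (1 - U y))) * nz y))).
Proof.
move=> q0; rewrite RintegralZl//; last first.
  by apply: bounded_measurable_integrable; exact: bounded_exp_window.
rewrite RintegralZl ?mulrA//.
by apply: bounded_measurable_integrable; exact: bounded_lap_window.
Qed.

(** Given [y], a point [x] forms an edge only if its rescaled radius exceeds
    [yy - t y + lam (1 - del) (1 - c)], where [c] is the cosine of the angle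
    between [x] and [- y]. Given [c] this has probability at most
    [(1 + del) / n] times the exponential of the opposite, and averaging over
    the direction of [x] gives the Laplace transform. *)
Lemma section_upper y : yy - A - 1 < t y <= A ->
  n * phi y * pi0 <=
  (1 + del) * expR (t y - yy) * lap i0 mu (lam * (1 - del)).
Proof.
move=> ty; have [a0' b0' A0'] : [/\ 0 < a, 0 < b & 0 <= A] by [].
have [d0 d1] : 0 <= del /\ del <= 1 by [].
have [ye y0 y1 y2] := radius_point ty; have [u1 u2] := u_window.
have /andP[t1 t2] := ty.
have vv := opposite_unit (lt0r_neq0 y0).
set v := - (en y)^-1 *: _ in vv.
pose f := threshold (1 - del) (t y).
have mf := measurable_threshold (1 - del) (t y).
have q0 : 0 <= 1 - del by lra.
have sub : [set x | edge B u x y] `<=`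
   [set x : E | (0 < en x) && (f (dot (x : 'rV[R]_d) v / en x) < en x <= B)].
  move=> x /= exy; have tx := @edge_radius y x.
  rewrite edgeC in tx; have [xe x0 x1 x2] := radius_point (tx exy).
  have /and3P[xB _ ux] := exy; rewrite x0 xB andbT/=.
  have := cosine_le1 x vv; rewrite ler_norml => /andP[c1 c2].
  have h : u ^+ 2 < en x ^+ 2 + en y ^+ 2 + 2 * (en x * en y * (dot (x : 'rV[R]_d) v / en x)).
    rewrite -edge_dist ?gt_eqF// ltr_pXn2r ?nnegrE ?enorm_ge0//.
    by apply: le_trans u1; rewrite mulr_ge0//; lra.
  have k0 : 0 <= del / 8 by lra.
  have := annulus_upper a0 k0 (erefl _) del1 x1 x2 y1 y2 u1 u2 c1 c2 h.
  rewrite /f /threshold; set c := dot _ _ / _ => h'.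
  have -> : a + b * (yy - t y + lam * (1 - del) * (1 - c)) =
    u - en y + a / 2 * (1 - del) * (1 - c) by field; rewrite gt_eqF.
  lra.
have mW := measurable_window (f := f) B mf.
have mS : measurable [set x : E | (0 < en x) && (f (dot (x : 'rV[R]_d) v / en x) < en x <= B)].
  exact: measurable_polar_window.
have h1 : phi y <= pr [set x : E | (0 < en x) && (f (dot (x : 'rV[R]_d) v / en x) < en x <= B)].
  by apply: le_pr => //; exact: measurable_edge_section.
apply: (@le_trans _ _ (n * (\int[mu]_y' (pr (window f B (U y')) * nz y')))).
  by rewrite -(polar_window i0 mu_rot B mf vv) mulrA (ler_wpM2r (ltW pi0_gt0))// ler_wpM2l.
have bw := bounded_window i0 mu B mf.
rewrite -RintegralZl//; last first.
  apply: bounded_measurable_integrable; apply: bounded_measurableM => //.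
  exact: bounded_nonzero.
rewrite lap_window//.
apply: le_Rintegral => //.
- apply: bounded_measurable_integrable; apply: bounded_measurableM.
    exact: bounded_measurable_cst.
  by apply: bounded_measurableM => //; exact: bounded_nonzero.
- apply: bounded_measurable_integrable; apply: bounded_measurableM.
    exact: bounded_measurable_cst.
  exact: bounded_exp_window.
move=> y' _; rewrite !mulrA ler_wpM2r//.
apply: le_trans (window_tail_le (threshold_window y' q0 t2)) _.
rewrite -[leRHS]mulrA -expRD le_eqVlt; apply/orP; left; apply/eqP; congr (_ * expR _).
by ring.
Qed.

(** The same computation in the other direction, with the two terms of
    [window_tail_ge] giving two Laplace transforms. *)
Lemma section_lower y : yy - A < t y <= A ->
  (1 - del) * expR (t y - yy) * lap i0 mu (lam * (1 + del)) -
  2 * expR (- ((t y - yy + A) / 2)) * expR (t y - yy) *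
    lap i0 mu (lam * ((1 + del) / 2)) <= n * phi y * pi0.
Proof.
move=> ty; have [a0' b0' A0'] : [/\ 0 < a, 0 < b & 0 <= A] by [].
have [yy0' w1 w2] : [/\ yy <= 0, A - yy + 1 <= w & b * w <= a * (del / 8)] by [].
have [d0 d1] : 0 <= del /\ del <= 1 by [].
have ty' : yy - A - 1 < t y <= A by move: ty => /andP[? ?]; apply/andP; split; lra.
have [ye y0 y1 y2] := radius_point ty'; have [u1 u2] := u_window.
have /andP[t1 t2] := ty.
have vv := opposite_unit (lt0r_neq0 y0).
set v := - (en y)^-1 *: _ in vv.
pose f := threshold (1 + del) (t y).
have mf := measurable_threshold (1 + del) (t y).
have q0 : 0 <= 1 + del by lra.
have q20 : 0 <= (1 + del) / 2 by lra.
have sub : [set x : E | (0 < en x) && (f (dot (x : 'rV[R]_d) v / en x) < en x <= B)] `<=`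
    [set x | edge B u x y].
  move=> x /= /andP[x0 /andP[fx xB]].
  have := cosine_le1 x vv; rewrite ler_norml => /andP[c1 c2].
  move: fx c1 c2; rewrite /f /threshold; set c := dot _ _ / _ => fx c1 c2.
  have lq : 0 <= lam * (1 + del) * (1 - c).
    by apply: mulr_ge0; [exact: mulr_ge0|rewrite subr_ge0].
  have x_ge : a * (1 - del / 8) <= en x.
    have : b * - w <= b * (yy - t y + lam * (1 + del) * (1 - c)).
      by rewrite ler_pM2l//; lra.
    by lra.
  have x_le : en x <= a * (1 + del / 8).
    apply: (le_trans xB); have : b * A <= b * w by rewrite ler_pM2l//; lra.
    by lra.
  have k0 : 0 <= del / 8 by lra.
  have := annulus_lower a0 k0 (erefl _) del1 x_ge x_le y1 y2 u1 u2 c1 c2.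
  have fE : a + b * (yy - t y + lam * (1 + del) * (1 - c)) =
    u - en y + a / 2 * (1 + del) * (1 - c) by field; rewrite gt_eqF.
  rewrite fE in fx => h.
  apply/and3P; split => //.
    by rewrite ye lerD2l ler_pM2l.
  rewrite -(@ltr_pXn2r _ 2)// ?nnegrE ?enorm_ge0//.
    by rewrite edge_dist ?gt_eqF//; apply: h; lra.
  by apply: le_trans u1; rewrite mulr_ge0//; lra.
have mS : measurable [set x : E | (0 < en x) && (f (dot (x : 'rV[R]_d) v / en x) < en x <= B)].
  exact: measurable_polar_window.
have h1 : pr [set x : E | (0 < en x) && (f (dot (x : 'rV[R]_d) v / en x) < en x <= B)] <= phi y.
  by apply: le_pr => //; exact: measurable_edge_section.
apply: (@le_trans _ _ (n * (\int[mu]_y' (pr (window f B (U y')) * nz y')))); last first.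
  by rewrite -(polar_window i0 mu_rot B mf vv) mulrA (ler_wpM2r (ltW pi0_gt0))// ler_wpM2l.
have bw := bounded_window i0 mu B mf.
rewrite -RintegralZl//; last first.
  apply: bounded_measurable_integrable; apply: bounded_measurableM => //.
  exact: bounded_nonzero.
rewrite (lap_window (t y) (1 - del) q0).
rewrite (lap_window (t y) (2 * expR (- ((t y - yy + A) / 2))) q20).
have bound r q : 0 <= q -> bounded_measurable (fun y' =>
    r * (expR (t y - yy) * (expR (- (lam * q * (1 - U y'))) * nz y'))).
  move=> q'; apply: bounded_measurableM; first exact: bounded_measurable_cst.
  exact: bounded_exp_window.
rewrite -RintegralB//; last 2 first.
- by apply: bounded_measurable_integrable; exact: bound.
- by apply: bounded_measurable_integrable; exact: bound.
apply: le_Rintegral => //.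
- apply: bounded_measurable_integrable.
  rewrite (_ : (fun _ => _) = (fun y' =>
      (1 - del) * (expR (t y - yy) * (expR (- (lam * (1 + del) * (1 - U y'))) * nz y')) +
      (- (2 * expR (- ((t y - yy + A) / 2)))) * (expR (t y - yy) *
         (expR (- (lam * ((1 + del) / 2) * (1 - U y'))) * nz y')))).
    by apply: bounded_measurableD; exact: bound.
  by apply/funext => y'; rewrite mulNr.
- apply: bounded_measurable_integrable; apply: bounded_measurableM.
    exact: bounded_measurable_cst.
  by apply: bounded_measurableM => //; exact: bounded_nonzero.
move=> y' _; rewrite !mulrA -mulrBl ler_wpM2r//.
apply: le_trans (window_tail_ge (threshold_window y' q0 t2)).
rewrite le_eqVlt; apply/orP; left; apply/eqP.
rewrite -[(1 - del) * _ * _]mulrA -[2 * _ * _ * _]mulrA -[2 * _ * (_ * _)]mulrA -!expRD.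
congr (_ * expR _ - _ * expR _); first ring.
by field; rewrite gt_eqF.
Qed.

Let measurable_t : measurable_fun setT (fun y : E => t y).
Proof.
apply: measurable_funM; last exact: measurable_cst.
by apply: measurable_funB; [exact: measurable_enormE|exact: measurable_cst].
Qed.

Let t_tail s : - w <= s -> s <= A ->
  (1 - del) * expR (- s) <= n * pr [set y : E | s < t y] <= (1 + del) * expR (- s).
Proof.
move=> ws sA; have := G_tail ws sA.
rewrite (_ : [set x : E | a + b * s < en x] = [set y : E | s < t y])//.
by apply/seteqP; split => x /=; rewrite ltr_pdivlMr// ltrBrDl mulrC.
Qed.

Lemma lap_ge0 l : 0 <= lap i0 mu l.
Proof. by apply: Rintegral_ge0 => y _; rewrite mulr_ge0 ?expR_ge0 ?ler0n. Qed.

Local Notation Cu := ((1 + del) * expR (- yy) * lap i0 mu (lam * (1 - del))).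
Local Notation c0 := (yy - A - 1).

Let section_le y : n * phi y * pi0 <= Cu * (expR (t y) * (c0 < t y <= A)%R%:R).
Proof.
have [ty|ty] := boolP (c0 < t y <= A).
  apply: le_trans (section_upper ty) _.
  rewrite mulr1 expRD; set e1 := expR _; set e2 := expR _; set l := lap _ _ _.
  by rewrite le_eqVlt; apply/orP; left; apply/eqP; ring.
rewrite (_ : phi y = 0) ?mulr0 ?mul0r//.
rewrite /section_prob (_ : [set x | _] = set0) ?measure0//.
by apply/seteqP; split => x //= /edge_radius; apply/negP.
Qed.

Let Cu0 : 0 <= Cu.
Proof.
apply: mulr_ge0; last exact: lap_ge0.
by rewrite mulr_ge0 ?expR_ge0// addr_ge0.
Qed.

Let layer_bound : layer mu (fun y => t y) n A c0 <= (1 + del) * (2 * A - yy + 5).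
Proof.
have A0' := A0; have [yy0' w1] : yy <= 0 /\ A - yy + 1 <= w by [].
have -> : 2 * A - yy + 5 = A - c0 + 4 by ring.
apply: layer_le => //; first lra.
by move=> s s1 s2; apply: t_tail => //; lra.
Qed.

Let bounded_phi : bounded_measurable phi.
Proof. exact: bounded_section_prob. Qed.

(** The section bound is [exp (t y)] times a constant, and the integral of
    [exp (t y)] over the range of radii that allow an edge is a [layer]. *)
Lemma pair_upper : n * (n * \int[mu]_y phi y) * pi0 <=
  Cu * ((1 + del) * (2 * A - yy + 5)).
Proof.
apply: le_trans (ler_wpM2l Cu0 layer_bound).
rewrite /layer -(mulrA n) [leRHS]mulrCA ler_wpM2l//.
have bc (r : R) : bounded_measurable (fun _ : E => r) by exact: bounded_measurable_cst.
have bl := @bounded_layer _ _ _ _ measurable_t A c0.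
rewrite -RintegralZl//; last exact: bounded_measurable_integrable.
rewrite -RintegralZr//; last first.
  by apply: bounded_measurable_integrable; exact: bounded_measurableM.
rewrite -RintegralZl//; last exact: bounded_measurable_integrable.
apply: le_Rintegral => //.
- apply: bounded_measurable_integrable; apply: bounded_measurableM => //.
  exact: bounded_measurableM.
- by apply: bounded_measurable_integrable; exact: bounded_measurableM.
Qed.

(** Of the two factors [exp (t y)] in the square of the section bound, one is
    at most [exp A] by truncation. *)
Lemma triple_upper : n * (n ^+ 2 * \int[mu]_y (phi y ^+ 2)) * pi0 ^+ 2 <=
  Cu ^+ 2 * expR A * ((1 + del) * (2 * A - yy + 5)).
Proof.
have CA0 : 0 <= Cu ^+ 2 * expR A by rewrite mulr_ge0 ?expR_ge0// exprn_ge0.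
apply: le_trans (ler_wpM2l CA0 layer_bound).
rewrite /layer -(mulrA n) [leRHS]mulrCA ler_wpM2l//.
have bc (r : R) : bounded_measurable (fun _ : E => r) by exact: bounded_measurable_cst.
have bl := @bounded_layer _ _ _ _ measurable_t A c0.
have b2 : bounded_measurable (fun y => phi y ^+ 2) by exact: bounded_measurableX.
rewrite -RintegralZl//; last exact: bounded_measurable_integrable.
rewrite -RintegralZr//; last first.
  by apply: bounded_measurable_integrable; exact: bounded_measurableM.
rewrite -RintegralZl//; last exact: bounded_measurable_integrable.
apply: le_Rintegral => //.
- apply: bounded_measurable_integrable; apply: bounded_measurableM => //.
  exact: bounded_measurableM.
- by apply: bounded_measurable_integrable; exact: bounded_measurableM.
move=> y _; have h := section_le y.
have p0 : 0 <= n * phi y * pi0.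
  by rewrite mulr_ge0 ?(ltW pi0_gt0)// mulr_ge0// fine_ge0.
have -> : n ^+ 2 * phi y ^+ 2 * pi0 ^+ 2 = (n * phi y * pi0) ^+ 2 by ring.
apply: (@le_trans _ _ ((Cu * (expR (t y) * (c0 < t y <= A)%R%:R)) ^+ 2)).
  by rewrite lerXn2r ?nnegrE//; exact: le_trans h.
have [/andP[_ ty]|ty] := boolP (c0 < t y <= A); last by rewrite !mulr0 expr0n.
rewrite !mulr1 [leLHS]exprMn -[leRHS]mulrA ler_wpM2l ?sqr_ge0//.
by rewrite expr2 ler_wpM2r ?expR_ge0// ler_expR.
Qed.

(** Radii [t y] below [yy - A + Bd] are discarded; above, the second term of
    [section_lower] is smaller by the factor [exp (- Bd / 2)]. *)
Lemma pair_lower (Bd : R) : 0 <= Bd -> yy - A + Bd <= A ->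
  let Cl := (1 - del) * lap i0 mu (lam * (1 + del)) -
    2 * expR (- (Bd / 2)) * lap i0 mu (lam * ((1 + del) / 2)) in
  0 <= Cl ->
  expR (- yy) * Cl * ((1 - del) * (2 * A - yy - Bd) - 3) <=
  n * (n * \int[mu]_y phi y) * pi0.
Proof.
move=> Bd0 cA Cl Cl0; set c := yy - A + Bd in cA.
have A0' := A0; have [yy0' w1] : yy <= 0 /\ A - yy + 1 <= w by [].
have C0 : 0 <= expR (- yy) * Cl by rewrite mulr_ge0 ?expR_ge0.
have lay : (1 - del) * (2 * A - yy - Bd) - 3 <= layer mu (fun y => t y) n A c.
  have -> : 2 * A - yy - Bd = A - c by rewrite /c; ring.
  apply: layer_ge => // s s1 s2; apply: t_tail => //.
  by move: s1; rewrite /c; lra.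
apply: (le_trans (ler_wpM2l C0 lay)).
rewrite /layer -(mulrA n) [leLHS]mulrCA ler_wpM2l//.
have bc (r : R) : bounded_measurable (fun _ : E => r) by exact: bounded_measurable_cst.
have bl := @bounded_layer _ _ _ _ measurable_t A c.
rewrite -[leLHS]RintegralZl//; last exact: bounded_measurable_integrable.
rewrite -RintegralZl//; last exact: bounded_measurable_integrable.
rewrite -RintegralZr//; last first.
  by apply: bounded_measurable_integrable; exact: bounded_measurableM.
apply: le_Rintegral => //.
- by apply: bounded_measurable_integrable; exact: bounded_measurableM.
- apply: bounded_measurable_integrable; apply: bounded_measurableM => //.
  exact: bounded_measurableM.
move=> y _; have [ty|ty] := boolP (c < t y <= A); last first.
  by rewrite !mulr0 !mulr_ge0 ?(ltW pi0_gt0)// fine_ge0.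
have /andP[t1 t2] := ty; rewrite mulr1.
have ty' : yy - A < t y <= A by rewrite t2 andbT; move: t1; rewrite /c; lra.
apply: le_trans (section_lower ty').
have eM : expR (- ((t y - yy + A) / 2)) <= expR (- (Bd / 2)).
  by rewrite ler_expR; move: t1; rewrite /c; lra.
have l2 := lap_ge0 (lam * ((1 + del) / 2)).
rewrite expRD /Cl; set e1 := expR (- yy); set e2 := expR (t y).
have e12 : 0 <= e1 * e2 by rewrite mulr_ge0 ?expR_ge0.
have h : e1 * e2 * lap i0 mu (lam * ((1 + del) / 2)) * expR (- ((t y - yy + A) / 2)) <=
    e1 * e2 * lap i0 mu (lam * ((1 + del) / 2)) * expR (- (Bd / 2)).
  by rewrite ler_wpM2l// mulr_ge0.
move: h; set l1 := lap _ _ (lam * (1 + del)); set l3 := lap _ _ _.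
set e3 := expR (- (Bd / 2)); set e4 := expR _ => h.
have -> : e1 * ((1 - del) * l1 - 2 * e3 * l3) * e2 =
  (1 - del) * (e2 * e1) * l1 - 2 * (e1 * e2 * l3 * e3) by ring.
have -> : 2 * e4 * (e2 * e1) * l3 = 2 * (e1 * e2 * l3 * e4) by ring.
by rewrite lerD2l lerN2 ler_pM2l.
Qed.

End truncated_edges.

(** * Edges of a sample *)

Section pair_rv.
Context d (T : measurableType d) (R : realType) (P : probability T R).
Context d1 (E1 : measurableType d1) d2 (E2 : measurableType d2).
Variables (Y : {RV P >-> E1}) (Z : {RV P >-> E2}).

Definition pair_fun (t : T) : E1 * E2 := (Y t, Z t).

Let measurable_pair_fun : measurable_fun setT pair_fun.
Proof. by apply: measurable_fun_pair; exact: measurable_funPT. Qed.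

HB.instance Definition _ := isMeasurableFun.Build _ _ _ _ pair_fun measurable_pair_fun.

Definition pair_rv : {RV P >-> (E1 * E2)%type} := pair_fun.

End pair_rv.

Section joint_law.
Local Open Scope ereal_scope.
Context d (T : measurableType d) (R : realType) (P : probability T R).
Context d1 (E1 : measurableType d1) d2 (E2 : measurableType d2).
Variables (Y : {RV P >-> E1}) (Z : {RV P >-> E2}).
Hypothesis YZ_indep : forall A B, measurable A -> measurable B ->
  P (Y @^-1` A `&` Z @^-1` B) = P (Y @^-1` A) * P (Z @^-1` B).

Lemma joint_law (S : set (E1 * E2)) : measurable S ->
  P [set t | S (Y t, Z t)] =
  \int[distribution P Y]_y distribution P Z (xsection S y).
Proof.
move=> mS.
have := @product_measure_unique _ _ _ _ _ (distribution P Y) (distribution P Z)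
  (distribution P (pair_rv Y Z)) _ S mS.
by rewrite /product_measure1/= => -> // A B mA mB; exact: YZ_indep.
Qed.

End joint_law.

Section edge_events.
Context dT (T : measurableType dT) (R : realType) (P : probability T R) (m : nat).
Local Notation d := m.+2.
Local Notation E := (borel_rV R d).
Variables (X : nat -> {RV P >-> E}) (mu : probability E R).
Hypothesis X_indep : independent_sequence X.
Hypothesis X_law : forall i (A : set E), measurable A -> distribution P (X i) A = mu A.
Variables B u : R.
Local Notation pr S := (fine (P S)).
Local Notation edge := (edge B u).
Local Notation phi := (section_prob mu B u).

Definition edge_event (i j : nat) : set T := [set t | edge (X i t) (X j t)].

Lemma edge_eventC i j : edge_event i j = edge_event j i.
Proof. by apply/seteqP; split => t; rewrite /edge_event/= edgeC. Qed.

Lemma edge_event_cylinder (J : {fset nat}) i j : i \in J -> j \in J ->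
  <<s cylinder X J >> (edge_event i j).
Proof.
move=> iJ jJ.
have : measurable_fun setT (fun t : g_sigma_algebraType (cylinder X J) =>
    edge (X i t) (X j t)).
  have mg : measurable_fun setT
      (fun t : g_sigma_algebraType (cylinder X J) => (X i t, X j t) : E * E).
    by apply: measurable_fun_pair; exact: cylinder_coord.
  exact: (measurableT_comp (measurable_edge B u) mg).
by move=> /measurable_bool_set.
Qed.

Lemma measurable_edge_event i j : measurable (edge_event i j).
Proof.
apply: measurable_bool_set.
have mg : measurable_fun setT (fun t => (X i t, X j t) : E * E).
  by apply: measurable_fun_pair; exact: measurable_funPT.
exact: (measurableT_comp (measurable_edge B u) mg).
Qed.

Lemma rv_cylinder i (A : set E) : measurable A ->
  <<s cylinder X [fset i]%fset >> (X i @^-1` A).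
Proof.
move=> mA; have iJ : i \in [fset i]%fset by rewrite inE.
by have := @cylinder_coord _ T R P _ E X _ i iJ measurableT A mA; rewrite setTI.
Qed.

Lemma coord_indep i j (A A' : set E) : i != j -> measurable A -> measurable A' ->
  P (X i @^-1` A `&` X j @^-1` A') = (P (X i @^-1` A) * P (X j @^-1` A'))%E.
Proof.
move=> ij mA mA'; apply: (block_indep X_indep (I := [fset i]%fset) (J := [fset j]%fset)).
- by rewrite fdisjointX1 inE eq_sym.
- exact: rv_cylinder.
- exact: rv_cylinder.
Qed.

Lemma measurable_edge_sectionl y : measurable [set x : E | edge y x].
Proof.
rewrite (_ : [set x : E | edge y x] = [set x | edge x y]); first exact: measurable_edge_section.
by apply/seteqP; split => x /=; rewrite edgeC.
Qed.

Let phiE y : (mu [set x : E | edge y x] = (phi y)%:E)%E.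
Proof.
rewrite /section_prob fineK; last by rewrite fin_num_measure//; exact: measurable_edge_section.
by congr (mu _); apply/seteqP; split => x /=; rewrite edgeC.
Qed.

Let law_integral i (f : E -> R) :
  (\int[distribution P (X i)]_y (f y)%:E = \int[mu]_y (f y)%:E)%E.
Proof. by apply: eq_measure_integral => A mA _; exact: X_law. Qed.

Lemma pr_edge i j : i != j -> pr (edge_event i j) = \int[mu]_y phi y.
Proof.
move=> ij; pose S : set (E * E) := [set z | edge z.1 z.2].
have mS : measurable S by apply: measurable_bool_set; exact: measurable_edge.
rewrite /Rintegral -(law_integral i) -[edge_event i j]/[set t | S (X i t, X j t)].
rewrite (joint_law (Y := X i) (Z := X j)) //; last first.
  by move=> A A' mA mA'; exact: coord_indep.
congr fine; apply: eq_integral => y _.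
rewrite X_law; last exact: measurable_xsection.
rewrite -phiE; congr (mu _); apply/seteqP; split => x;
  by rewrite /= -?mem_xsection ?inE// /xsection/= ?inE//.
Qed.

(** Given the common endpoint, the two other endpoints are independent. *)
Lemma pr_two_edges i j k : i != j -> i != k -> j != k ->
  pr (edge_event i j `&` edge_event i k) = \int[mu]_y (phi y ^+ 2).
Proof.
move=> ij ik jk; pose S : set (E * (E * E)) :=
  [set z | edge z.1 z.2.1 && edge z.1 z.2.2].
have mS : measurable S.
  apply: measurable_bool_set; apply: measurable_and.
    apply: (measurableT_comp (measurable_edge B u)
      (g := fun z : E * (E * E) => (z.1, z.2.1))).
    apply: measurable_fun_pair; first exact: measurable_fst.
    exact: (measurableT_comp measurable_fst measurable_snd).
  apply: (measurableT_comp (measurable_edge B u)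
    (g := fun z : E * (E * E) => (z.1, z.2.2))).
  apply: measurable_fun_pair; first exact: measurable_fst.
  exact: (measurableT_comp measurable_snd measurable_snd).
rewrite /Rintegral -(law_integral i).
have -> : edge_event i j `&` edge_event i k = [set t | S (X i t, (X j t, X k t))].
  apply/seteqP; split => t; rewrite /edge_event /S/=.
    by move=> [-> ->].
  by move=> /andP[-> ->].
pose YZ := pair_rv (X j) (X k).
rewrite (joint_law (Y := X i) (Z := YZ)) //; last first.
  move=> A A' mA mA'.
  apply: (block_indep X_indep (I := [fset i]%fset) (J := [fset j; k]%fset)).
  - by rewrite fdisjoint1X !inE negb_or ij ik.
  - exact: rv_cylinder.
  have mZ : measurable_fun setT
      (fun t : g_sigma_algebraType (cylinder X [fset j; k]%fset) => (X j t, X k t)).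
    by apply: measurable_fun_pair; apply: cylinder_coord; rewrite !inE eqxx ?orbT.
  by have := mZ measurableT _ mA'; rewrite setTI.
congr fine; apply: eq_integral => y _.
rewrite /distribution /pushforward.
have -> : YZ @^-1` xsection S y =
    X j @^-1` [set x | edge y x] `&` X k @^-1` [set x | edge y x].
  apply/seteqP; split => t; rewrite /preimage/= /xsection/= inE /S/=.
    by move=> /andP[-> ->].
  by move=> [-> ->].
have mE := measurable_edge_sectionl y.
rewrite coord_indep// -[P (X j @^-1` _)]/(distribution P (X j) _).
rewrite -[P (X k @^-1` _)]/(distribution P (X k) _) !X_law//.
by rewrite !phiE -EFinM expr2.
Qed.

End edge_events.

Section no_edge.
Context dT (T : measurableType dT) (R : realType) (P : probability T R) (m : nat).
Local Notation d := m.+2.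
Local Notation E := (borel_rV R d).
Variables (X : nat -> {RV P >-> E}) (mu : probability E R).
Hypothesis X_indep : independent_sequence X.
Hypothesis X_law : forall i (A : set E), measurable A -> distribution P (X i) A = mu A.
Variables (B u : R) (n : nat).
Local Notation pr S := (fine (P S)).
Local Notation phi := (section_prob mu B u).
Local Notation I := ('I_n * 'I_n)%type.

Definition pair_event (e : I) : set T := edge_event X B u e.1 e.2.

Definition pair_list : seq I := [seq e : I <- enum {: I} | (e.1 < e.2)%N].

Definition share (e f : I) : bool :=
  [|| f.1 == e.1, f.1 == e.2, f.2 == e.1 | f.2 == e.2].

Lemma size_pair_list : size pair_list = 'C(n, 2).
Proof.
rewrite /pair_list size_filter -sum1_count big_enum_cond/= big_mkcond/=.
rewrite -(pair_bigA _ (fun i j : 'I_n => if (i < j)%N then 1 else 0)%N)/=.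
rewrite exchange_big/= -bin2_sum big_mkord; apply: eq_bigr => j _.
rewrite -big_mkcond/= -(big_ord_widen n (fun=> 1%N) (ltnW (ltn_ord j))).
by rewrite sum1_card card_ord.
Qed.

Lemma share_count e : (size [seq f <- pair_list | share e f] <= 4 * n)%N.
Proof.
have cfst (i : 'I_n) : count (fun f : I => f.1 == i) (enum {: I}) = n.
  rewrite -sum1_count big_enum_cond/= sum1_card -[RHS]card_ord -[RHS]mul1n -(card1 i).
  by rewrite -cardX; apply: eq_card => -[k l]; rewrite !inE/= andbT.
have csnd (i : 'I_n) : count (fun f : I => f.2 == i) (enum {: I}) = n.
  rewrite -sum1_count big_enum_cond/= sum1_card -[RHS]card_ord -[RHS]muln1 -(card1 i).
  by rewrite -cardX; apply: eq_card => -[k l]; rewrite !inE/=.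
have cU (a b : pred I) s : (count (predU a b) s <= count a s + count b s)%N.
  by rewrite -count_predUI leq_addr.
rewrite size_filter; apply: (@leq_trans (count (share e) (enum {: I}))).
  by rewrite count_filter; apply: sub_count => f /= /andP[].
have hE : share e =1 predU (predU (fun f => f.1 == e.1) (fun f => f.1 == e.2))
    (predU (fun f => f.2 == e.1) (fun f => f.2 == e.2)).
  by move=> f; rewrite /share/= -!orbA.
rewrite (eq_count hE).
apply: (leq_trans (cU _ _ _)); apply: (leq_trans (leq_add (cU _ _ _) (cU _ _ _))).
by rewrite !cfst !csnd; lia.
Qed.

Let p := \int[mu]_y phi y.
Let q := \int[mu]_y (phi y ^+ 2).

Lemma pr_sharing (e f : I) : (e.1 < e.2)%N -> (f.1 < f.2)%N -> e != f -> share e f ->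
  pr (pair_event e `&` pair_event f) = q.
Proof.
case: e f => [i j] [k l] /= ij kl ef.
have two := pr_two_edges X_indep X_law B u.
have C := edge_eventC X B u.
rewrite /pair_event/= => /or4P[] /eqP /= e1.
- rewrite e1 in ef kl *; apply: two.
  + by rewrite ltn_eqF.
  + by rewrite ltn_eqF.
  + by apply: contraNneq ef => /val_inj ->.
- rewrite e1 in kl *; rewrite (C i j); apply: two.
  + by rewrite gtn_eqF.
  + by rewrite ltn_eqF.
  + by rewrite ltn_eqF// (ltn_trans ij kl).
- rewrite e1 in kl *; rewrite (C k i); apply: two.
  + by rewrite ltn_eqF.
  + by rewrite gtn_eqF.
  + by rewrite gtn_eqF// (ltn_trans kl ij).
- rewrite e1 in ef kl *; rewrite (C i j) (C k j); apply: two.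
  + by rewrite gtn_eqF.
  + by rewrite gtn_eqF.
  + by apply: contraNneq ef => /val_inj ->.
Qed.

(** The pairs disjoint from [e] involve only variables other than the two of
    [e]. *)
Lemma far_indep (e : I) (s : seq I) :
  let far := none pair_event [seq f <- s | ~~ share e f] in
  pr (pair_event e `&` far) = pr (pair_event e) * pr far.
Proof.
move=> far.
pose J := [fset val e.1; val e.2]%fset.
pose K := [fset i in iota 0 n | i \notin J]%fset.
pose A' f := if share e f then set0 else pair_event f.
have far' : far = none A' [seq f <- s | ~~ share e f].
  apply/seteqP; split => t h f; have := h f; rewrite mem_filter /A' => hf /andP[sf fs];
    by move: hf; rewrite sf fs (negbTE sf) => /(_ isT).
have mA' f : <<s cylinder X K >> (A' f).
  rewrite /A'; case: ifPn => [_|sf]; first exact: sigma_algebra0.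
  have inK (i : 'I_n) : i != e.1 -> i != e.2 -> val i \in K.
    move=> i1 i2; rewrite !inE mem_iota/= add0n ltn_ord/=.
    by rewrite negb_or !val_eqE i1 i2.
  move: sf; rewrite /share !negb_or => /and4P[? ? ? ?].
  by apply: edge_event_cylinder; exact: inK.
have mfar : <<s cylinder X K >> far.
  rewrite far'.
  exact: (@measurable_none _ (g_sigma_algebraType (cylinder X K)) I A' mA').
have me : <<s cylinder X J >> (pair_event e).
  by apply: edge_event_cylinder; rewrite !inE eqxx ?orbT.
have JK : [disjoint J & K]%fset.
  apply/fdisjointP => i iJ; apply/negP; rewrite /K inE/= => /andP[_].
  by move=> /negP; apply.
rewrite (block_indep X_indep JK me mfar) fineM// fin_num_measure//.
  exact: measurable_edge_event.
by apply: measurable_none => f; exact: measurable_edge_event.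
Qed.

(** Each pair shares an index with at most [4 n] pairs, and two pairs that share
    an index are two edges at a common endpoint. *)
Theorem no_edge_binomial :
  `|pr (none pair_event pair_list) - (1 - p) ^+ 'C(n, 2)| <=
    'C(n, 2)%:R * (4 * n)%:R * (q + p ^+ 2).
Proof.
have me f : measurable (pair_event f) by exact: measurable_edge_event.
have pE f : f \in pair_list -> pr (pair_event f) = p.
  rewrite mem_filter => /andP[f12 _]; apply: pr_edge => //.
  by rewrite ltn_eqF.
have bphi := bounded_section_prob mu B u.
have phi0 y : 0 <= phi y by exact: fine_ge0.
have p0 : 0 <= p by apply: Rintegral_ge0.
have q0 : 0 <= q by apply: Rintegral_ge0 => y _; rewrite exprn_ge0.
have p1 : p <= 1.
  have -> : 1 = \int[mu]_y (1 : R).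
    have mu1 : fine (mu setT) = 1 by rewrite (@probability_setT _ _ _ mu).
    by rewrite Rintegral_cst// [fine _](_ : _ = 1) ?mulr1.
  apply: le_Rintegral => //.
  - exact: bounded_measurable_integrable.
  - by apply: bounded_measurable_integrable; exact: bounded_measurable_cst.
  move=> y _; apply: pr_le1; exact: measurable_edge_section.
rewrite -size_pair_list.
apply: (pr_none_binomial me (touch := share)) => //.
- by rewrite filter_uniq// enum_uniq.
- move=> e f; rewrite !mem_filter => /andP[e12 _] /andP[f12 _] ef sf.
  by rewrite pr_sharing.
- by move=> e es s' _; rewrite far_indep pE.
- by move=> e _; exact: share_count.
Qed.

End no_edge.

(** * Mean number of edges *)

Section mean_number_of_edges.
Context (R : realType) (m : nat).
Local Notation d := m.+2.
Local Notation p := m.+1.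
Variable i0 : 'I_d.
Local Notation E := (borel_rV R d).
Variable mu : probability E R.
Hypothesis mu_rot : forall Q : 'M[R]_d, Q *m Q^T = 1%:M ->
  forall A : set E, measurable A -> mu [set x | A ((x : 'rV[R]_d) *m Q)] = mu A.
Local Notation en x := (enorm (x : 'rV[R]_d)).
Local Notation pr S := (fine (mu S)).
Local Notation pi0 := (moment i0 mu 0).
Hypothesis pi0_gt0 : 0 < pi0.

Variables a b : nat -> R.
Local Notation ell n := (ln (a n / b n)).
Hypothesis ab_gt0 : \forall n \near \oo, 0 < a n /\ 0 < b n.
Hypothesis ell_cvg : ell n @[n --> \oo] --> +oo.
Hypothesis tail : forall K del : R, 0 < K -> 0 < del -> \forall n \near \oo,
  forall t : R, `|t| <= K * ell n ->
    (1 - del) * expR (- t) <= n%:R * pr [set x : E | a n + b n * t < en x] <=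
    (1 + del) * expR (- t).

Variables x A : R.
Hypothesis A0 : 0 <= A.
Local Notation c := (c_ R d).
Local Notation alpha := (p%:R / 2 : R).

(** The normalized maximum is at most [x] exactly when the maximum is at most
    [level n]. *)
Definition shift n : R := x - (alpha * ell n - ln (ell n) - ln c).
Definition radius n : R := a n + b n * A.
Definition level n : R := 2 * a n + b n * shift n.
Local Notation lam n := (a n / (2 * b n)).

Lemma c_gt0 : 0 < c.
Proof.
rewrite /c_ Gamma_half divr_gt0 ?sqrtr_gt0 ?pi_gt0//.
by rewrite !mulr_gt0 ?gmoment_gt0// ?exprz_gt0// subr_gt0 ltr1n.
Qed.

(** The value of [c_d] is designed for this cancellation: the right-hand side
    is [2 / alpha], and the integral over the radius contributes the factor
    [alpha], so that the mean number of edges tends to [exp (- x)]. *)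
Lemma c_E : Num.sqrt 2 ^+ p * (Num.sqrt 2 ^+ p * Gamma (m.+2%:R / 2) / (2 * Num.sqrt pi)) / c =
  4 / p%:R :> R.
Proof.
have s2 : Num.sqrt 2 ^+ p * Num.sqrt 2 ^+ p = 2 ^+ p :> R.
  by rewrite -exprMn -expr2 sqr_sqrtr.
have G0 : 0 < Gamma (m.+2%:R / 2) :> R by rewrite Gamma_half mulr_gt0// gmoment_gt0.
have pi0' : 0 < Num.sqrt pi :> R by rewrite sqrtr_gt0 pi_gt0.
rewrite /c_ !mulrA s2.
have -> : (m.+2%:R - 1 : R) = p%:R by rewrite -natr1 addrK.
have -> : (2 : R) ^ (m.+2%:Z - 4) = 2 ^+ p / 8.
  rewrite expfzDr// -[(2 : R) ^ (- 4)]/((2 ^+ 4)^-1) -[(2 : R) ^ m.+2%:Z]/(2 ^+ m.+2).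
  by rewrite (exprS _ m.+1) (_ : (2 : R) ^+ 4 = 16); [field|ring].
by field; rewrite !gt_eqF// ?exprn_gt0.
Qed.

Lemma ln_le_linear (k : R) : 0 < k -> \forall n \near \oo, 0 <= ln (ell n) <= k * ell n.
Proof.
move=> k0; near=> n.
have l1 : 1 <= ell n by near: n; move/cvgryPge : ell_cvg; exact.
have l2 : 2 / k ^+ 2 <= ell n by near: n; move/cvgryPge : ell_cvg; exact.
rewrite ln_ge0//= -[leRHS]expRK ler_ln ?posrE ?expR_gt0//; last lra.
have : 1 + (k * ell n) ^+ 2 / 2 <= expR (k * ell n).
  by apply: (@expR_ge1Dxn R _ 1); rewrite mulr_ge0//; lra.
rewrite ler_pdivrMr ?exprn_gt0// in l2.
by nra.
Unshelve. all: by end_near. Qed.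

Lemma ln_div_cvg0 : ln (ell n) / ell n @[n --> \oo] --> (0 : R).
Proof.
apply/cvgrPdist_le => e e0; near=> n.
have l1 : 1 <= ell n by near: n; move/cvgryPge : ell_cvg; exact.
have /andP[h1 h2] : 0 <= ln (ell n) <= e * ell n by near: n; exact: ln_le_linear.
rewrite sub0r normrN ger0_norm; last by rewrite divr_ge0//; lra.
by rewrite ler_pdivrMr//; lra.
Unshelve. all: by end_near. Qed.

Lemma inv_ell_cvg0 : (ell n)^-1 @[n --> \oo] --> (0 : R).
Proof.
apply/gtr0_cvgV0 => //; near=> n; near: n.
by move/cvgryPgt : ell_cvg; exact.
Unshelve. all: by end_near. Qed.

Lemma shift_cvg (C : R) : (C - shift n) / ell n @[n --> \oo] --> alpha.
Proof.
have h : (C - x - ln c) * (ell n)^-1 - ln (ell n) / ell n + alpha @[n --> \oo] -->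
    (C - x - ln c) * 0 - 0 + alpha.
  apply: cvgD; last exact: cvg_cst.
  apply: cvgB; last exact: ln_div_cvg0.
  by apply: cvgM; [exact: cvg_cst|exact: inv_ell_cvg0].
rewrite mulr0 subr0 add0r in h; apply: cvg_trans h; apply: near_eq_cvg.
near=> n; have l0 : 0 < ell n by near: n; move/cvgryPgt : ell_cvg; exact.
by rewrite /shift; field; rewrite gt_eqF.
Unshelve. all: by end_near. Qed.

Lemma lam_cvg (q : R) : 0 < q -> lam n * q @[n --> \oo] --> +oo.
Proof.
move=> q0; apply/cvgryPge => M; near=> n.
have [a0 b0] : 0 < a n /\ 0 < b n by near: n.
have h : 2 * `|M| / q <= ell n by near: n; move/cvgryPge : ell_cvg; exact.
have e : a n / b n = expR (ell n) by rewrite lnK// posrE divr_gt0.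
have -> : lam n * q = a n / b n * (q / 2) by field; rewrite gt_eqF.
rewrite e; have h2 := expR_ge1Dx (ell n).
rewrite ler_pdivrMr// in h; have := ler_norm M.
have : ell n * (q / 2) <= expR (ell n) * (q / 2) by rewrite ler_wpM2r//; lra.
lra.
Unshelve. all: by end_near. Qed.

(** [exp (- shift n)] is [exp (- x) / c] times [(a / b) ^ alpha / ell], and the
    power is exactly what [lap_asymptotic] requires. *)
Lemma scaled_lap_cvg (q : R) : 0 < q ->
  ell n * expR (- shift n) * lap i0 mu (lam n * q) @[n --> \oo] -->
  pi0 * expR (- x) * (4 / p%:R) * Num.sqrt q^-1 ^+ p.
Proof.
move=> q0; pose D : R := Num.sqrt 2 ^+ p * Gamma (m.+2%:R / 2) / (2 * Num.sqrt pi).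
have h := cvg_comp _ _ (lam_cvg q0) (@lap_asymptotic _ _ i0 _ mu_rot).
have h2 : expR (- x) / c * Num.sqrt (2 / q) ^+ p *
    (Num.sqrt (lam n * q) ^+ p * lap i0 mu (lam n * q)) @[n --> \oo] -->
    expR (- x) / c * Num.sqrt (2 / q) ^+ p * (pi0 * D).
  by apply: cvgM; [exact: cvg_cst|exact: h].
have -> : pi0 * expR (- x) * (4 / p%:R) * Num.sqrt q^-1 ^+ p =
    expR (- x) / c * Num.sqrt (2 / q) ^+ p * (pi0 * D).
  by rewrite -c_E sqrtrM// exprMn -/D; ring.
apply: cvg_trans h2; apply: near_eq_cvg; near=> n.
have [a0 b0] : 0 < a n /\ 0 < b n by near: n.
have l0 : 0 < ell n by near: n; move/cvgryPgt : ell_cvg; exact.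
have c0 := c_gt0.
have e1 : expR (- shift n) = expR (- x) / c * (Num.sqrt (a n / b n) ^+ p / ell n).
  have -> : Num.sqrt (a n / b n) ^+ p = expR (alpha * ell n).
    rewrite -powR12_sqrt; last by rewrite divr_ge0// ltW.
    rewrite -powR_mulrn ?powR_ge0// -powRrM /powR gt_eqF ?divr_gt0//.
    by congr expR; congr (_ * _); field.
  have -> : - shift n = - x + (alpha * ell n - ln (ell n) - ln c) by rewrite /shift; ring.
  rewrite !expRD !expRN !lnK ?posrE//; field.
  by rewrite !gt_eqF ?expR_gt0.
have e2 : Num.sqrt (2 / q) ^+ p * (Num.sqrt (lam n * q) ^+ p * lap i0 mu (lam n * q)) =
    Num.sqrt (a n / b n) ^+ p * lap i0 mu (lam n * q).
  rewrite mulrA -exprMn -sqrtrM ?divr_ge0 ?ltW//.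
  by congr (Num.sqrt _ ^+ _ * _); field; rewrite !gt_eqF.
rewrite /= -[_ * _ ^+ p * _]mulrA e2 e1; field; by rewrite !gt_eqF.
Unshelve. all: by end_near. Qed.

Local Notation K := (alpha + 2).

(** The range of radii of the endpoints of edges has length [O(ell)], as
    [shift n] is about [- alpha ell], and [b ell] is negligible compared with
    [a], as [a / b = exp ell]. *)
Lemma shift_regime (del : R) : 0 < del -> \forall n \near \oo,
  [/\ 0 < a n, 0 < b n, shift n <= 0, A - shift n + 1 <= K * ell n &
      b n * (K * ell n) <= a n * (del / 8)].
Proof.
move=> del0; have al0 : 0 < alpha by rewrite divr_gt0.
have sc (C : R) : \forall n \near \oo, (alpha - 2^-1 * alpha) * ell n <= C - shift n <= (alpha + 1) * ell n.
  have mn0 : 0 < Num.min (2^-1 * alpha) 1 by rewrite lt_min mulr_gt0//=.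
  have /cvgrPdist_le/(_ _ mn0) h := shift_cvg C.
  near=> k; have : `|alpha - (C - shift k) / ell k| <= Num.min (2^-1 * alpha) 1 by near: k.
  have k0 : 0 < ell k by near: k; move/cvgryPgt : ell_cvg; exact.
  rewrite le_min => /andP[]; rewrite !ler_norml => /andP[_ h1] /andP[h2 _].
  apply/andP; split; first by rewrite -ler_pdivlMr//; lra.
  by rewrite -ler_pdivrMr//; lra.
near=> n.
have [a0 b0] : 0 < a n /\ 0 < b n by near: n.
have l1 : 1 <= ell n by near: n; move/cvgryPge : ell_cvg; exact.
have h1 : (alpha - 2^-1 * alpha) * ell n <= 0 - shift n <= (alpha + 1) * ell n.
  by near: n; exact: sc.
have h2 : (alpha - 2^-1 * alpha) * ell n <= A + 1 - shift n <= (alpha + 1) * ell n.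
  by near: n; exact: sc.
have h3 : 8 * K / del * 2 <= ell n by near: n; move/cvgryPge : ell_cvg; exact.
have e : a n = b n * expR (ell n).
  by rewrite lnK ?posrE ?divr_gt0// mulrC divfK// gt_eqF.
have h4 : 1 + (ell n) ^+ 2 / 2 <= expR (ell n).
  by apply: (@expR_ge1Dxn R _ 1); lra.
split => //.
- move: h1 => /andP[h1 _]; have : 0 <= (alpha - 2^-1 * alpha) * ell n; last lra.
  by rewrite mulr_ge0//; lra.
- move: h2 => /andP[_ h2]; have -> : K * ell n = (alpha + 1) * ell n + ell n by ring.
  lra.
rewrite [X in _ <= X * _]e -[leRHS]mulrA ler_pM2l//.
have h5 : K * (8 / del * 2) <= ell n by rewrite (_ : K * _ = 8 * K / del * 2)//; ring.
have h6 : K = K * (8 / del * 2) * (del / 16) by field; rewrite gt_eqF.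
apply: (@le_trans _ _ (ell n * (del / 16) * ell n)).
  by rewrite ler_wpM2r//; [lra|rewrite {1}h6 ler_wpM2r// divr_ge0// ltW].
have -> : ell n * (del / 16) * ell n = (ell n) ^+ 2 / 2 * (del / 8) by field.
by rewrite ler_wpM2r ?divr_ge0//; lra.
Unshelve. all: by end_near. Qed.

Lemma tail_regime (del : R) : 0 < del -> \forall n \near \oo,
  forall s, - (K * ell n) <= s -> s <= A ->
    (1 - del) * expR (- s) <= n%:R * pr [set x : E | a n + b n * s < en x] <=
    (1 + del) * expR (- s).
Proof.
move=> del0; near=> n => s s1 s2.
have al0 : 0 < alpha by rewrite divr_gt0.
have l1 : A <= ell n by near: n; move/cvgryPge : ell_cvg; exact.
suff : `|s| <= K * ell n.
  move: s {s1 s2}; near: n; apply: tail => //; lra.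
rewrite ler_norml s1/=; apply: le_trans s2 _.
have : 0 <= (alpha + 1) * ell n by rewrite mulr_ge0//; have := A0; lra.
have -> : K * ell n = (alpha + 1) * ell n + ell n by ring.
lra.
Unshelve. all: by end_near. Qed.

Local Notation phi n := (section_prob mu (radius n) (level n)).
(** Asymptotically twice the mean number of edges. *)
Definition pair_mean n : R := n%:R * (n%:R * \int[mu]_y phi n y).
(** The order of the mean number of pairs of edges with a common endpoint. *)
Definition triple_mean n : R := n%:R * (n%:R ^+ 2 * \int[mu]_y (phi n y ^+ 2)).

Local Notation sl q n := (ell n * expR (- shift n) * lap i0 mu (lam n * q)).
Local Notation sl_lim q := (pi0 * expR (- x) * (4 / p%:R) * Num.sqrt q^-1 ^+ p).

Let upper_lim del := (1 + del) ^+ 2 * sl_lim (1 - del) * alpha.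

Lemma pair_mean_upper (del e : R) : 0 < del -> del < 1 -> 0 < e ->
  \forall n \near \oo, pair_mean n * pi0 <= upper_lim del + e.
Proof.
move=> del0 del1 e0.
have q0 : 0 < 1 - del by rewrite subr_gt0.
have h : (1 + del) ^+ 2 * sl (1 - del) n * ((2 * A + 5 - shift n) / ell n) @[n --> \oo] -->
    upper_lim del.
  apply: cvgM; last exact: shift_cvg.
  by apply: cvgM; [exact: cvg_cst|exact: scaled_lap_cvg].
have /cvgrPdist_le/(_ _ e0) h' := h.
near=> n.
have hn : `|upper_lim del - (1 + del) ^+ 2 * sl (1 - del) n *
    ((2 * A + 5 - shift n) / ell n)| <= e by near: n.
have [a0 b0 y0 w1 w2] : [/\ 0 < a n, 0 < b n, shift n <= 0, A - shift n + 1 <= K * ell n &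
  b n * (K * ell n) <= a n * (del / 8)] by near: n; exact: shift_regime.
have G : forall s, - (K * ell n) <= s -> s <= A ->
    (1 - del) * expR (- s) <= n%:R * pr [set x : E | a n + b n * s < en x] <=
    (1 + del) * expR (- s) by near: n; exact: tail_regime.
have l0 : 0 < ell n by near: n; move/cvgryPgt : ell_cvg; exact.
have := pair_upper mu_rot a0 b0 (ltW del0) (ltW del1) (ler0n _ n) A0 y0 w1 w2 pi0_gt0 G.
rewrite -/(pair_mean n) => hu.
have E1 : (1 + del) * expR (- shift n) * lap i0 mu (lam n * (1 - del)) *
    ((1 + del) * (2 * A - shift n + 5)) =
    (1 + del) ^+ 2 * sl (1 - del) n * ((2 * A + 5 - shift n) / ell n).
  by field; rewrite gt_eqF.
rewrite E1 in hu; move: hn; rewrite ler_norml => /andP[hn _].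
apply: (le_trans hu); lra.
Unshelve. all: by end_near. Qed.

Let bracket del := (1 - del) * sl_lim (1 + del) - 2 * del * sl_lim ((1 + del) / 2).
Let lower_lim del := bracket del * ((1 - del) * alpha).

(** Take [Bd = - 2 ln del], so that [exp (- Bd / 2) = del]. *)
Lemma pair_mean_lower (del e : R) : 0 < del -> del < 1 -> 0 < bracket del -> 0 < e ->
  \forall n \near \oo, lower_lim del - e <= pair_mean n * pi0.
Proof.
move=> del0 del1 br0 e0.
have q1 : 0 < 1 + del by rewrite addr_gt0.
have q2 : 0 < (1 + del) / 2 by rewrite divr_gt0.
pose Bd := - (2 * ln del).
have Bd0 : 0 <= Bd by rewrite oppr_ge0 pmulr_rle0// ln_le0// ltW.
have eB : expR (- (Bd / 2)) = del.
  have -> : - (Bd / 2) = ln del by rewrite /Bd; field.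
  by rewrite lnK.
pose br n := (1 - del) * sl (1 + del) n - 2 * del * sl ((1 + del) / 2) n.
have hbr : br n @[n --> \oo] --> bracket del.
  by apply: cvgB; (apply: cvgM; [exact: cvg_cst|exact: scaled_lap_cvg]).
have h : br n * ((1 - del) * ((2 * A - Bd - shift n) / ell n) - 3 * (ell n)^-1) @[n --> \oo] -->
    bracket del * ((1 - del) * alpha - 3 * 0).
  apply: cvgM => //; apply: cvgB; (apply: cvgM; first exact: cvg_cst).
    exact: shift_cvg.
  exact: inv_ell_cvg0.
rewrite mulr0 subr0 -/(lower_lim del) in h.
have /cvgrPdist_le/(_ _ e0) h' := h.
have /cvgrPdist_lt/(_ _ br0) hb := hbr.
have al0 : 0 < alpha by rewrite divr_gt0.
near=> n.
have hn : `|lower_lim del - br n * ((1 - del) * ((2 * A - Bd - shift n) / ell n) -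
  3 * (ell n)^-1)| <= e by near: n.
have bn : `|bracket del - br n| < bracket del by near: n.
have [a0 b0 y0 w1 w2] : [/\ 0 < a n, 0 < b n, shift n <= 0, A - shift n + 1 <= K * ell n &
  b n * (K * ell n) <= a n * (del / 8)] by near: n; exact: shift_regime.
have G : forall s, - (K * ell n) <= s -> s <= A ->
    (1 - del) * expR (- s) <= n%:R * pr [set x : E | a n + b n * s < en x] <=
    (1 + del) * expR (- s) by near: n; exact: tail_regime.
have l0 : 0 < ell n by near: n; move/cvgryPgt : ell_cvg; exact.
have c0 : `|alpha - (2 * A - Bd - shift n) / ell n| < alpha.
  by near: n; have /cvgrPdist_lt := shift_cvg (2 * A - Bd); apply.
have hB : shift n - A + Bd <= A.
  move: c0; rewrite ltr_norml => /andP[_ c0].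
  have : 0 < (2 * A - Bd - shift n) / ell n by lra.
  by rewrite pmulr_lgt0 ?invr_gt0//; lra.
have := pair_lower mu_rot a0 b0 (ltW del0) (ltW del1) (ler0n _ n) A0 y0 w1 w2 pi0_gt0 G Bd0 hB.
rewrite -/(pair_mean n) eB.
set Cl := (_ - _); have E1 : br n = ell n * expR (- shift n) * Cl by rewrite /br /Cl; ring.
have lC0 : 0 <= Cl.
  move: bn; rewrite E1 ltr_norml => /andP[_].
  rewrite gtrBl pmulr_rgt0; first exact: ltW.
  by rewrite mulr_gt0// expR_gt0.
move=> /= /(_ lC0) hl; apply: le_trans hl.
have -> : expR (- shift n) * Cl * ((1 - del) * (2 * A - shift n - Bd) - 3) =
   br n * ((1 - del) * ((2 * A - Bd - shift n) / ell n) - 3 * (ell n)^-1).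
  by rewrite E1; field; rewrite gt_eqF.
by move: hn; rewrite ler_norml => /andP[_ hn]; lra.
Unshelve. all: by end_near. Qed.

Lemma sl_lim_cvg (f : R -> R) (q : R) : 0 < q -> f del @[del --> 0^'+] --> q ->
  sl_lim (f del) @[del --> 0^'+] --> sl_lim q.
Proof.
move=> q0 h; apply: cvgM; first exact: cvg_cst.
have h1 : (f del)^-1 @[del --> 0^'+] --> q^-1 by apply: cvgV; rewrite ?gt_eqF.
have h2 := cvg_comp _ _ h1 (@sqrt_continuous R _).
exact: (cvg_comp _ _ h2 (@exprn_continuous R p _)).
Qed.

(** As [del] tends to 0, the bounds of [pair_mean_upper] and [pair_mean_lower]
    have the same limit. *)
Theorem pair_mean_cvg : pair_mean n @[n --> \oo] --> 2 * expR (- x).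
Proof.
suff h : pair_mean n * pi0 @[n --> \oo] --> 2 * expR (- x) * pi0.
  have h2 : pair_mean n * pi0 * pi0^-1 @[n --> \oo] --> 2 * expR (- x) * pi0 * pi0^-1.
    by apply: cvgM => //; exact: cvg_cst.
  rewrite mulfK ?gt_eqF// in h2; apply: cvg_trans h2; apply: near_eq_cvg; near=> n.
  by rewrite mulfK ?gt_eqF.
have id0 : (del : R) @[del --> (0 : R)^'+] --> (0 : R) by apply: cvg_at_right_filter; exact: cvg_id.
have d1 : 1 - del @[del --> (0 : R)^'+] --> (1 - 0 : R) by apply: cvgB => //; exact: cvg_cst.
have d2 : 1 + del @[del --> (0 : R)^'+] --> (1 + 0 : R) by apply: cvgD => //; exact: cvg_cst.
have d3 : (1 + del) / 2 @[del --> (0 : R)^'+] --> ((1 + 0) / 2 : R).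
  by apply: cvgM => //; exact: cvg_cst.
rewrite subr0 in d1; rewrite addr0 in d2 d3.
have one1 : sl_lim 1 = pi0 * expR (- x) * (4 / p%:R).
  by rewrite invr1 sqrtr1 expr1n mulr1.
have limE : sl_lim 1 * alpha = 2 * expR (- x) * pi0.
  by rewrite one1; field.
have up : upper_lim del @[del --> (0 : R)^'+] --> 2 * expR (- x) * pi0.
  rewrite -limE -[sl_lim 1]mul1r -[X in X * sl_lim 1](expr1n _ 2).
  apply: cvgM; last exact: cvg_cst.
  apply: cvgM; last exact: sl_lim_cvg.
  exact: (cvg_comp _ _ d2 (@exprn_continuous R 2 _)).
have br : bracket del @[del --> (0 : R)^'+] --> sl_lim 1.
  have -> : sl_lim 1 = 1 * sl_lim 1 - 2 * 0 * sl_lim (1 / 2) by rewrite mul1r mulr0 mul0r subr0.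
  apply: cvgB; (apply: cvgM; last by apply: sl_lim_cvg => //; rewrite divr_gt0).
    exact: d1.
  by apply: cvgM => //; exact: cvg_cst.
have lo : lower_lim del @[del --> (0 : R)^'+] --> 2 * expR (- x) * pi0.
  have -> : 2 * expR (- x) * pi0 = sl_lim 1 * (1 * alpha) by rewrite mul1r limE.
  by apply: cvgM => //; apply: cvgM => //; exact: cvg_cst.
have sl0 : 0 < sl_lim 1 by rewrite one1 !mulr_gt0 ?expR_gt0// invr_gt0.
apply/cvgrPdist_le => e e0; have e2 : 0 < e / 2 by rewrite divr_gt0.
near (0 : R)^'+ => del.
have del0 : 0 < del by near: del; exact: nbhs_right_gt.
have del1 : del < 1 by near: del; exact: nbhs_right_lt.
have hu : `|2 * expR (- x) * pi0 - upper_lim del| <= e / 2.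
  by near: del; move/cvgrPdist_le : up; exact.
have hl : `|2 * expR (- x) * pi0 - lower_lim del| <= e / 2.
  by near: del; move/cvgrPdist_le : lo; exact.
have hb : `|sl_lim 1 - bracket del| < sl_lim 1.
  by near: del; move/cvgrPdist_lt : br; exact.
have br0 : 0 < bracket del by move: hb; rewrite ltr_norml => /andP[_]; rewrite gtrBl.
near=> n.
have h1 : pair_mean n * pi0 <= upper_lim del + e / 2.
  by near: n; exact: pair_mean_upper.
have h2 : lower_lim del - e / 2 <= pair_mean n * pi0.
  by near: n; exact: pair_mean_lower.
move: hu hl; rewrite !ler_norml => /andP[u1 u2] /andP[l1 l2].
by apply/andP; split; lra.
Unshelve. all: by end_near. Qed.

(** [triple_upper] is of order [(1 / ell) ^ 2 * ell]. *)
Theorem triple_mean_cvg0 : triple_mean n @[n --> \oo] --> (0 : R).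
Proof.
pose r : R := 1 / 2.
have q0 : 0 < 1 - r by rewrite /r; lra.
have h : (1 + r) ^+ 3 * (sl (1 - r) n) ^+ 2 * expR A * pi0 ^- 2 *
    ((2 * A + 5 - shift n) / ell n) * (ell n)^-1 @[n --> \oo] -->
    (1 + r) ^+ 3 * (sl_lim (1 - r)) ^+ 2 * expR A * pi0 ^- 2 * alpha * 0.
  apply: cvgM; last exact: inv_ell_cvg0.
  apply: cvgM; last exact: shift_cvg.
  do 2 (apply: cvgM; last exact: cvg_cst).
  apply: cvgM; first exact: cvg_cst.
  have hs : sl (1 - r) n @[n --> \oo] --> sl_lim (1 - r) by exact: scaled_lap_cvg.
  exact: (cvg_comp _ _ hs (@exprn_continuous R 2 _)).
rewrite mulr0 in h.
apply: (squeeze_cvgr _ (cvg_cst 0) h); near=> n.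
have [a0 b0 y0 w1 w2] : [/\ 0 < a n, 0 < b n, shift n <= 0, A - shift n + 1 <= K * ell n &
  b n * (K * ell n) <= a n * (r / 8)] by near: n; apply: shift_regime; rewrite /r; lra.
have G : forall s, - (K * ell n) <= s -> s <= A ->
    (1 - r) * expR (- s) <= n%:R * pr [set x : E | a n + b n * s < en x] <=
    (1 + r) * expR (- s) by near: n; apply: tail_regime; rewrite /r; lra.
have l0 : 0 < ell n by near: n; move/cvgryPgt : ell_cvg; exact.
apply/andP; split.
  rewrite mulr_ge0// mulr_ge0 ?exprn_ge0//.
  by apply: Rintegral_ge0 => y _; rewrite exprn_ge0// fine_ge0.
have r0 : 0 <= r by rewrite /r; lra.
have r1 : r <= 1 by rewrite /r; lra.
have := triple_upper mu_rot a0 b0 r0 r1 (ler0n _ n) A0 y0 w1 w2 pi0_gt0 G.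
rewrite -/(triple_mean n) -ler_pdivlMr ?exprn_gt0// => hu.
apply: (le_trans hu); rewrite le_eqVlt; apply/orP; left; apply/eqP.
by field; rewrite !gt_eqF.
Unshelve. all: by end_near. Qed.

End mean_number_of_edges.

(** * Absence of edges and the maximum *)

(** [exp (- q / (1 - q)) <= 1 - q <= exp (- q)]. *)
Lemma exp_power_cvg (R : realType) (N : nat -> nat) (q : nat -> R) (l : R) :
  (\forall n \near \oo, 0 <= q n) -> q n @[n --> \oo] --> (0 : R) ->
  (N n)%:R * q n @[n --> \oo] --> l ->
  (1 - q n) ^+ N n @[n --> \oo] --> expR (- l).
Proof.
move=> q_ge0 q0 Nq.
have up : expR (- ((N n)%:R * q n)) @[n --> \oo] --> expR (- l).
  have h : - ((N n)%:R * q n) @[n --> \oo] --> - l by exact: cvgN.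
  exact: (cvg_comp _ _ h (@continuous_expR R _)).
have lo : expR (- ((N n)%:R * q n / (1 - q n))) @[n --> \oo] --> expR (- l).
  have h : - ((N n)%:R * q n / (1 - q n)) @[n --> \oo] --> - (l / (1 - 0)).
    apply: cvgN; apply: cvgM => //; apply: cvgV; first by rewrite subr0 oner_neq0.
    by apply: cvgB => //; exact: cvg_cst.
  rewrite subr0 divr1 in h.
  exact: (cvg_comp _ _ h (@continuous_expR R _)).
apply: (squeeze_cvgr _ lo up); near=> n.
have q0n : 0 <= q n by near: n.
have q1n : q n < 1.
  near: n; have /cvgrPdist_lt/(_ 1 ltr01) := q0; apply: filterS => n.
  by rewrite sub0r normrN => /(le_lt_trans (ler_norm _)).
have s0 : 0 < 1 - q n by rewrite subr_gt0.
have -> : - ((N n)%:R * q n / (1 - q n)) = (N n)%:R * - (q n / (1 - q n)) by ring.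
have -> : - ((N n)%:R * q n) = (N n)%:R * - q n by ring.
rewrite !expRM_natl; apply/andP; split.
  apply: lerXn2r; rewrite ?nnegrE ?expR_ge0 ?(ltW s0)//.
  rewrite expRN -[leRHS]invrK lef_pV2 ?posrE ?expR_gt0 ?invr_gt0//.
  apply: le_trans (expR_ge1Dx _).
  by rewrite le_eqVlt; apply/orP; left; apply/eqP; field; rewrite gt_eqF.
apply: lerXn2r; rewrite ?nnegrE ?expR_ge0 ?(ltW s0)//.
exact: expR_ge1Dx.
Unshelve. all: by end_near. Qed.

Section maximum.
Context dT (T : measurableType dT) (R : realType) (P : probability T R) (m : nat).
Local Notation d := m.+2.
Local Notation E := (borel_rV R d).
Local Notation en x := (enorm (x : 'rV[R]_d)).
Variable X : nat -> {RV P >-> E}.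
Local Notation M := (max_interpoint_dist X).
Local Notation pr S := (fine (P S)).

Lemma measurable_bigmax (I : Type) (s : seq I) (Q : pred I) (F : I -> T -> R) :
  (forall i, measurable_fun setT (F i)) ->
  measurable_fun setT (fun t => \big[Num.max/0]_(i <- s | Q i) F i t).
Proof.
move=> mF; elim: s => [|i s IHs].
  by under eq_fun do rewrite big_nil; exact: measurable_cst.
under eq_fun do rewrite big_cons; case: (Q i) => //.
exact: measurable_maxr.
Qed.

Lemma measurable_max n : measurable_fun setT (M n).
Proof.
apply: measurable_bigmax => e; apply: measurable_enormB; exact: measurable_funPT.
Qed.

Lemma measurable_max_le n u : measurable [set t | M n t <= u].
Proof.
apply: measurable_bool_set.
by apply: measurable_fun_ler; [exact: measurable_max|exact: measurable_cst].
Qed.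

Let far r (i : nat) : set T := [set t | r < en (X i t)].

Let measurable_far r i : measurable (far r i).
Proof.
apply: measurable_bool_set; apply: measurable_fun_ltr; first exact: measurable_cst.
exact: (measurableT_comp (@measurable_enormE R m) (@measurable_funPT _ _ _ _ (X i))).
Qed.

Lemma max_le_none B u n : pr [set t | M n t <= u] <=
  pr (none (pair_event X B u (n := n)) (pair_list n)).
Proof.
apply: le_pr; first exact: measurable_max_le.
  by apply: measurable_none => f; exact: measurable_edge_event.
move=> t /= Mu e; rewrite mem_filter => /andP[e12 _] /and3P[_ _].
apply/negP; rewrite -leNgt; apply: le_trans Mu.
exact: (le_bigmax_cond _ (fun e : 'I_n * 'I_n => en ((X e.1 t : 'rV[R]_d) - (X e.2 t : 'rV[R]_d))) e12).
Qed.

(** If the maximum exceeds [u] although there is no edge, an endpoint of a pair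
    at distance more than [u] lies outside the ball of radius [B]. *)
Lemma none_le_max B u n : 0 <= u ->
  pr (none (pair_event X B u (n := n)) (pair_list n)) <=
  pr [set t | M n t <= u] + \sum_(i <- iota 0 n) pr [set t | B < en (X i t)].
Proof.
move=> u0; set N := none _ _.
have mN : measurable N by apply: measurable_none => f; exact: measurable_edge_event.
have := pr_none_ge P (measurable_far B) (iota 0 n) mN.
move=> /le_trans; apply; apply: lerD.
  apply: le_pr; [|exact: measurable_max_le|].
    by apply: measurableI => //; apply: measurable_none.
  move=> t [h1 h2] /=; apply/bigmax_leP; split => // e e12; rewrite leNgt; apply/negP => h.
  have e_in : e \in pair_list n by rewrite mem_filter e12 mem_enum.
  have near_i (i : 'I_n) : en (X i t) <= B.
    by rewrite leNgt; apply/negP; apply: (h2 i); rewrite mem_iota/=.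
  by apply: (h1 e e_in); apply/and3P; split.
have mF := measurable_far B; apply: ler_sum => i _; apply: le_pr; [|exact: mF|by move=> t []].
by apply: measurableI; [|exact: mF].
Qed.

End maximum.

(** * Gumbel limit *)

Section maximum_limit.
Context dT (T : measurableType dT) (R : realType) (P : probability T R) (m : nat).
Local Notation d := m.+2.
Local Notation E := (borel_rV R d).
Variable i0 : 'I_d.
Variables (X : nat -> {RV P >-> E}) (mu : probability E R).
Hypothesis X_indep : independent_sequence X.
Hypothesis X_law : forall i (A : set E), measurable A -> distribution P (X i) A = mu A.
Hypothesis mu_rot : forall Q : 'M[R]_d, Q *m Q^T = 1%:M ->
  forall A : set E, measurable A -> mu [set x | A ((x : 'rV[R]_d) *m Q)] = mu A.
Hypothesis pi0_gt0 : 0 < moment i0 mu 0.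
Local Notation en x := (enorm (x : 'rV[R]_d)).
Local Notation M := (max_interpoint_dist X).
Local Notation pr S := (fine (P S)).

Variables a b : nat -> R.
Local Notation ell n := (ln (a n / b n)).
Hypothesis ab_gt0 : \forall n \near \oo, 0 < a n /\ 0 < b n.
Hypothesis ell_cvg : ell n @[n --> \oo] --> +oo.
Hypothesis tail : forall K del : R, 0 < K -> 0 < del -> \forall n \near \oo,
  forall t : R, `|t| <= K * ell n ->
    (1 - del) * expR (- t) <= n%:R * fine (mu [set x : E | a n + b n * t < en x]) <=
    (1 + del) * expR (- t).

Variable x : R.
Local Notation level n := (level m a b x n).
Local Notation limit := (expR (- expR (- x))).

Section truncation.
Variable A : R.
Hypothesis A0 : 0 <= A.
Local Notation radius n := (radius a b A n).
Local Notation phi n := (section_prob mu (radius n) (level n)).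
Local Notation p n := (\int[mu]_y phi n y).
Local Notation q n := (\int[mu]_y (phi n y ^+ 2)).
Local Notation none_n n :=
  (none (pair_event X (radius n) (level n) (n := n)) (pair_list n)).

(** The mean number of edges tends to [exp (- x)], and the error of the binomial
    approximation is a combination of [triple_mean] and [pair_mean ^ 2 / n]. *)
Lemma none_cvg : pr (none_n n) @[n --> \oo] --> limit.
Proof.
have pm : n%:R * (n%:R * p n) @[n --> \oo] --> 2 * expR (- x).
  exact: (pair_mean_cvg mu_rot pi0_gt0 ab_gt0 ell_cvg tail A0).
have tm : n%:R * (n%:R ^+ 2 * q n) @[n --> \oo] --> (0 : R).
  exact: (@triple_mean_cvg0 _ _ _ _ mu_rot pi0_gt0 _ _ ab_gt0 ell_cvg tail x _ A0).
have inv : (n%:R : R)^-1 @[n --> \oo] --> (0 : R).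
  apply/gtr0_cvgV0; last exact: cvgr_idn.
  by near=> n; rewrite ltr0n; near: n; exact: nbhs_infty_gt.
have binE n : ('C(n, 2)%:R : R) = n%:R * (n%:R - 1) / 2.
  case: n => [|n]; first by rewrite bin_small// mul0r mul0r.
  have h : ('C(n.+1, 2).*2)%:R = (n.+1 * n)%:R :> R.
    by congr (_%:R); rewrite bin2 /= -[RHS]odd_double_half oddM /= andNb.
  rewrite -mul2n !natrM in h.
  have -> : (n.+1%:R - 1 : R) = n%:R by rewrite -natr1 addrK.
  by rewrite -h; field.
have p0 : p n @[n --> \oo] --> (0 : R).
  have h : n%:R * (n%:R * p n) * n%:R^-1 * n%:R^-1 @[n --> \oo] --> 2 * expR (- x) * 0 * 0.
    by apply: cvgM => //; exact: cvgM.
  rewrite mulr0 in h; apply: cvg_trans h; apply: near_eq_cvg; near=> n.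
  have n0 : (n%:R : R) != 0 by rewrite pnatr_eq0 -lt0n; near: n; exact: nbhs_infty_gt.
  by field.
have Np : 'C(n, 2)%:R * p n @[n --> \oo] --> expR (- x).
  have h : n%:R * (n%:R * p n) * (1 - n%:R^-1) / 2 @[n --> \oo] -->
      2 * expR (- x) * (1 - 0) / 2.
    apply: cvgM; last exact: cvg_cst.
    by apply: cvgM => //; apply: cvgB => //; exact: cvg_cst.
  rewrite subr0 (_ : 2 * expR (- x) * 1 / 2 = expR (- x)) in h; last by field.
  apply: cvg_trans h; apply: near_eq_cvg; near=> n.
  have n0 : (n%:R : R) != 0 by rewrite pnatr_eq0 -lt0n; near: n; exact: nbhs_infty_gt.
  by rewrite /= binE; field.
have lim : (1 - p n) ^+ 'C(n, 2) @[n --> \oo] --> limit.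
  apply: exp_power_cvg => //.
  by near=> n; apply: Rintegral_ge0 => y _; exact: fine_ge0.
have err : 2 * (n%:R * (n%:R ^+ 2 * q n) +
    (n%:R * (n%:R * p n)) ^+ 2 * n%:R^-1) @[n --> \oo] --> (0 : R).
  have h : 2 * (n%:R * (n%:R ^+ 2 * q n) +
    (n%:R * (n%:R * p n)) ^+ 2 * n%:R^-1) @[n --> \oo] -->
    2 * (0 + (2 * expR (- x)) ^+ 2 * 0).
    apply: cvgM; first exact: cvg_cst.
    apply: cvgD => //; apply: cvgM => //.
    exact: (cvg_comp _ _ pm (@exprn_continuous R 2 _)).
  by rewrite mulr0 addr0 mulr0 in h.
apply/cvgrPdist_le => e e0; have e2 : 0 < e / 2 by rewrite divr_gt0.
near=> n.
have n0 : (n%:R : R) != 0 by rewrite pnatr_eq0 -lt0n; near: n; exact: nbhs_infty_gt.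
have q0 : 0 <= q n by apply: Rintegral_ge0 => y _; rewrite exprn_ge0// fine_ge0.
have l1 : `|limit - (1 - p n) ^+ 'C(n, 2)| <= e / 2.
  by near: n; move/cvgrPdist_le : lim; exact.
have l2 : `|0 - 2 * (n%:R * (n%:R ^+ 2 * q n) +
    (n%:R * (n%:R * p n)) ^+ 2 * n%:R^-1)| <= e / 2.
  by near: n; move/cvgrPdist_le : err; exact.
have l3 := no_edge_binomial X_indep X_law (radius n) (level n) n.
have l4 : 'C(n, 2)%:R * (4 * n)%:R * (q n + p n ^+ 2) <=
    2 * (n%:R * (n%:R ^+ 2 * q n) + (n%:R * (n%:R * p n)) ^+ 2 * n%:R^-1).
  have -> : 2 * (n%:R * (n%:R ^+ 2 * q n) + (n%:R * (n%:R * p n)) ^+ 2 * n%:R^-1) =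
    n%:R * n%:R / 2 * (4 * n)%:R * (q n + p n ^+ 2) by rewrite natrM; field.
  apply: ler_wpM2r; first by rewrite addr_ge0// sqr_ge0.
  apply: ler_wpM2r => //; rewrite binE; apply: ler_wpM2r => //.
  by apply: ler_wpM2l => //; rewrite gerBl.
rewrite sub0r normrN in l2; have l5 := le_trans (ler_norm _) l2.
rewrite -(subrK ((1 - p n) ^+ 'C(n, 2)) limit) -addrA.
apply: (le_trans (ler_normD _ _)); rewrite [leRHS](splitr e); apply: lerD => //.
by rewrite distrC; apply: (le_trans l3); apply: (le_trans l4).
Unshelve. all: by end_near. Qed.

Lemma far_points : \forall n \near \oo,
  \sum_(i <- iota 0 n) pr [set t | radius n < en (X i t)] <= 2 * expR (- A).
Proof.
near=> n.
have l0 : A <= ell n by near: n; move/cvgryPge : ell_cvg; exact.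
have := A0 => A0'.
have : `|A| <= 1 * ell n by rewrite mul1r ger0_norm.
have -> : \sum_(i <- iota 0 n) pr [set t | radius n < en (X i t)] =
    n%:R * fine (mu [set x : E | a n + b n * A < en x]).
  rewrite -[X in X%:R * _](size_iota 0 n) -sum1_size natr_sum mulr_suml.
  apply: eq_bigr => i _; rewrite mul1r; congr fine; rewrite -(X_law i)//.
  apply: measurable_bool_set; apply: measurable_fun_ltr; first exact: measurable_cst.
  exact: measurable_enormE.
have -> : 2 * expR (- A) = (1 + 1) * expR (- A) by [].
move: (A) => A1 h; suff /andP[]: (1 - 1) * expR (- A1) <=
  n%:R * fine (mu [set x : E | a n + b n * A1 < en x]) <= (1 + 1) * expR (- A1) by [].
by move: A1 h; near: n; exact: tail.
Unshelve. all: by end_near. Qed.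

Lemma level_ge0 : \forall n \near \oo, 0 <= level n.
Proof.
near=> n.
have [a0 b0 y0 w1 w2] : [/\ 0 < a n, 0 < b n, shift m a b x n <= 0,
    A - shift m a b x n + 1 <= (m.+1%:R / 2 + 2) * ell n &
    b n * ((m.+1%:R / 2 + 2) * ell n) <= a n * (1 / 8)].
  by near: n; apply: shift_regime.
rewrite -[X in 0 <= X]/(2 * a n + b n * shift m a b x n).
have h := ler_wpM2l (ltW b0) w1.
have bA : 0 <= b n * A by rewrite mulr_ge0// ltW.
by rewrite !mulrDr mulrN mulr1 in h; lra.
Unshelve. all: by end_near. Qed.

End truncation.

(** The truncation at [A] changes the probability by at most [2 exp (- A)]
    asymptotically, for every [A]. *)
Theorem max_cvg : pr [set t | M n t <= level n] @[n --> \oo] --> limit.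
Proof.
apply/cvgrPdist_le => e e0; have e2 : 0 < e / 2 by rewrite divr_gt0.
pose A := Num.max 0 (- ln (e / 4)).
have A0 : 0 <= A by rewrite le_max lexx.
have eA : 2 * expR (- A) <= e / 2.
  have h : expR (- A) <= e / 4.
    have e4 : 0 < e / 4 by rewrite divr_gt0.
    by rewrite -[leRHS]lnK// ler_expR lerNl le_max lexx orbT.
  lra.
near=> n.
have h1 : `|limit - pr (none (pair_event X (radius a b A n) (level n) (n := n))
    (pair_list n))| <= e / 2.
  by near: n; move/cvgrPdist_le : (none_cvg A0); exact.
have h2 : \sum_(i <- iota 0 n) pr [set t | radius a b A n < en (X i t)] <= 2 * expR (- A).
  by near: n; exact: far_points.
have h3 : 0 <= level n by near: n; exact: (level_ge0 A0).
have h4 := max_le_none X (radius a b A n) (level n) n.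
have h5 := none_le_max X (radius a b A n) n h3.
move: h1; rewrite !ler_norml => /andP[h1 h1']; apply/andP; split; lra.
Unshelve. all: by end_near. Qed.

End maximum_limit.

Lemma moment0_gt0 (R : realType) (m : nat) (i0 : 'I_m.+2)
    (mu : probability (borel_rV R m.+2) R) (r : R) : 0 <= r ->
  0 < fine (mu [set x : borel_rV R m.+2 | r < enorm (x : 'rV[R]_m.+2)]) ->
  0 < moment i0 mu 0.
Proof.
move=> r0 mu0; rewrite /moment.
under eq_Rintegral do rewrite expr0 mul1r.
have mnz : measurable_fun setT (fun y : borel_rV R m.+2 => enorm (y : 'rV[R]_m.+2) != 0).
  apply: measurable_neg; apply: measurable_fun_eqr; last exact: measurable_cst.
  exact: measurable_enormE.
rewrite /nonzero Rintegral_natr_bool//; apply: (lt_le_trans mu0); apply: le_pr.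
- apply: measurable_bool_set; apply: measurable_fun_ltr; first exact: measurable_cst.
  exact: measurable_enormE.
- exact: measurable_bool_set.
by move=> y /= ry; rewrite gt_eqF// (le_lt_trans r0).
Qed.

(* The sample X_1, X_2, ... is indexed from 0: Xs i is X_(i+1). *)
Theorem theorem1p4 (R : realType)
    (disp : measure_display) (Omega : measurableType disp)
    (P : probability Omega R)
    (disp' : measure_display) (Omega' : measurableType disp')
    (P' : probability Omega' R)
    (d : nat) (d_ge2 : (2 <= d)%N)
    (X : {RV P >-> borel_rV R d}) (Xs : nat -> {RV P >-> borel_rV R d})
    (Xs_indep : independent_sequence Xs)
    (Xs_ident : forall i, same_distribution (Xs i) X)
    (X_symm : spherically_symmetric X)
    (g : R -> R)
    (g_tail : exists2 e : R -> R, e x @[x --> +oo] --> 0 &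
       \forall x \near +oo,
         P [set t | x < enorm (X t)] = (expR (- g x + e x))%:E)
    (g_twice_derivable : \forall x \near +oo,
       derivable g x 1 /\ derivable (derive1 g) x 1)
    (g_cond1 : x * derive1 g x @[x --> +oo] --> +oo)
    (g_cond2 :
       derive1n 2 g x / derive1 g x ^+ 2 * ln (x * derive1 g x) ^+ 2 @[x --> +oo] --> 0)
    (a b : nat -> R)
    (a_cvg : a n @[n --> \oo] --> +oo)
    (g_a : g (a n) - ln n%:R @[n --> \oo] --> 0)
    (b_a : exists2 e : nat -> R,
       e =o_\oo (fun n => (ln (a n * derive1 g (a n)))^-1) &
       \forall n \near \oo, b n = (1 + e n) / derive1 g (a n))
    (V : {RV P' >-> R}) (V_Gumbel : Gumbel V) :
  cvg_in_distribution P
    (fun n t =>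
       (max_interpoint_dist Xs n t - 2 * a n) / b n
       + (d%:R - 1) / 2 * ln (a n / b n)
       - ln (ln (a n / b n)) - ln (c_ R d))
    V.
Proof.
case: d d_ge2 X Xs Xs_indep Xs_ident X_symm g_tail => [|[|m]]// _ {}X {}Xs {}Xs_indep
  {}Xs_ident {}X_symm {}g_tail.
pose mu : probability (borel_rV R m.+2) R := distribution P X.
pose T r := fine (mu [set y : borel_rV R m.+2 | r < enorm (y : 'rV[R]_m.+2)]).
have T_tail : exists2 e : R -> R, e x @[x --> +oo] --> 0 &
    \forall x \near +oo, T x = expR (- g x + e x).
  have [e e0 he] := g_tail; exists e => //.
  by near=> r; have -> : T r = fine (P [set t | r < enorm (X t)]) by [];
    rewrite (_ : P _ = (expR (- g r + e r))%:E)//; near: r.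
have rb := ratio_bounds g_cond1 a_cvg b_a.
have ab0 : \forall n \near \oo, 0 < a n /\ 0 < b n.
  by near=> n; have [] : [/\ 0 < a n, 0 < b n, 0 <= ln (a n / b n) &
    `|ln (a n / b n) - ln (a n * derive1 g (a n))| <= 1] by near: n; exact: rb.
have ell_cvg := ratio_cvg g_cond1 a_cvg b_a.
have tail := tail_uniform T_tail g_twice_derivable g_cond1 g_cond2 a_cvg g_a b_a.
have pi0 : 0 < moment (@ord0 m.+1) mu 0.
  have [e e0 he] := T_tail.
  near (pinfty_nbhs R) => r; apply: (@moment0_gt0 _ _ _ _ r).
    by near: r; apply: nbhs_pinfty_ge; exact: num_real.
  have hr : T r = expR (- g r + e r) by near: r.
  by rewrite -/(T r) hr expR_gt0.
have mZ n : measurable_fun setT (fun t =>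
    (max_interpoint_dist Xs n t - 2 * a n) / b n + (m.+2%:R - 1) / 2 * ln (a n / b n) -
    ln (ln (a n / b n)) - ln (c_ R m.+2)).
  do 2 (apply: measurable_funB; last exact: measurable_cst).
  apply: measurable_funD; last exact: measurable_cst.
  apply: measurable_funM; last exact: measurable_cst.
  by apply: measurable_funB; [exact: measurable_max|exact: measurable_cst].
split=> // x _.
rewrite V_Gumbel.
have h := @max_cvg _ _ _ _ _ ord0 Xs mu Xs_indep Xs_ident X_symm pi0 a b ab0 ell_cvg tail x.
apply: cvg_EFin.
  near=> n; rewrite fin_num_measure//; apply: measurable_bool_set.
  by apply: measurable_fun_ler; [exact: mZ|exact: measurable_cst].
apply: cvg_trans h; apply: near_eq_cvg; near=> n.
have [a0 b0] : 0 < a n /\ 0 < b n by near: n.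
congr (fine (P _)); apply/seteqP; rewrite /level /shift.
have e : (m.+2%:R - 1 : R) = m.+1%:R by rewrite -natr1 addrK.
suff eq t : (max_interpoint_dist Xs n t - 2 * a n) / b n +
      (m.+2%:R - 1) / 2 * ln (a n / b n) - ln (ln (a n / b n)) - ln (c_ R m.+2) <= x =
    (max_interpoint_dist Xs n t <= 2 * a n +
      b n * (x - (m.+1%:R / 2 * ln (a n / b n) - ln (ln (a n / b n)) - ln (c_ R m.+2)))).
  by split => t /=; rewrite eq.
rewrite e -[RHS]lerBlDl (mulrC (b n)) -[RHS]ler_pdivrMr// [RHS]lerBrDr.
by congr (_ <= _); ring.
Unshelve. all: by end_near. Qed.
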